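(* Let $g_k(z,u,t)$ and $h_k(z,u,t)$, $k\ge1$, be formal power series in $z,u,t$ with rational coefficients. Let $C(z,u,t)$ be the generating function of rooted planar maps with a weight $z$ per face, a weight $u$ per non-root vertex, a weight $t$ per edge, a weight $g_k(z,u,t)$ per non-root vertex of degree $k$ and a weight $h_k(z,u,t)$ if the root vertex has degree $k$. If $\sum_{k\ge1}g_k(z,u,t)v^k$ and $\sum_{k\ge1}h_k(z,u,t)v^k$ are holonomic series (with respect to the variables $z,u,t,v$), then $C$ is differentially algebraic with respect to $t$, with respect to $u$ and with respect to $z$.
   Context: A rooted planar map is a connected graph (loops and multiple edges allowed) embedded in the sphere up to orientation-preserving homeomorphism, with a distinguished corner whose incident vertex is the root vertex. A formal power series $A(z_1,\dots,z_m)$ with rational coefficients is holonomic (D-finite) if the $\mathbb Q(z_1,\dots,z_m)$-vector space spanned by all its partial derivatives $\partial^{i_1+\dots+i_m}A/\partial z_1^{i_1}\cdots\partial z_m^{i_m}$ is finite-dimensional. It is differentially algebraic with respect to $z_i$ if there exist $n\ge0$ and a nonzero polynomial $P$ with rational coefficients such that $P(A,\partial A/\partial z_i,\dots,\partial^nA/\partial z_i^n,z_1,\dots,z_m)=0$. *)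

(* Defs.v *)
From HB Require Import structures.
From mathcomp Require Import all_boot all_order all_algebra all_fingroup.
From mathcomp Require Import mpoly.
Set Implicit Arguments. Unset Strict Implicit. Unset Printing Implicit Defensive.
Import Order.TTheory GRing.Theory Num.Theory.
Local Open Scope ring_scope.

Definition series (k : nat) := 'X_{1..k} -> rat.

Definition szero k : series k := fun _ => 0.
Definition sone k : series k := fun m => if m == 0%MM then 1 else 0.
Definition sadd k (f g : series k) : series k := fun m => f m + g m.
Definition sscale k (c : rat) (f : series k) : series k := fun m => c * f m.
Definition smul k (f g : series k) : series k := fun m =>
  \sum_(e : 'X_{1..k < (mdeg m).+1}) \sum_(e' : 'X_{1..k < (mdeg m).+1})
     (if (val e + val e')%MM == m then f (val e) * g (val e') else 0).
Definition spow k (f : series k) (n : nat) : series k := iter n (smul f) (@sone k).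
Definition smono k (e : 'X_{1..k}) : series k := fun m => if m == e then 1 else 0.
Definition svar k (i : 'I_k) : series k := smono (mnm1 i).
Definition spoly k (p : {mpoly rat[k]}) : series k := fun m => p@_m.
Definition sfold k (l : seq (series k)) : series k := foldr (@smul k) (@sone k) l.
Definition sum_series k (l : seq (series k)) : series k := foldr (@sadd k) (@szero k) l.

Definition sderiv k (i : 'I_k) (f : series k) : series k :=
  fun m => (m i).+1%:R * f (m + mnm1 i)%MM.
Definition sderivm k (d : 'X_{1..k}) (f : series k) : series k :=
  foldr (fun i g => iter (d i) (sderiv i) g) f (enum 'I_k).

Definition seval k j (P : {mpoly rat[k]}) (a : 'I_k -> series j) : series j :=
  sum_series [seq sscale P@_m (sfold [seq spow (a i) (m i) | i <- enum 'I_k])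
             | m <- msupp P].

(* Holonomic (D-finite) series: the Q(x_1..x_k)-span of all partial    *)
(* derivatives is finite dimensional, i.e. there is N such that any    *)
(* N+1 partial derivatives are linearly dependent over Q(x_1..x_k),     *)
(* equivalently (clearing denominators) over Q[x_1..x_k].               *)
Definition holonomic k (A : series k) : Prop :=
  exists N : nat, forall d : 'I_N.+1 -> 'X_{1..k},
    exists p : 'I_N.+1 -> {mpoly rat[k]},
      (exists j, p j != 0) /\
      forall m, sum_series [seq smul (spoly (p j)) (sderivm (d j) A) | j <- enum 'I_N.+1] m = 0.

Definition diff_alg_wrt k (i : 'I_k) (A : series k) : Prop :=
  exists (n : nat) (P : {mpoly rat[n.+1 + k]}),
    P != 0 /\
    forall m, seval P (fun j : 'I_(n.+1 + k) =>
       match split j with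
       | inl l => iter l (sderiv i) A
       | inr l => svar l
       end) m = 0.

(* Rooted planar maps as labelled combinatorial maps.                  *)
(* A map with n+1 edges has darts 'I_(n.*2.+2); s is the vertex        *)
(* rotation, a the edge involution; faces are the cycles of s * a.     *)
(* Rooted maps with n+1 edges correspond (2n+1)!-to-one to labelled    *)
(* maps whose root dart is 0 (rooted maps have no automorphisms).     *)
Definition darts (n : nat) := 'I_(n.*2.+2).

Definition is_planar_map n (s a : {perm darts n}) : bool :=
  [forall x, (a (a x) == x) && (a x != x)] &&
  [transitive <<[set s; a]>>, on [set: darts n] | 'P] &&
  (#|porbits s| + #|porbits (s * a)| == n.+1 + 2)%N.

Definition root_dart n : darts n := ord0.
Arguments root_dart : clear implicits.

Definition var_z : 'I_3 := @Ordinal 3 0 isT.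
Definition var_u : 'I_3 := @Ordinal 3 1 isT.
Definition var_t : 'I_3 := @Ordinal 3 2 isT.
Definition var_v : 'I_4 := @Ordinal 4 3 isT.

Definition mono3 (a b c : nat) : 'X_{1..3} := [multinom nth 0%N [:: a; b; c] i | i < 3].

Definition map_weight (g h : nat -> series 3) n (s a : {perm darts n}) : series 3 :=
  sfold ([:: smono (mono3 #|porbits (s * a)| (#|porbits s|).-1 n.+1);
             h #|porbit s (root_dart n)| ] ++
         [seq g #|B| | B : {set darts n} <- enum (porbits s :\ porbit s (root_dart n))]).

(* C(z,u,t): coefficientwise a finite sum, since a map with E edges   *)
(* contributes only to coefficients of t^c with c >= E.                *)
Definition C_maps (g h : nat -> series 3) : series 3 := fun m =>
  \sum_(n < m var_t)
    (n.*2.+1)`!%:R^-1 *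
      \sum_(sa : {perm darts n} * {perm darts n} | is_planar_map sa.1 sa.2)
         map_weight g h sa.1 sa.2 m.

Definition restr3 (m : 'X_{1..4}) : 'X_{1..3} := [multinom m (widen_ord (leqnSn 3) i) | i < 3].
Definition gen_v (g : nat -> series 3) : series 4 := fun m =>
  if (0 < m var_v)%N then g (m var_v) (restr3 m) else 0.

(* Main.v *)
(** Removing the root edge of a planar map gives Tutte's recursion for the weight
    W_l of maps with root degree l.  Its solution is explicit: with R, S the power
    series defined by S = t u [sum_n g_(n+1) ee n 0] and
    R = z t + t u [sum_n g_(n+1) R ee n 1], where ee counts Motzkin paths, one has
    t C = sum_(m,l) psi_m h_l bt m l for psi = v - t u sum_k g_k v^(k-1) and an
    explicit kernel bt.  Keeping R and S as formal variables, the three series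
    occurring here are diagonals of D-finite series obtained from sum_k g_k v^k and
    sum_k h_k v^k by substituting v := alpha + S + p y or v := alpha p + S + y and
    extracting the powers of alpha p y =: R.  Hence (Lipshitz) they satisfy linear
    differential equations in each variable, and all their derivatives lie in a
    field Q(b_1, ..., b_m).  Implicit differentiation expresses
    t^(i+1) d^i C, for all i, by elements of that field, so m + 1 of them are
    algebraically dependent over Q; having rational coefficients, the relation
    survives the specialization of R and S to the actual series. *)

Require Import Defs.
From HB Require Import structures.
From mathcomp Require Import all_boot all_order all_algebra all_fingroup.
From mathcomp Require Import mpoly.
From mathcomp Require Import boolp.
From mathcomp Require Import ring lra zify.
Set Implicit Arguments. Unset Strict Implicit. Unset Printing Implicit Defensive.

(** * Rotation systems and Tutte's recursion *)

Section Rotations.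
Import GroupScope.

Section Perm.
Variable T : finType.
Implicit Types (s a p q : {perm T}) (X Y : {set T}) (x y r d b : T).

(** R and S are given only by a system of functional equations, and D-finite series are not closed
    under substituting such series; this is why both stay formal until the end. The specialization
    may annihilate a nonzero polynomial in z, u, t, S, R, and with it every coefficient of a
    relation over Q[z, u, t, S, R], so the elimination is carried out over Q, where coefficients are
    left unchanged. The three extra variables are designed for a single extraction: alpha times p y
    and alpha p times y are both R, so powers of either substitution expand in the same path
    polynomials [ee], while the exponent of p tells which of the two summands a power comes from.
    That is enough to read a bilinear expression in the coefficients of psi and h off one diagonal.
    On the combinatorial side no topology enters: planarity is equality in Euler's inequality, and
    the inequality itself plays the part of the Jordan curve theorem. Sums over all degrees are
    infinite, so both sides meet modulo every order N, with finite sums whose length depends on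
    N. *)

Definition stable p Y := forall x, x \in Y -> p x \in Y.

(** An injection of a finite set into itself is onto, so stability under [p] also gives stability
    under its inverse. *)
Lemma stable_eq p Y x : stable p Y -> (p x \in Y) = (x \in Y).
Proof.
move=> h; have e : [set p y | y in Y] = Y.
  apply/eqP; rewrite eqEcard card_imset ?leqnn ?andbT; last exact: perm_inj.
  by apply/subsetP => z /imsetP [y hy ->]; apply: h.
by rewrite -{1}e mem_imset //; apply: perm_inj.
Qed.

Lemma stableU p Y X : stable p Y -> stable p X -> stable p (Y :|: X).
Proof. by move=> h h' x; rewrite !inE => /orP [/h ->|/h' ->]; rewrite ?orbT. Qed.

Lemma stableD p Y X : stable p Y -> stable p X -> stable p (Y :\: X).
Proof. by move=> h h' x; rewrite !inE stable_eq // => /andP [-> /h ->]. Qed.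

Lemma stableM p q Y : stable p Y -> stable q Y -> stable (p * q) Y.
Proof. by move=> hp hq x hx; rewrite permM; apply/hq/hp. Qed.

Lemma stable_tperm x y Y : x \in Y -> y \in Y -> stable (tperm x y) Y.
Proof. by move=> hx hy z hz; case: tpermP => // _. Qed.

Lemma stable_out (p : {perm T}) Y X : perm_on X p -> X \subset Y -> stable p Y.
Proof.
move=> h1 h2 x hx; case: (boolP (x \in X)) => hX; last by rewrite (out_perm h1 hX).
by apply: (subsetP h2); rewrite perm_closed.
Qed.

Lemma porbit_step p x y : y \in porbit p x -> p y \in porbit p x.
Proof.
by case/porbitP => i ->; apply/porbitP; exists i.+1; rewrite expgSr permM.
Qed.

Lemma stable_porbit p x : stable p (porbit p x).
Proof. by move=> y; apply: porbit_step. Qed.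

Lemma porbit_min p Y x : x \in Y -> stable p Y -> porbit p x \subset Y.
Proof.
move=> hx h; apply/subsetP => y /porbitP [i ->].
by elim: i => [|i IH]; rewrite ?expg0 ?perm1 // expgSr permM; apply: h.
Qed.

Lemma porbit_eq p x y : y \in porbit p x -> porbit p y = porbit p x.
Proof. by rewrite -eq_porbit_mem => /eqP ->. Qed.

Lemma porbit_congr p q x : (forall y, y \in porbit p x -> q y = p y) -> porbit q x = porbit p x.
Proof.
move=> h; have sub : porbit q x \subset porbit p x.
  by apply: porbit_min; rewrite ?porbit_id // => y hy; rewrite h // porbit_step.
apply/eqP; rewrite eqEsubset sub /=; apply: porbit_min; first exact: porbit_id.
by move=> y hy; rewrite -h ?porbit_step //; apply: (subsetP sub).
Qed.

Definition nv X s := #|[set porbit s x | x in X]|.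

Lemma nv_eq X s s' : (forall x, x \in X -> porbit s x = porbit s' x) -> nv X s = nv X s'.
Proof. by move=> h; rewrite /nv (eq_in_imset h). Qed.

Lemma nv_congr X s s' : stable s X -> (forall x, x \in X -> s' x = s x) -> nv X s' = nv X s.
Proof.
move=> h e; apply: nv_eq => x hx; apply: porbit_congr => y hy; apply: e.
exact: (subsetP (porbit_min hx h)).
Qed.

Lemma imset_porbitU X Y s : stable s X -> [disjoint X & Y] ->
  [disjoint [set porbit s x | x in X] & [set porbit s x | x in Y]].
Proof.
move=> hX dXY; apply/pred0P => B /=; apply/negP => /andP [/imsetP [x hx ->] /imsetP [y hy e]].
have := porbit_id s y; rewrite -e => /(subsetP (porbit_min hx hX)) hyX.
by move: dXY; rewrite disjoints_subset => /subsetP /(_ _ hyX); rewrite inE hy.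
Qed.

Lemma nvU X Y s : stable s X -> [disjoint X & Y] -> nv (X :|: Y) s = nv X s + nv Y s.
Proof.
by move=> hX dXY; rewrite /nv imsetU -cardsUI [_ :&: _](disjoint_setI0 _) ?cards0 ?addn0 // imset_porbitU.
Qed.

Lemma nv_porbits X s : perm_on X s -> #|porbits s| = (nv X s + #|~: X|)%N.
Proof.
move=> h; have -> : porbits s = [set porbit s x | x in X :|: ~: X].
  by apply/setP => B; rewrite setUCr; apply/imsetP/imsetP => -[x _ ->]; exists x.
rewrite -/(nv _ _) nvU; last 2 first.
- exact: stable_out h (subxx _).
- by rewrite -setI_eq0 setICr.
congr addn; rewrite /nv card_in_imset // => x y.
have p1 z : z \in ~: X -> porbit s z = [set z].
  rewrite inE => hz; apply/eqP; rewrite eqEsubset sub1set porbit_id andbT.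
  by apply: porbit_min; rewrite ?set11 // => w /set1P ->; rewrite (out_perm h hz) set11.
by move=> hx hy; rewrite !p1 // => /set1_inj.
Qed.

(* Splits the cycle of s through d and b, or merges their two cycles. *)
Definition cut d b s : {perm T} := tperm d b * s.

Lemma cutE d b s x : cut d b s x = s (tperm d b x). Proof. by rewrite /cut permM. Qed.

Lemma cutK d b s : cut d b (cut d b s) = s.
Proof. by rewrite /cut mulgA tperm2 mul1g. Qed.

Lemma perm_on_tperm X d b : d \in X -> b \in X -> perm_on X (tperm d b).
Proof.
move=> hd hb; apply/subsetP => x; rewrite inE; case: tpermP => [->|->|] //.
by rewrite eqxx.
Qed.

Lemma perm_on_cut X d b s : d \in X -> b \in X -> perm_on X s -> perm_on X (cut d b s).
Proof. by move=> hd hb hs; apply: perm_onM => //; apply: perm_on_tperm. Qed.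

Lemma porbits_cut d b s : d != b ->
  (#|porbits (cut d b s)| + (b \notin porbit s d).*2 = #|porbits s| + 1)%N.
Proof.
move=> h; have := porbits_mul_tperm s d b; rewrite /= h => <-.
by rewrite -porbit_sym.
Qed.

(** The cycle count [porbits_cut], applied to [s] and to [cut d b s], excludes that [d] and [b] lie
    in different cycles both before and after the cut. *)
Lemma cut_diff d b s : d != b -> b \notin porbit s d ->
  b \in porbit (cut d b s) d /\ porbit (cut d b s) d = porbit s d :|: porbit s b.
Proof.
move=> ndb hb; have e1 := porbits_cut s ndb; have e2 := porbits_cut (cut d b s) ndb.
rewrite cutK hb in e1 e2.
have h : b \in porbit (cut d b s) d.
  by apply: contraT => h; rewrite h in e2; move: e1 e2; rewrite -!muln2 /=; lia.
split=> //; apply/eqP; rewrite eqEsubset; apply/andP; split.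
  apply: porbit_min; first by rewrite inE porbit_id.
  apply: stableM; first by apply: stable_tperm; rewrite !inE porbit_id ?orbT.
  by apply: stableU; apply: stable_porbit.
have st : stable s (porbit (cut d b s) d).
  rewrite -{1}(cutK d b s); apply: stableM; last exact: stable_porbit.
  by apply: stable_tperm => //; apply: porbit_id.
by rewrite subUset !porbit_min ?porbit_id.
Qed.

Lemma cut_same d b s : d != b -> b \in porbit s d ->
  b \notin porbit (cut d b s) d /\ porbit s d = porbit (cut d b s) d :|: porbit (cut d b s) b.
Proof.
move=> ndb hb; have e1 := porbits_cut s ndb; have e2 := porbits_cut (cut d b s) ndb.
rewrite cutK hb in e1 e2.
have h : b \notin porbit (cut d b s) d.
  by apply/negP => h; rewrite h in e2; move: e1 e2; rewrite -!muln2 /=; lia.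
split=> //; have := cut_diff ndb h; rewrite cutK; by case.
Qed.

Lemma cut_other d b s x : x \notin porbit s d -> x \notin porbit s b ->
  porbit (cut d b s) x = porbit s x.
Proof.
move=> h1 h2; apply: porbit_congr => y hy; rewrite cutE tpermD //.
  by apply: contraNneq h1 => ->; rewrite porbit_sym.
by apply: contraNneq h2 => ->; rewrite porbit_sym.
Qed.

Lemma nv_cut X d b s : d \in X -> b \in X -> perm_on X s -> d != b ->
  (nv X (cut d b s) + (b \notin porbit s d).*2 = nv X s + 1)%N.
Proof.
move=> hd hb hs ndb; have := porbits_cut s ndb.
by rewrite (nv_porbits hs) (nv_porbits (perm_on_cut hd hb hs)); lia.
Qed.

(* Removes r from its cycle. *)
Definition skip r p : {perm T} := p * tperm r (p r).

Lemma skip_fix r p : skip r p r = r.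
Proof. by rewrite /skip permM tpermR. Qed.

Lemma skip_neq r p x : x != r -> p x != r -> skip r p x = p x.
Proof.
move=> h1 h2; rewrite /skip permM tpermD // eq_sym //.
by rewrite (inj_eq perm_inj).
Qed.
Lemma skip_pre r p x : p x = r -> skip r p x = p r.
Proof. by move=> h; rewrite /skip permM h tpermL. Qed.

Lemma perm_on_skip X r p : perm_on X p -> r \in X -> perm_on (X :\ r) (skip r p).
Proof.
move=> h hr; apply/subsetP => x; rewrite !inE; case: (eqVneq x r) => [->|_] /=.
  by rewrite skip_fix eqxx.
apply: contraR => hx; rewrite /skip permM (out_perm h hx) tpermD //.
  by apply: contraNneq hx => <-.
by apply: contraNneq hx => <-; rewrite perm_closed.
Qed.

Lemma nv_skip X r p : perm_on X p -> r \in X -> p r != r -> nv (X :\ r) (skip r p) = nv X p.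
Proof.
move=> h hr hp; set q := p^-1 r.
(* Removing [r] is a cut at [r] and its predecessor: the cycle splits off the fixed point [r], and
   the count outside [r] is unchanged. *)
have e : skip r p = cut q r p.
  apply/permP => x; rewrite /skip /cut !permM; case: (tpermP q r x) => [->|->|h1 h2].
  - by rewrite permKV tpermL.
  - by rewrite tpermR permKV.
  - rewrite tpermD //; last by rewrite (inj_eq perm_inj); apply/eqP => e; case: h2.
    by apply/eqP => e; case: h1; rewrite /q e permK.
have nq : q != r by apply: contra hp => /eqP eq; rewrite -{1}eq permKV.
have := porbits_cut p nq; rewrite -e (nv_porbits h) (nv_porbits (perm_on_skip h hr)).
have -> : (r \notin porbit p q) = false.
  by apply/negbTE; rewrite negbK -{1}(permKV p r) porbit_step ?porbit_id.
have : #|~: (X :\ r)| = #|~: X|.+1.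
  by have := cardsC X; have := cardsC (X :\ r); rewrite (cardsD1 r X) hr; lia.
lia.
Qed.

Lemma porbit_skip r p x : x != r -> porbit (skip r p) x = porbit p x :\ r.
Proof.
move=> hx; apply/eqP; rewrite eqEsubset; apply/andP; split.
  apply: porbit_min; first by rewrite !inE hx porbit_id.
  move=> y; rewrite !inE => /andP [yr hy].
  case: (eqVneq (p y) r) => e.
    rewrite (skip_pre e); apply/andP; split; last by apply: porbit_step; rewrite -e porbit_step.
    by apply: contra yr => /eqP; rewrite -{2}e => /perm_inj ->.
  by rewrite skip_neq // e porbit_step.
have xr y : y \in porbit (skip r p) x -> y != r.
  apply: contraTneq => ->; rewrite -porbit_sym; apply/negP => h.
  case/eqP: hx; have := porbit_min (set11 r) (p := skip r p) (Y := [set r]).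
  move=> /(_ _) h2; apply/set1P; apply: (subsetP (h2 _)) => //.
  by move=> z /set1P ->; rewrite skip_fix set11.
(* Putting [r] back exactly when its successor lies in the orbit produces a set that is stable under
   [p]. *)
pose Y := porbit (skip r p) x :|: (if p r \in porbit (skip r p) x then [set r] else set0).
have st : stable p Y.
  move=> y; rewrite !inE => /orP [hy|].
    case: (eqVneq (p y) r) => e.
      have := porbit_step hy; rewrite (skip_pre e) => ->; by rewrite e set11 orbT.
    by have := porbit_step hy; rewrite (skip_neq (xr _ hy) e) => hh; apply/orP; left.
  case: ifP => [h|_]; last by rewrite inE.
  by move/set1P => ->; rewrite h.
have sub : porbit p x \subset Y by apply: porbit_min => //; rewrite inE porbit_id.
apply/subsetP => y; rewrite !inE => /andP [yr /(subsetP sub)]; rewrite !inE.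
by case: ifP => _; rewrite !inE ?(negPf yr) !orbF.
Qed.

End Perm.

(** * Connected maps, opening the root edge, Euler's inequality *)

Section Maps.
Variable T : finType.
Implicit Types (s a p q : {perm T}) (X Y : {set T}) (x y r d b : T).

Definition mtch Y a := [forall x, a (a x) == x] && [forall x, (a x != x) == (x \in Y)].

Lemma mtchP Y a : reflect ((forall x, a (a x) = x) /\ (forall x, (a x != x) = (x \in Y))) (mtch Y a).
Proof.
apply: (iffP andP) => -[h1 h2]; split.
- by move=> x; have /eqP := forallP h1 x.
- by move=> x; have /eqP := forallP h2 x.
- by apply/forallP => x; apply/eqP.
- by apply/forallP => x; apply/eqP.
Qed.

Lemma mtchK Y a x : mtch Y a -> a (a x) = x.
Proof. by case/mtchP. Qed.
Lemma mtch_in Y a x : mtch Y a -> (a x != x) = (x \in Y).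
Proof. by case/mtchP. Qed.
Lemma mtch_out Y a x : mtch Y a -> x \notin Y -> a x = x.
Proof. by move=> h; rewrite -(mtch_in _ h) negbK => /eqP. Qed.
Lemma mtch_on Y a : mtch Y a -> perm_on Y a.
Proof. by move=> h; apply/subsetP => x; rewrite inE (mtch_in _ h). Qed.

Lemma perm_onS X Y p : perm_on Y p -> Y \subset X -> perm_on X p.
Proof. exact: subset_trans. Qed.

Definition cpt s a r := orbit 'P <<[set s; a]>> r.

Lemma cpt_id s a r : r \in cpt s a r. Proof. exact: orbit_refl. Qed.

Lemma cpt_stables s a r : stable s (cpt s a r).
Proof.
move=> x hx; apply: (orbit_trans (y := x)) => //.
apply/orbitP; exists s => //; by rewrite mem_gen // !inE eqxx.
Qed.
Lemma cpt_stablea s a r : stable a (cpt s a r).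
Proof.
move=> x hx; apply: (orbit_trans (y := x)) => //.
apply/orbitP; exists a => //; by rewrite mem_gen // !inE eqxx orbT.
Qed.

Lemma stable_astabs p Y : stable p Y -> p \in 'N(Y | 'P).
Proof. by move=> h; apply/astabsP => x; rewrite /= apermE stable_eq. Qed.

Lemma cpt_min s a r Y : r \in Y -> stable s Y -> stable a Y -> cpt s a r \subset Y.
Proof.
move=> hr hs ha; rewrite acts_sub_orbit // gen_subG.
by apply/subsetP => p /set2P [] ->; apply: stable_astabs.
Qed.

Lemma cpt_eq s a x y : y \in cpt s a x -> cpt s a y = cpt s a x.
Proof. by move/orbit_eqP. Qed.

Lemma cpt_sym s a x y : (y \in cpt s a x) = (x \in cpt s a y).
Proof. exact: orbit_sym. Qed.

Lemma cpt_skip s a b d : a b = b -> d != b -> cpt (skip b s) a d = cpt s a d :\ b.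
Proof.
move=> hb hd; have an y : y != b -> a y != b by move=> h; rewrite -{1}hb (inj_eq perm_inj).
apply/eqP; rewrite eqEsubset; apply/andP; split.
  apply: cpt_min; first by rewrite !inE hd cpt_id.
    move=> y; rewrite !inE => /andP [yb hy].
    case: (eqVneq (s y) b) => e.
      rewrite (skip_pre e); apply/andP; split; last by apply: cpt_stables; rewrite -e cpt_stables.
      by apply: contra yb => /eqP; rewrite -{2}e => /perm_inj ->.
    by rewrite skip_neq // e cpt_stables.
  by move=> y; rewrite !inE => /andP [yb hy]; rewrite an // cpt_stablea.
have xr y : y \in cpt (skip b s) a d -> y != b.
  apply: contraTneq => ->; rewrite cpt_sym; apply/negP => h.
  case/eqP: hd; apply/set1P; apply: (subsetP _ _ h).
  apply: cpt_min; rewrite ?set11 // => z /set1P ->; rewrite ?skip_fix ?hb set11 //.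
pose Y := cpt (skip b s) a d :|: (if s b \in cpt (skip b s) a d then [set b] else set0).
have sub : cpt s a d \subset Y.
  apply: cpt_min; first by rewrite inE cpt_id.
    move=> y; rewrite !inE => /orP [hy|].
      case: (eqVneq (s y) b) => e.
        have := @cpt_stables (skip b s) a d _ hy; rewrite (skip_pre e) => ->; by rewrite e set11 orbT.
      have := @cpt_stables (skip b s) a d _ hy; rewrite (skip_neq (xr _ hy) e) => hh; apply/orP; by left.
    case: ifP => [h|_]; last by rewrite inE.
    by move/set1P => ->; rewrite h.
  move=> y; rewrite !inE => /orP [hy|]; first by rewrite cpt_stablea.
  case: ifP => [h|_]; last by rewrite inE.
  by move/set1P => ->; rewrite hb set11 orbT.
apply/subsetP => y; rewrite !inE => /andP [yr /(subsetP sub)]; rewrite !inE.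
by case: ifP => _; rewrite !inE ?(negPf yr) !orbF.
Qed.

(* Connected maps with dart set X: rotation s, edge involution a.  In [cl] the root r
   is a leg, that is, a half-edge fixed by a; in [cd] every dart is paired. *)
Definition cl X r s a := [&& r \in X, perm_on X s, mtch (X :\ r) a & cpt s a r == X].
Definition cd X d s a := [&& d \in X, perm_on X s, mtch X a & cpt s a d == X].

Lemma skipM s a r : a r = r -> a * skip r s = skip r (a * s).
Proof. by move=> h; rewrite /skip permM h mulgA. Qed.

Lemma cl_deg0 X r s a : cl X r s a -> s r = r -> X = [set r].
Proof.
case/and4P => hr hs ha /eqP <- e; apply/eqP; rewrite eqEsubset sub1set cpt_id andbT.
apply: cpt_min; rewrite ?set11 // => z /set1P ->; rewrite ?e ?set11 //.
by rewrite (mtch_out ha) ?set11 // !inE eqxx.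
Qed.

Lemma cl_skip X r s a : cl X r s a -> s r != r ->
  [/\ cd (X :\ r) (s r) (skip r s) a, nv (X :\ r) (skip r s) = nv X s
    & nv (X :\ r) (a * skip r s) = nv X (a * s)].
Proof.
case/and4P => hr hs ha /eqP hc e.
have har : a r = r by rewrite (mtch_out ha) // !inE eqxx.
have ha' : perm_on X a by apply: (perm_onS (mtch_on ha)); apply: subsetDl.
split.
- apply/and4P; split => //.
  + by rewrite !inE e perm_closed.
  + exact: perm_on_skip.
  + rewrite cpt_skip // -hc; apply/eqP; congr (_ :\ _); apply: cpt_eq.
    exact/cpt_stables/cpt_id.
- by rewrite nv_skip.
- by rewrite skipM // nv_skip // ?permM ?har // perm_onM.
Qed.

Lemma stable_cut s d b Y : d \in Y -> b \in Y -> stable s Y -> stable (cut d b s) Y.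
Proof. by move=> hd hb hs; apply: stableM => //; apply: stable_tperm. Qed.

Lemma stable_cutr a d b Y : d \in Y -> b \in Y -> stable a Y -> stable (a * tperm d b) Y.
Proof. by move=> hd hb hs; apply: stableM => //; apply: stable_tperm. Qed.

Lemma mtch_cut X a d : mtch X a -> d \in X -> mtch (X :\ d :\ a d) (a * tperm d (a d)).
Proof.
move=> ha hd; apply/mtchP; split=> x; rewrite !permM.
  case: (eqVneq x d) => [->|nd]; first by rewrite tpermR tpermR.
  case: (eqVneq x (a d)) => [->|nb]; first by rewrite (mtchK _ ha) tpermL (mtchK _ ha) tpermL.
  have nax : a x != d by apply: contra nb => /eqP <-; rewrite (mtchK _ ha).
  have nbx : a x != a d by rewrite (inj_eq perm_inj).
  rewrite (tpermD (z := a x)) 1?eq_sym // (mtchK _ ha) tpermD 1?eq_sym //.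
rewrite !inE -(mtch_in x ha).
case: (eqVneq x d) => [->|nd]; first by rewrite tpermR eqxx andbF.
case: (eqVneq x (a d)) => [->|nb]; first by rewrite (mtchK _ ha) tpermL eqxx.
by rewrite tpermD // eq_sym ?(inj_eq perm_inj) //; apply: contra nb => /eqP <-; rewrite (mtchK _ ha).
Qed.

Lemma mtch_uncut X a d b : mtch (X :\ d :\ b) a -> d \in X -> b \in X -> d != b ->
  mtch X (a * tperm d b) /\ (a * tperm d b) d = b.
Proof.
move=> ha hd hb ndb.
have ad : a d = d by rewrite (mtch_out ha) // !inE eqxx andbF.
have ab : a b = b by rewrite (mtch_out ha) // !inE eqxx.
split; last by rewrite permM ad tpermL.
apply/mtchP; split=> x; rewrite !permM.
  case: (eqVneq x d) => [->|nd]; first by rewrite ad tpermL ab tpermR.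
  case: (eqVneq x b) => [->|nb]; first by rewrite ab tpermR ad tpermL.
  have nax : a x != d by rewrite -{1}ad (inj_eq perm_inj).
  have nbx : a x != b by rewrite -{1}ab (inj_eq perm_inj).
  rewrite (tpermD (z := a x)) 1?eq_sym // (mtchK _ ha) tpermD 1?eq_sym //.
case: (eqVneq x d) => [->|nd]; first by rewrite ad tpermL eq_sym ndb hd.
case: (eqVneq x b) => [->|nb]; first by rewrite ab tpermR ndb hb.
have nax : a x != d by rewrite -{1}ad (inj_eq perm_inj).
have nbx : a x != b by rewrite -{1}ab (inj_eq perm_inj).
have -> : tperm d b (a x) = a x by rewrite tpermD // eq_sym.
by rewrite (mtch_in x ha) !inE nd nb.
Qed.

(** Faces are the cycles of [a * s]. Twisting both permutations by the same transposition keeps this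
    product, so opening an edge changes the vertices and leaves the faces alone. *)
Lemma cut_mulM a s d b : (a * tperm d b) * cut d b s = a * s.
Proof. by rewrite /cut mulgA -(mulgA a) tperm2 mulg1. Qed.

(** Here [d] and [b] are two legs of one connected map. The leg [b] cannot be alone at its vertex,
    since it would then be a whole component; deleting it preserves the numbers of vertices and
    faces and leads back to a map with one leg. *)
Lemma conn2_skip X d b s a : d \in X -> b \in X -> d != b -> perm_on X s ->
  mtch (X :\ d :\ b) a -> cpt s a d = X ->
  [/\ s b != b, cl (X :\ b) d (skip b s) a, nv (X :\ b) (skip b s) = nv X s
    & nv (X :\ b) (a * skip b s) = nv X (a * s)].
Proof.
move=> hd hb ndb hs ha hc.
have ab : a b = b by rewrite (mtch_out ha) // !inE eqxx.
have hsb : s b != b.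
  apply/eqP => e.
  have /subsetP h : cpt s a b \subset [set b].
    by apply: cpt_min; rewrite ?set11 // => z /set1P ->; rewrite ?e ?ab set11.
  have : d \in cpt s a b by rewrite cpt_sym hc.
  by move/h => /set1P e2; rewrite e2 eqxx in ndb.
have ha' : perm_on X a.
  by apply: (perm_onS (mtch_on ha)); apply: subset_trans (subsetDl _ _) (subsetDl _ _).
split => //.
- apply/and4P; split.
  + by rewrite !inE ndb.
  + exact: perm_on_skip.
  + by rewrite (_ : X :\ b :\ d = X :\ d :\ b) //; apply/setP => x; rewrite !inE andbCA.
  + by rewrite cpt_skip // hc.
- by rewrite nv_skip.
- by rewrite skipM // nv_skip // ?permM ?ab // perm_onM.
Qed.

Lemma rpE Y p x : stable p Y -> restr_perm Y p x = if x \in Y then p x else x.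
Proof.
move=> h; case: ifP => hx; first by rewrite restr_permE // stable_astabs.
by rewrite (out_perm (restr_perm_on Y p)) ?hx.
Qed.

Lemma mtch_rp X Y a r : mtch X a -> stable a Y -> Y :\ r \subset X -> r \notin X ->
  X :&: Y = Y :\ r -> mtch (Y :\ r) (restr_perm Y a).
Proof.
move=> ha hY sub rX e; apply/mtchP; split=> x; rewrite !rpE //.
  by case: (boolP (x \in Y)) => hx; rewrite ?stable_eq // ?hx ?(mtchK _ ha) // (negPf hx).
rewrite -e inE -(mtch_in x ha); case: (x \in Y); rewrite ?andbT ?eqxx ?andbF //.
Qed.

Lemma disc_comp X d b s a : d \in X -> b \in X -> d != b -> perm_on X s ->
  mtch (X :\ d :\ b) a -> b \notin cpt s a d ->
  let Y := cpt s a d in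
  [/\ cl Y d (restr_perm Y s) (restr_perm Y a), nv Y (restr_perm Y s) = nv Y s
    & nv Y (restr_perm Y a * restr_perm Y s) = nv Y (a * s)].
Proof.
move=> hd hb ndb hs ha hbY Y.
have sY : stable s Y := @cpt_stables s a d.
have aY : stable a Y := @cpt_stablea s a d.
have YX : Y \subset X.
  apply: cpt_min => //; first exact: stable_out hs (subxx _).
  apply: stable_out (mtch_on ha) _; exact: subset_trans (subsetDl _ _) (subsetDl _ _).
split.
- apply/and4P; split.
  + exact: cpt_id.
  + exact: restr_perm_on.
  + have hsub : Y :\ d \subset X :\ d :\ b.
      apply/subsetP => x; rewrite !inE => /andP [-> xY].
      have nb : x != b by apply: contraNneq hbY => <-.
      by rewrite nb (subsetP YX).
    apply: mtch_rp ha _ _ _ _ => //; first by rewrite !inE eqxx andbF.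
    apply/setP => x; rewrite !inE; case: (boolP (x \in Y)) => xY; last by rewrite !andbF.
    have nb : x != b by apply: contraNneq hbY => <-.
    by rewrite nb (subsetP YX) //= !andbT.
  + rewrite eqEsubset; apply/andP; split.
      apply: cpt_min; rewrite ?cpt_id // => x hx; rewrite rpE // hx ?sY ?aY //.
    have st1 : stable (restr_perm Y s) (cpt (restr_perm Y s) (restr_perm Y a) d) by apply: cpt_stables.
    have st2 : stable (restr_perm Y a) (cpt (restr_perm Y s) (restr_perm Y a) d) by apply: cpt_stablea.
    set Z := cpt _ _ _ in st1 st2 *.
    have ZY : Z \subset Y.
      by apply: cpt_min; rewrite ?cpt_id // => x hx; rewrite rpE // hx ?sY ?aY.
    apply: cpt_min; rewrite ?cpt_id // => x hx.
      by have := st1 _ hx; rewrite rpE // (subsetP ZY).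
    by have := st2 _ hx; rewrite rpE // (subsetP ZY).
- by apply: nv_congr => // x hx; rewrite rpE // hx.
- apply: nv_congr; first exact: stableM.
  by move=> x hx; rewrite !permM !rpE // hx aY.
Qed.

Lemma cd_cut X d s a : cd X d s a ->
  let b := a d in let s1 := cut d b s in let a1 := a * tperm d b in
  [/\ b \in X, d != b, perm_on X s1, mtch (X :\ d :\ b) a1 & X = cpt s1 a1 d :|: cpt s1 a1 b].
Proof.
case/and4P => hd hs ha /eqP hc b s1 a1.
have hb : b \in X by rewrite perm_closed // mtch_on.
have ndb : d != b by rewrite eq_sym (mtch_in _ ha).
split => //; first exact: perm_on_cut.
  exact: mtch_cut.
set Y := _ :|: _.
have dY : d \in Y by rewrite inE cpt_id.
have bY : b \in Y by rewrite inE cpt_id orbT.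
have s1Y : stable s1 Y by apply: stableU; apply: cpt_stables.
have a1Y : stable a1 Y by apply: stableU; apply: cpt_stablea.
have hs1 : perm_on X s1 by exact: perm_on_cut.
have ha1 := mtch_cut ha hd.
have a1X : stable a1 X.
  apply: stable_out (mtch_on ha1) _; exact: subset_trans (subsetDl _ _) (subsetDl _ _).
have s1X : stable s1 X by apply: stable_out hs1 _.
apply/eqP; rewrite eqEsubset; apply/andP; split.
  rewrite -{1}hc; apply: cpt_min => //.
    by rewrite -(cutK d b s); apply: stable_cut.
  have -> : a = a1 * tperm d b by rewrite /a1 -mulgA tperm2 mulg1.
  exact: stable_cutr.
by rewrite subUset !cpt_min.
Qed.

Lemma setD1D1 X d b : X :\ d :\ b = X :\ b :\ d.
Proof. by apply/setP => x; rewrite !inE andbCA. Qed.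

Lemma disc_split X d b s a : d \in X -> b \in X -> d != b -> perm_on X s ->
  mtch (X :\ d :\ b) a -> b \notin cpt s a d -> X = cpt s a d :|: cpt s a b ->
  let Y := cpt s a d in let Z := cpt s a b in
  [/\ cl Y d (restr_perm Y s) (restr_perm Y a), cl Z b (restr_perm Z s) (restr_perm Z a),
   [disjoint Y & Z],
   nv X s = (nv Y (restr_perm Y s) + nv Z (restr_perm Z s))%N
  & nv X (a * s) = (nv Y (restr_perm Y a * restr_perm Y s) + nv Z (restr_perm Z a * restr_perm Z s))%N].
Proof.
move=> hd hb ndb hs ha hbY XE Y Z.
have [c1 c2 c3] := disc_comp hd hb ndb hs ha hbY.
have [||||||c1' c2' c3'] // := @disc_comp X b d s a.
- by rewrite eq_sym.
- by rewrite setD1D1.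
- by rewrite cpt_sym.
have dj : [disjoint Y & Z].
  apply/pred0P => x /=; apply/negP => /andP [h1 h2].
  by move/negP: hbY; apply; rewrite cpt_sym -(cpt_eq h2) (cpt_eq h1) cpt_id.
split => //.
- by rewrite c2 c2' -nvU ?{1}XE //; apply: cpt_stables.
- rewrite c3 c3' -nvU ?{1}XE //; apply: stableM; [exact: cpt_stablea | exact: cpt_stables].
Qed.

(* Euler: V + F <= E + 2, by deleting the leg, respectively cutting the root edge. *)
Lemma genus_bound n :
  (forall X r s a, #|X| <= n -> cl X r s a -> 2 * (nv X s + nv X (a * s)) <= #|X| + 3) /\
  (forall X d s a, #|X| <= n -> cd X d s a -> 2 * (nv X s + nv X (a * s)) <= #|X| + 4).
Proof.
elim: n => [|n [IHl IHd]].
  by split=> X r s a; rewrite leqn0 cards_eq0 => /eqP -> /and4P []; rewrite inE.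
have Hl X r s a : #|X| <= n.+1 -> cl X r s a -> 2 * (nv X s + nv X (a * s)) <= #|X| + 3.
  move=> hX h; case: (eqVneq (s r) r) => e.
    have XE := cl_deg0 h e; rewrite XE /nv !imset_set1 !cards1 //.
  have [c1 <- <-] := cl_skip h e.
  have := cardsD1 r X; case/and4P: h => -> _ _ _ /= => e1.
  have hX' : #|X :\ r| <= n by rewrite e1 in hX.
  have := IHd _ _ _ _ hX' c1; move: e1; clear; lia.
split=> // X d s a hX h.
have [hb ndb hs1 ha1 XE] := cd_cut h; set b := a d in hb ndb hs1 ha1 XE *.
case/and4P: (h) => hd hs ha hc.
have n1 := nv_cut hd hb hs ndb.
have := cardsD1 b X; rewrite hb /= => e1.
case: (boolP (b \in cpt (cut d b s) (a * tperm d b) d)) => hbc.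
  have cX : cpt (cut d b s) (a * tperm d b) d = X by rewrite [RHS]XE (cpt_eq hbc) setUid.
  have [_ c1 c2 c3] := conn2_skip hd hb ndb hs1 ha1 cX.
  have hX' : #|X :\ b| <= n by rewrite e1 in hX.
  have := IHl _ _ _ _ hX' c1; rewrite c2 c3 cut_mulM; move: n1 e1.
  by case: (b \in _) => /=; rewrite -muln2; clear; lia.
have [c1 c2 dj c3 c4] := disc_split hd hb ndb hs1 ha1 hbc XE.
set Y := cpt _ _ d in c1 c2 c3 c4 dj XE hbc; set Z := cpt _ _ b in c1 c2 c3 c4 dj XE hbc.
have cYZ : #|X| = (#|Y| + #|Z|)%N.
  by rewrite XE -cardsUI [_ :&: _](disjoint_setI0 dj) cards0 addn0.
have Y0 : 0 < #|Y| by apply/card_gt0P; exists d; apply: cpt_id.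
have Z0 : 0 < #|Z| by apply/card_gt0P; exists b; apply: cpt_id.
rewrite cut_mulM in c4.
have h1 := IHl _ _ _ _ (_ : #|Y| <= n) c1; have h2 := IHl _ _ _ _ (_ : #|Z| <= n) c2.
have {}h1 := h1 ltac:(move: hX cYZ Z0; clear; lia).
have {}h2 := h2 ltac:(move: hX cYZ Y0; clear; lia).
(* Only a loop can disconnect: if [d] and [b] were at different vertices, the cut would merge these
   vertices and keep [b] in the component of [d]. *)
have hbs : b \in porbit s d.
  apply: contraNT hbc => /(cut_diff ndb) [h3 _].
  by apply: (subsetP (porbit_min _ _)) h3; [exact: cpt_id | exact: cpt_stables].
rewrite hbs /= in n1; move: n1 h1 h2 c3 c4 cYZ; clear; lia.
Qed.

Lemma cl_bound X r s a : cl X r s a -> 2 * (nv X s + nv X (a * s)) <= #|X| + 3.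
Proof. by case: (genus_bound #|X|) => h _; apply: h. Qed.

End Maps.

Section Orb.
Variable T : finType.
Implicit Types (s : {perm T}) (x y : T).

Lemma iter_porbit_neq s x i : 0 < i < #|porbit s x| -> iter i s x != x.
Proof.
move=> /andP [i0 iN]; have u := uniq_traject_porbit s x.
apply/eqP => e; have := nth_uniq x _ _ u; rewrite size_traject => /(_ 0 i).
rewrite (leq_ltn_trans _ iN) // iN => /(_ isT isT).
by rewrite !nth_traject ?(leq_ltn_trans _ iN) //= e eqxx; case: i i0 {iN e}.
Qed.

Lemma card_porbit_iter s x n : iter n.+1 s x = x ->
  (forall i, 0 < i <= n -> iter i s x != x) -> #|porbit s x| = n.+1.
Proof.
move=> e h; have p0 : 0 < #|porbit s x| by apply/card_gt0P; exists x; apply: porbit_id.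
case: (ltngtP #|porbit s x| n.+1) => // hn.
  by have := h _ (introT andP (conj p0 _ : _ /\ #|porbit s x| <= n)); rewrite iter_porbit eqxx => /(_ hn).
by have := @iter_porbit_neq s x n.+1; rewrite ltn0Sn hn e eqxx => /(_ isT).
Qed.

Lemma mem_iter_porbit s x i : iter i s x \in porbit s x.
Proof. by rewrite -permX mem_porbit. Qed.

Lemma iter_permK s n x : iter n s^-1 (iter n s x) = x.
Proof. by elim: n => // n IH; rewrite iterSr iterS permK. Qed.

Lemma iter_permKV s n x : iter n s (iter n s^-1 x) = x.
Proof. by elim: n => // n IH; rewrite iterSr iterS permKV. Qed.

End Orb.

(** * Planar maps and the contraction of a non-loop root edge *)

Section Corr.
Variable T : finType.
Implicit Types (s a p q : {perm T}) (X Y : {set T}) (x y r d b : T).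

(* Planar maps: equality in Euler's inequality, with E = #|X|./2 edges. *)
Definition lm X r s a := cl X r s a && (2 * (nv X s + nv X (a * s)%g) == #|X| + 3)%N.
Definition dm X d s a := cd X d s a && (2 * (nv X s + nv X (a * s)%g) == #|X| + 4)%N.

Lemma lm_skip X r s a : r \in X -> s r != r ->
  lm X r s a = dm (X :\ r) (s r) (skip r s) a && perm_on X s.
Proof.
move=> hr e; have cX : #|X| = #|X :\ r|.+1 by rewrite (cardsD1 r X) hr.
apply/andP/andP => [[h1 h2]|[/andP [h1 h2] hs]].
  have [c1 c2 c3] := cl_skip h1 e; case/and4P: h1 => _ hs _ _; split=> //.
  rewrite /dm c1 c2 c3 /=; move: h2; rewrite cX; lia.
have h3 : cl X r s a.
  case/and4P: h1 => h1 _ h4 /eqP h5; apply/and4P; split=> //.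
  have har : a r = r by rewrite (mtch_out h4) // !inE eqxx.
  have h6 : s r \in cpt s a r by apply/cpt_stables/cpt_id.
  rewrite -(cpt_eq h6) -(setD1K hr) -h5 cpt_skip // setD1K //.
  by rewrite cpt_sym.
have [c1 c2 c3] := cl_skip h3 e; split=> //.
by move: h2; rewrite c2 c3 cX; lia.
Qed.

Lemma cd_uncut X d b s1 a1 : d \in X -> b \in X -> d != b -> perm_on X s1 ->
  mtch (X :\ d :\ b) a1 -> X = cpt s1 a1 d :|: cpt s1 a1 b ->
  cd X d (cut d b s1) (a1 * tperm d b) && ((a1 * tperm d b) d == b).
Proof.
move=> hd hb ndb hs ha XE; have [ha' e] := mtch_uncut ha hd hb ndb.
rewrite e eqxx andbT; apply/and4P; split=> //; first exact: perm_on_cut.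
set s := cut _ _ _; set a := a1 * _ in ha' e *.
have dC := cpt_id s a d.
have bC : b \in cpt s a d by rewrite -{1}e cpt_stablea.
have s1C : stable s1 (cpt s a d).
  by rewrite -(cutK d b s1); apply: stable_cut => //; apply: cpt_stables.
have a1C : stable a1 (cpt s a d).
  have -> : a1 = a * tperm d b by rewrite /a -mulgA tperm2 mulg1.
  by apply: stable_cutr => //; apply: cpt_stablea.
rewrite eqEsubset; apply/andP; split; last by rewrite {1}XE subUset !cpt_min.
apply: cpt_min => //; first by apply: stable_out (subxx X); apply: perm_on_cut.
exact: stable_out (mtch_on ha') (subxx X).
Qed.

(* [opn] contracts the non-loop root edge {d, b}; the dart d stays behind as a leg.
   [cls] is the inverse, l being the position at which the merged vertex is split. *)
Definition opn d b (sa : {perm T} * {perm T}) := (skip b (cut d b sa.1), sa.2 * tperm d b).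
Definition cls d b l (sa : {perm T} * {perm T}) :=
  (cut d b (sa.1 * tperm b (iter l (sa.1^-1) d)), sa.2 * tperm d b).

Lemma opn_fwd X d b s a : dm X d s a -> a d = b -> b \notin porbit s d ->
  let s3 := skip b (cut d b s) in let a3 := a * tperm d b in
  [/\ lm (X :\ b) d s3 a3, (#|porbit s3 d|.+1 = #|porbit s d| + #|porbit s b|)%N,
    nv (X :\ b) (a3 * s3) = nv X (a * s),
    porbit s3 d = (porbit s d :|: porbit s b) :\ b
   & forall x, x \notin porbit s d :|: porbit s b -> porbit s3 x = porbit s x].
Proof.
move=> /andP [h1 h2] e hb s3 a3; subst b.
have [hbX ndb hs1 ha1 XE] := cd_cut h1; set b := a d in hb s3 a3 hbX ndb hs1 ha1 XE *.
have [h3 h4] := cut_diff ndb hb.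
case/and4P: (h1) => hd hs ha hc.
have cX : cpt (cut d b s) a3 d = X.
  rewrite [RHS]XE; have : b \in cpt (cut d b s) a3 d.
    by apply: (subsetP (porbit_min _ _)) h3; [exact: cpt_id | exact: cpt_stables].
  by move/cpt_eq => ->; rewrite setUid.
have [_ c1 c2 c3] := conn2_skip hd hbX ndb hs1 ha1 cX.
have n1 := nv_cut hd hbX hs ndb.
have p3 : porbit s3 d = (porbit s d :|: porbit s b) :\ b by rewrite porbit_skip // h4.
have dj : #|porbit s d :|: porbit s b| = (#|porbit s d| + #|porbit s b|)%N.
  rewrite -cardsUI [_ :&: _](_ : _ = set0) ?cards0 ?addn0 //.
  apply/setP => y; rewrite !inE; apply/negP => /andP [/porbit_eq y1 /porbit_eq y2].
  by move/negP: hb; apply; rewrite -y1 y2 porbit_id.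
have dj2 : #|porbit s d :|: porbit s b| = #|porbit s3 d|.+1.
  by rewrite (cardsD1 b) -p3 inE porbit_id orbT.
split=> //.
- rewrite /lm c1 /= -/s3 -/a3 c2 c3 cut_mulM; move: h2 n1 (cardsD1 b X); rewrite hbX hb.
  by move=> /eqP h2 n1 e1; apply/eqP; move: h2 n1 e1; rewrite -muln2 /=; clear; lia.
- by rewrite -dj2 dj.
- by rewrite c3 cut_mulM.
- move=> x; rewrite inE negb_or => /andP [x1 x2].
  have xb : x != b by apply: contraNneq x2 => ->; apply: porbit_id.
  rewrite porbit_skip // cut_other //; apply/setP => y; rewrite !inE.
  by rewrite andb_idl // => hy; apply: contraNneq x2 => <-; rewrite porbit_sym.
Qed.

Lemma cls_opn X d b s a l : dm X d s a -> a d = b -> b \notin porbit s d ->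
  #|porbit s d| = l.+1 -> cls d b l (opn d b (s, a)) = (s, a).
Proof.
move=> h e hb hl; rewrite /cls /opn /=; congr pair; last by rewrite -mulgA tperm2 mulg1.
case/andP: h => h1 _; have := cd_cut h1; rewrite e /=; case=> hbX ndb _ _ _.
set s3 := skip _ _.
have it i : i <= l -> iter i s3 (s d) = iter i.+1 s d.
  elim: i => // i IH hi; rewrite iterS IH; last exact: ltnW.
  rewrite [in RHS]iterS; have nd : iter i.+1 s d != d by rewrite iter_porbit_neq // hl /= ltnS.
  have nb : iter i.+1 s d != b by apply: contraNneq hb => <-; apply: mem_iter_porbit.
  have nb2 : s (iter i.+1 s d) != b.
    by apply: contraNneq hb => <-; apply: (mem_iter_porbit _ _ i.+2).
  have e1 : cut d b s (iter i.+1 s d) = s (iter i.+1 s d) by rewrite cutE tpermD // eq_sym.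
  by rewrite /s3 skip_neq // e1.
(* In the merged cycle the darts of the old vertex of [d] appear as [s d], ..., [d], with [d] in
   position l after [s d]; so [cls] finds the splitting point by walking back l steps from [d]. *)
have e2 : iter l s3^-1 d = s d.
  have e3 : iter l s3 (s d) = d by rewrite it // -hl iter_porbit.
  by have := iter_permK s3 l (s d); rewrite e3.
rewrite e2 /s3 /skip cutE tpermR -mulgA tperm2 mulg1 cutK //.
Qed.

Lemma cls_bwd X d b l s3 a3 : b \in X -> lm (X :\ b) d s3 a3 -> l < #|porbit s3 d| ->
  let s := (cls d b l (s3, a3)).1 in let a := (cls d b l (s3, a3)).2 in
  [/\ dm X d s a, a d = b, b \notin porbit s d, #|porbit s d| = l.+1
   & opn d b (s, a) = (s3, a3)].
Proof.
move=> hbX /andP [h1 h2] hl s a.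
case/and4P: (h1) => hd hs3 ha3 /eqP hc; move: (hd); rewrite !inE => /andP [ndb hdX].
have s3b : s3 b = b by rewrite (out_perm hs3) // !inE eqxx.
pose x0 := iter l s3^-1 d; pose s1 := s3 * tperm b x0.
have s1b : s1 b = x0 by rewrite permM s3b tpermL.
have sk : skip b s1 = s3 by rewrite /skip s1b /s1 -mulgA tperm2 mulg1.
have yl : iter l s3 x0 = d.
  exact: iter_permKV.
have yO i : iter i s3 x0 \in porbit s3 d.
  have : x0 \in porbit s3 d.
    by rewrite porbit_sym -yl mem_iter_porbit.
  by move/porbit_eq => <-; apply: mem_iter_porbit.
have nbO : b \notin porbit s3 d.
  rewrite porbit_sym; apply/negP => h; move/eqP: ndb; apply.
  apply/set1P; apply: (subsetP (porbit_min _ _)) h; rewrite ?set11 // => y /set1P ->.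
  by rewrite s3b set11.
have yb i : iter i s3 x0 != b by apply: contraNneq nbO => <-.
have cO : #|porbit s3 x0| = #|porbit s3 d| by rewrite (porbit_eq (yO 0)).
have yd i : i < l -> iter i s3 x0 != d.
  move=> hi; apply/eqP => e; have := @iter_porbit_neq _ s3 d (l - i).
  rewrite subn_gt0 hi (leq_ltn_trans (leq_subr _ _)) // => /(_ isT) /eqP; apply.
  by rewrite -{1}e -iterD subnK ?yl // ltnW.
have y0 i : i < l -> iter i.+1 s3 x0 != x0.
  by move=> hi; apply: iter_porbit_neq; rewrite cO /= (leq_ltn_trans hi).
have sE : s = cut d b s1 by [].
have sd i : i <= l -> iter i.+1 s d = iter i s3 x0.
  elim: i => [|i IH] hi; first by rewrite /= sE cutE tpermL.
  rewrite iterS IH; last exact: ltnW.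
  rewrite sE cutE tpermD 1?eq_sym ?yd ?yb // /s1 permM -iterS tpermD // eq_sym ?yb ?y0 //.
have szd : #|porbit s d| = l.+1.
  apply: card_porbit_iter; first by rewrite sd.
  by case=> // i /andP [_ hi]; rewrite sd ?yd // ltnW.
have nb : b \notin porbit s d.
  rewrite -[_ \in _]/(_ \in mem _) porbit_traject szd; apply/negP => /trajectP [[|i] hi e].
    by rewrite e eqxx in ndb.
  have hi' : i <= l by apply: ltnW.
  by case/eqP: (yb i); rewrite -(sd _ hi').
have ndb' : d != b by [].
have ha1 : mtch (X :\ d :\ b) a3 by rewrite setD1D1.
have x0X : x0 \in X.
  have : x0 \in X :\ b by apply: (subsetP (porbit_min hd _)) (yO 0); apply: stable_out hs3 _.
  by rewrite inE => /andP [].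
have hs1 : perm_on X s1.
  apply: perm_onM; last exact: perm_on_tperm.
  by apply: (perm_onS hs3); apply: subsetDl.
have a3b : a3 b = b by rewrite (mtch_out ha1) // !inE eqxx.
have [h3 _] := cut_diff ndb' nb; rewrite sE cutK in h3.
have bC : b \in cpt s1 a3 d.
  by apply: (subsetP (porbit_min _ _)) h3; [exact: cpt_id | exact: cpt_stables].
have XE : X = cpt s1 a3 d :|: cpt s1 a3 b.
  by rewrite (cpt_eq bC) setUid -(setD1K bC) -cpt_skip // sk hc setD1K.
have /andP [c1 /eqP c2] := cd_uncut hdX hbX ndb' hs1 ha1 XE.
have oE : opn d b (s, a) = (s3, a3).
  by rewrite /opn /= sE cutK sk /a /cls /= -mulgA tperm2 mulg1.
split=> //; rewrite /dm.
rewrite [cd _ _ _ _]c1 /=.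
have cX : cpt s1 a3 d = X by rewrite [RHS]XE (cpt_eq bC) setUid.
have [_ _ c3 c4] := conn2_skip hdX hbX ndb' hs1 ha1 cX.
rewrite sk in c3 c4.
have n1 := nv_cut hdX hbX hs1 ndb'; rewrite h3 -sE in n1.
have e5 : nv X (a * s) = nv X (a3 * s1) by rewrite -(cut_mulM a3 s1 d b).
move: h2; rewrite c3 c4 e5 => /eqP h2; apply/eqP.
move: h2 n1 (cardsD1 b X); rewrite hbX /=; clear; lia.
Qed.

End Corr.

(** * Cutting the map along a root loop *)

Section Loop.
Variable T : finType.
Implicit Types (s a p q : {perm T}) (X Y Z : {set T}) (x y r d b : T).

Lemma disjD Y X : [disjoint Y & X :\: Y].
Proof. by apply/pred0P => x /=; rewrite !inE; case: (x \in Y). Qed.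

Lemma rp_porbit p Y x : stable p Y -> x \in Y -> porbit (restr_perm Y p) x = porbit p x.
Proof.
move=> st hx; apply: porbit_congr => y hy; rewrite rpE //.
by rewrite (subsetP (porbit_min hx st)).
Qed.

Lemma rp_mul p Y Z : stable p Y -> stable p Z -> [disjoint Y & Z] -> perm_on (Y :|: Z) p ->
  restr_perm Y p * restr_perm Z p = p.
Proof.
move=> hY hZ dj hp; apply/permP => x; rewrite permM !rpE //.
case: (boolP (x \in Y)) => xY.
  by rewrite (disjointFr dj) // stable_eq.
case: (boolP (x \in Z)) => xZ //.
by rewrite (out_perm hp) // inE negb_or xY.
Qed.

Lemma rp_recl p q Y Z : perm_on Y p -> perm_on Z q -> [disjoint Y & Z] ->
  restr_perm Y (p * q) = p.
Proof.
move=> hp hq dj.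
have e x : x \in Y -> (p * q) x = p x.
  move=> hx; rewrite permM (out_perm hq) // (disjointFr dj) // perm_closed //.
have st : stable (p * q) Y by move=> x hx; rewrite e // perm_closed.
apply/permP => x; rewrite rpE //; case: (boolP (x \in Y)) => xY; first exact: e.
by rewrite (out_perm hp xY).
Qed.

Lemma perm_on_comm p q Y Z : perm_on Y p -> perm_on Z q -> [disjoint Y & Z] -> p * q = q * p.
Proof.
move=> hp hq dj; apply/permP => x; rewrite !permM.
case: (boolP (x \in Y)) => xY.
  rewrite (out_perm hq (x := x)) ?(disjointFr dj) // (out_perm hq) //.
  by rewrite (disjointFr dj) // perm_closed.
rewrite (out_perm hp xY); case: (boolP (x \in Z)) => xZ.
  by rewrite (out_perm hp) // (disjointFl dj) // perm_closed.
by rewrite (out_perm hq xZ) (out_perm hp xY).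
Qed.

Lemma rp_recr p q Y Z : perm_on Y p -> perm_on Z q -> [disjoint Y & Z] ->
  restr_perm Z (p * q) = q.
Proof.
move=> hp hq dj; rewrite (perm_on_comm hp hq dj); apply: rp_recl hq hp _.
by rewrite disjoint_sym.
Qed.

Lemma cpt_congr Y s a s' a' r : r \in Y -> stable s Y -> stable a Y ->
  (forall x, x \in Y -> s' x = s x) -> (forall x, x \in Y -> a' x = a x) ->
  cpt s' a' r = cpt s a r.
Proof.
have key (u v u' v' : {perm T}) : r \in Y -> stable u Y -> stable v Y ->
  (forall x, x \in Y -> u' x = u x) -> (forall x, x \in Y -> v' x = v x) ->
  cpt u' v' r \subset cpt u v r.
  move=> hr hu hv e e'.
  have sub := subsetP (cpt_min hr hu hv).
  apply: cpt_min; rewrite ?cpt_id // => x hx.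
    by rewrite e ?sub // cpt_stables.
  by rewrite e' ?sub // cpt_stablea.
move=> hr hs ha e e'; apply/eqP; rewrite eqEsubset key //=.
apply: key => //; try by move=> x hx; rewrite ?e ?e' //.
- by move=> x hx; rewrite e // hs.
- by move=> x hx; rewrite e' // ha.
Qed.

(** A loop in a planar map separates: opening it creates one more vertex with the same faces, so a
    result that stays connected would violate [cl_bound]. Both pieces are planar because their two
    Euler inequalities add up to an equality. *)
Lemma loop_fwd X d b s a : dm X d s a -> a d = b -> b \in porbit s d ->
  let s1 := cut d b s in let a1 := a * tperm d b in let Y := cpt s1 a1 d in
  [/\ [/\ Y \subset X, d \in Y, b \in X :\: Y & (stable s1 Y /\ stable a1 Y)],
      lm Y d (restr_perm Y s1) (restr_perm Y a1),
      lm (X :\: Y) b (restr_perm (X :\: Y) s1) (restr_perm (X :\: Y) a1)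
    & nv X (a * s) = (nv Y (restr_perm Y a1 * restr_perm Y s1)%g +
      nv (X :\: Y) (restr_perm (X :\: Y) a1 * restr_perm (X :\: Y) s1)%g)%N].
Proof.
move=> /andP [h1 h2] e hb; subst b => s1 a1 Y.
have [hbX ndb hs1 ha1 XE] := cd_cut h1; set b := a d in s1 a1 Y hb hbX ndb hs1 ha1 XE *.
case/and4P: (h1) => hd hs ha hc; have n1 := nv_cut hd hbX hs ndb.
have hbY : b \notin Y.
  apply/negP => bY; have cX : cpt s1 a1 d = X by rewrite [RHS]XE (cpt_eq bY) setUid.
  have [_ c1 c2 c3] := conn2_skip hd hbX ndb hs1 ha1 cX.
  have := cl_bound c1; rewrite c2 c3 cut_mulM.
  move: h2 n1 (cardsD1 b X); rewrite hbX hb /= => /eqP; clear; lia.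
have [c1 c2 dj c3 c4] := disc_split hd hbX ndb hs1 ha1 hbY XE.
have ZE : X :\: Y = cpt s1 a1 b.
  rewrite [in LHS]XE setDUl setDv set0U; apply/setDidPl; rewrite disjoint_sym; exact: dj.
have YX : Y \subset X by apply/subsetP => x xY; rewrite XE inE xY.
rewrite cut_mulM in c4; rewrite ZE.
have cYZ : #|X| = (#|Y| + #|cpt s1 a1 b|)%N.
  by rewrite [in LHS]XE -cardsUI [_ :&: _](disjoint_setI0 dj) cards0 addn0.
have b1 := cl_bound c1; have b2 := cl_bound c2.
have [E1 E2] : (2 * (nv Y (restr_perm Y s1) + nv Y (restr_perm Y a1 * restr_perm Y s1)%g) = #|Y| + 3)%N /\
  (2 * (nv (cpt s1 a1 b) (restr_perm (cpt s1 a1 b) s1) + nv (cpt s1 a1 b) (restr_perm (cpt s1 a1 b) a1 * restr_perm (cpt s1 a1 b) s1)%g) = #|cpt s1 a1 b| + 3)%N.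
  move: h2 n1; rewrite hb /= => /eqP; move: b1 b2 c3 c4 cYZ; rewrite -/s1 -/a1 -/Y; clear; lia.
split=> //.
- by split; rewrite ?cpt_id //; split; [exact: cpt_stables | exact: cpt_stablea].
- by rewrite /lm c1 E1 eqxx.
- by rewrite /lm c2 E2 eqxx.
Qed.

Lemma loop_porbit X d b s Y : d != b -> b \in porbit s d -> stable (cut d b s) Y ->
  perm_on X s -> d \in X -> b \in X ->
  d \in Y -> b \in X :\: Y ->
  [/\ porbit s d = porbit (restr_perm Y (cut d b s)) d :|: porbit (restr_perm (X :\: Y) (cut d b s)) b,
   (#|porbit s d| = #|porbit (restr_perm Y (cut d b s)) d| + #|porbit (restr_perm (X :\: Y) (cut d b s)) b|)%N,
   forall x, x \in Y :\: porbit (restr_perm Y (cut d b s)) d ->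
     porbit s x = porbit (restr_perm Y (cut d b s)) x
  & forall x, x \in X :\: Y :\: porbit (restr_perm (X :\: Y) (cut d b s)) b ->
     porbit s x = porbit (restr_perm (X :\: Y) (cut d b s)) x].
Proof.
set s1 := cut d b s => ndb hb st hs dX bX hd hbZ.
have stX : stable s1 X by apply: stable_out (subxx X); apply: perm_on_cut.
have stZ : stable s1 (X :\: Y) by apply: stableD.
rewrite !rp_porbit //; have [_ e] := cut_same ndb hb.
have pY := porbit_min hd st; have pZ := porbit_min hbZ stZ.
split => //.
- rewrite e -cardsUI [_ :&: _](_ : _ = set0) ?cards0 ?addn0 //.
  apply/eqP; rewrite setI_eq0; apply: disjointWl pY _; apply: disjointWr pZ _.
  exact: disjD.
- move=> x; rewrite inE => /andP [x1 x2]; rewrite rp_porbit //.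
  rewrite -{1}(cutK d b s) cut_other //.
  by apply: contraTN x2 => /(subsetP pZ); rewrite inE => /andP [].
- move=> x; rewrite inE => /andP [x1 x2]; rewrite rp_porbit //.
  rewrite -{1}(cutK d b s) cut_other //.
  by apply: contraTN x2 => /(subsetP pY); rewrite !inE => ->.
Qed.

Lemma mtchM Y Z a a' : mtch Y a -> mtch Z a' -> [disjoint Y & Z] -> mtch (Y :|: Z) (a * a').
Proof.
move=> ha ha' dj.
have e x : (a * a') x = if x \in Y then a x else a' x.
  rewrite permM; case: (boolP (x \in Y)) => xY; last by rewrite (mtch_out ha xY).
  by rewrite (mtch_out ha') // (disjointFr dj) // perm_closed // mtch_on.
have st1 x : (a x \in Y) = (x \in Y) by rewrite perm_closed // mtch_on.
have st2 x : x \notin Y -> a' x \notin Y.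
  move=> xY; case: (boolP (x \in Z)) => xZ; last by rewrite (mtch_out ha' xZ).
  by rewrite (disjointFl dj) // perm_closed // mtch_on.
apply/mtchP; split=> x; rewrite !e.
  case: (boolP (x \in Y)) => xY; first by rewrite st1 xY (mtchK _ ha).
  by rewrite (negPf (st2 _ xY)) (mtchK _ ha').
rewrite inE; case: (boolP (x \in Y)) => xY; first by rewrite (mtch_in _ ha) xY.
by rewrite (mtch_in _ ha').
Qed.

(** Euler's relations of the pieces add up to [#|X| + 6]; gluing the two legs into a loop merges two
    vertices into one and lowers this by 2, which is the relation for [dm]. *)
Lemma loop_bwd X d b Y s' a' s'' a'' : d \in X -> Y \subset X -> d \in Y -> b \in X :\: Y ->
  lm Y d s' a' -> lm (X :\: Y) b s'' a'' ->
  let s1 := s' * s'' in let a1 := a' * a'' in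
  let s := cut d b s1 in let a := a1 * tperm d b in
  [/\ dm X d s a, a d = b, b \in porbit s d & cpt s1 a1 d = Y] /\
  [/\ restr_perm Y s1 = s', restr_perm Y a1 = a', restr_perm (X :\: Y) s1 = s''
   & restr_perm (X :\: Y) a1 = a''].
Proof.
move=> dX YX dY bZ /andP [h1 E1] /andP [h2 E2] s1 a1 s a.
case/and4P: (h1) => _ hs' ha' /eqP hc'; case/and4P: (h2) => _ hs'' ha'' /eqP hc''.
have dj : [disjoint Y & X :\: Y] by exact: disjD.
have bX : b \in X by move: bZ; rewrite inE => /andP [].
have bY : b \notin Y by move: bZ; rewrite inE => /andP [].
have ndb : d != b by apply: contraNneq bY => <-.
have oa' : perm_on Y a' by apply: (perm_onS (mtch_on ha')); apply: subsetDl.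
have oa'' : perm_on (X :\: Y) a'' by apply: (perm_onS (mtch_on ha'')); apply: subsetDl.
have r1 := rp_recl hs' hs'' dj; have r2 := rp_recr hs' hs'' dj.
have r3 := rp_recl oa' oa'' dj; have r4 := rp_recr oa' oa'' dj.
have XU : X = Y :|: X :\: Y by rewrite setDE setUIr setUCr setIT; apply/esym/setUidPr.
have hs1 : perm_on X s1.
  apply: perm_onM; first by apply: (perm_onS hs').
  by apply: (perm_onS hs''); apply: subsetDl.
have ha1 : mtch (X :\ d :\ b) a1.
  have -> : X :\ d :\ b = (Y :\ d) :|: ((X :\: Y) :\ b).
    apply/setP => x; rewrite !inE; case: (boolP (x \in Y)) => xY /=.
      rewrite (subsetP YX) // !andbT andbF orbF; case: (eqVneq x b) => // e.
      by rewrite e in xY; rewrite xY in bY.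
    have nd : x != d by apply: contraNneq xY => ->.
    by rewrite nd ?andbF.
  apply: mtchM => //; apply: disjointWl (subsetDl _ _) _; apply: disjointWr (subsetDl _ _) _.
  exact: dj.
have st1 : stable s1 Y.
  move=> x hx; have h : s' x \in Y by rewrite perm_closed.
  by rewrite permM (out_perm hs'') ?h // (disjointFr dj).
have st2 : stable a1 Y.
  move=> x hx; have h : a' x \in Y by rewrite perm_closed.
  by rewrite permM (out_perm oa'') ?h // (disjointFr dj).
have st3 : stable s1 (X :\: Y) by apply: stableD => //; apply: stable_out hs1 (subxx X).
have a1X : stable a1 X.
  apply: stable_out (mtch_on ha1) _; exact: subset_trans (subsetDl _ _) (subsetDl _ _).
have st4 : stable a1 (X :\: Y) by apply: stableD.
have cY : cpt s1 a1 d = Y.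
  rewrite -[RHS]hc' -r1 -r3; apply/esym/(@cpt_congr Y) => // x hx;
  by rewrite rpE // hx.
have cZ : cpt s1 a1 b = X :\: Y.
  rewrite -[RHS]hc'' -r2 -r4; apply/esym/(@cpt_congr (X :\: Y)) => // x hx;
  by rewrite rpE // hx.
have XE : X = cpt s1 a1 d :|: cpt s1 a1 b by rewrite cY cZ.
have /andP [c1 /eqP c2] := cd_uncut dX bX ndb hs1 ha1 XE.
have nb : b \notin porbit s1 d by apply: contra bY => /(subsetP (porbit_min dY st1)).
have [hb _] := cut_diff ndb nb.
split; split=> //.
rewrite /dm [cd _ _ _ _]c1 /=.
have bC : b \notin cpt s1 a1 d by rewrite cY.
have [_ _ _ c3 c4] := disc_split dX bX ndb hs1 ha1 bC XE.
rewrite cY cZ r1 r2 r3 r4 in c3 c4.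
have n1 := nv_cut dX bX hs1 ndb; rewrite nb /= in n1.
have e5 : nv X (a * s) = nv X (a1 * s1) by rewrite -(cut_mulM a1 s1 d b).
have cX : #|X| = (#|Y| + #|X :\: Y|)%N by have := cardsID Y X; rewrite setIC (setIidPl YX).
rewrite e5 c4; move: n1 E1 E2; rewrite c3 cX -/s => n1 /eqP E1 /eqP E2; apply/eqP.
move: n1 E1 E2; clear; lia.
Qed.

End Loop.

End Rotations.

Import Order.TTheory GRing.Theory Num.Theory.
Local Open Scope ring_scope.

(** * Weighted sums over labelled planar maps *)

Section Sums.
Variables (T : finType) (A : comNzRingType) (z : A) (gam : nat -> A).
Implicit Types (s a : {perm T}) (X Y Z W : {set T}) (x y r d b : T).

Definition PW s W := \prod_(B in [set porbit s x | x in W]) gam #|B|.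

Lemma PW_eq s s' W : (forall x, x \in W -> porbit s x = porbit s' x) -> PW s W = PW s' W.
Proof. by move=> h; rewrite /PW (eq_in_imset h). Qed.

Lemma PWU s W W' : stable s W -> [disjoint W & W'] -> PW s (W :|: W') = PW s W * PW s W'.
Proof.
move=> st dj; rewrite /PW imsetU -bigU; last exact: imset_porbitU.
by apply: eq_bigl => B; rewrite !inE.
Qed.

Lemma PW_orbit s x : PW s (porbit s x) = gam #|porbit s x|.
Proof.
rewrite /PW; have -> : [set porbit s y | y in porbit s x] = [set porbit s x].
  apply/setP => B; apply/imsetP/set1P => [[y hy ->]|->]; first exact: porbit_eq.
  by exists x => //; apply: porbit_id.
by rewrite big_set1.
Qed.

Definition wt X r s a : A := z ^+ nv X (a * s)%g * PW s (X :\: porbit s r).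

(* The root degree is l.+1 in both sums; in [Zs] it includes the leg. *)
Definition Zs X r l : A :=
  \sum_(sa : {perm T} * {perm T} | lm X r sa.1 sa.2 && (#|porbit sa.1 r| == l.+1))
    wt X r sa.1 sa.2.
Definition Ds X d l : A :=
  \sum_(sa : {perm T} * {perm T} | dm X d sa.1 sa.2 && (#|porbit sa.1 d| == l.+1))
    wt X d sa.1 sa.2.

Lemma perm_on_set1 r (p : {perm T}) : perm_on [set r] p -> p = 1%g.
Proof.
move=> h; apply/permP => x; rewrite perm1; case: (eqVneq x r) => [->|n].
  by apply/set1P; rewrite perm_closed // set11.
by rewrite (out_perm h) // inE.
Qed.

Lemma porbit_card1 s r : (#|porbit s r| == 1%N) = (s r == r).
Proof.
apply/eqP/eqP => [h|h]; last by apply: (@card_porbit_iter _ _ _ 0) => // -[].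
by have := iter_porbit s r; rewrite h.
Qed.

Lemma porbit1 (x : T) : porbit 1%g x = [set x].
Proof.
apply/eqP; rewrite eqEsubset sub1set porbit_id andbT; apply: porbit_min; rewrite ?set11 //.
by move=> y /set1P ->; rewrite perm1 set11.
Qed.

Lemma Zs0 X r : Zs X r 0 = if X == [set r] then z else 0.
Proof.
rewrite /Zs; case: eqP => [->|ne]; last first.
  rewrite big1 // => -[s a] /= /andP [/andP [h _]].
  by rewrite porbit_card1 => /eqP /(cl_deg0 h).
rewrite (big_pred1 (1%g, 1%g)) => [|[s a]] /=.
  by rewrite /wt mulg1 /nv imset_set1 cards1 expr1 porbit1 setDv /PW imset0 big_set0 mulr1.
rewrite porbit_card1 /pred1 /= xpair_eqE; apply/andP/andP => [[/andP [/and4P [_ hs ha _] _] _]|[/eqP -> /eqP ->]].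
  split; apply/eqP; first exact: perm_on_set1 hs.
  by apply: (@perm_on_set1 r); apply: (perm_onS (mtch_on ha)); apply: subsetDl.
rewrite perm1 eqxx /lm /nv !imset_set1 !cards1 andbT; split=> //.
apply/and4P; split; rewrite ?set11 ?perm_on1 //.
  apply/mtchP; split=> x; rewrite !perm1 // eqxx !inE; by case: (x == r).
rewrite eqEsubset sub1set cpt_id andbT; apply: cpt_min; rewrite ?set11 // => x; by rewrite perm1.
Qed.

(** Deleting the leg makes its successor [d] the new root. Conversely [s * tperm r d] inserts [r]
    into the cycle of [d], immediately before [d]. *)
Lemma ZsS X r l : r \in X -> Zs X r l.+1 = \sum_(d in X :\ r) Ds (X :\ r) d l.
Proof.
move=> hr; rewrite /Zs (partition_big (fun sa : {perm T} * {perm T} => sa.1 r) (mem (X :\ r))) /=.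
  apply: eq_bigr => d hd; move: (hd); rewrite !inE => /andP [ndr dX].
  rewrite (reindex_onto (fun sa : {perm T} * {perm T} => ((sa.1 * tperm r d)%g, sa.2))
      (fun sa => (skip r sa.1, sa.2))) /=; last first.
    by move=> [s a] /= /andP [_ /eqP <-]; rewrite /skip -mulgA tperm2 mulg1.
  have key s a : [&& lm X r (s * tperm r d)%g a && (#|porbit (s * tperm r d)%g r| == l.+2),
      (s * tperm r d)%g r == d & (skip r (s * tperm r d)%g, a) == (s, a)] =
     dm (X :\ r) d s a && (#|porbit s d| == l.+1).
    case: (eqVneq (s r) r) => e; last first.
      rewrite [RHS]andbC; case: (boolP (dm _ _ _ _)) => h.
        case/andP: h => /and4P [_ hs _ _] _; move: e.
        by rewrite (out_perm hs) ?eqxx // !inE eqxx.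
      rewrite andbF; apply/negP => /and3P [_ _ /eqP [e2]]; move: e.
      by rewrite -{1}e2 skip_fix eqxx.
    have e1 : (s * tperm r d)%g r = d by rewrite permM e tpermL.
    have e2 : skip r (s * tperm r d)%g = s by rewrite /skip e1 -mulgA tperm2 mulg1.
    rewrite e1 e2 !eqxx !andbT lm_skip ?e1 // e2.
    case: (boolP (dm _ _ _ _)) => //= h.
    have hs : perm_on X (s * tperm r d)%g.
      case/andP: h => /and4P [_ hs _ _] _; apply: perm_onM; last exact: perm_on_tperm.
      by apply: (perm_onS hs); apply: subsetDl.
    rewrite hs /=; have : porbit s d = porbit (s * tperm r d)%g r :\ r.
      rewrite -{1}e2 porbit_skip //; congr (_ :\ _); apply: porbit_eq.
      by rewrite -{1}e1; apply/porbit_step/porbit_id.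
    by move=> ->; rewrite (cardsD1 r (porbit (s * tperm r d)%g r)) porbit_id eqSS.
  apply: eq_big => [[s a]|[s a]] /=; first by rewrite -key andbA.
  rewrite -andbA key => /andP [h _].
  move: (key s a); rewrite h /=.
  case/andP: (h) => /and4P [_ hs ha _] _.
  have e : s r = r by rewrite (out_perm hs) // !inE eqxx.
  have e1 : (s * tperm r d)%g r = d by rewrite permM e tpermL.
  have e2 : skip r (s * tperm r d)%g = s by rewrite /skip e1 -mulgA tperm2 mulg1.
  have har : a r = r by rewrite (mtch_out ha) // !inE eqxx.
  have hs' : perm_on X (s * tperm r d)%g.
    apply: perm_onM; last exact: perm_on_tperm.
    by apply: (perm_onS hs); apply: subsetDl.
  have hl : lm X r (s * tperm r d)%g a by rewrite lm_skip ?e1 // e2 h.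
  have [_ _ c3] := @cl_skip T X r (s * tperm r d)%g a (proj1 (andP hl)) ltac:(by rewrite e1).
  move=> _; rewrite /wt -c3 e2; congr (_ * _).
  have po x : x != r -> porbit s x = porbit (s * tperm r d)%g x :\ r by move=> hx; rewrite -{1}e2 porbit_skip.
  have pd : porbit (s * tperm r d)%g d = porbit (s * tperm r d)%g r.
    by apply: porbit_eq; rewrite -{1}e1; apply/porbit_step/porbit_id.
  have -> : X :\ r :\: porbit s d = X :\: porbit (s * tperm r d)%g r.
    rewrite po // pd; apply/setP => x; rewrite !inE.
    case: (eqVneq x r) => [->|] //=; by rewrite porbit_id.
  apply: PW_eq => x; rewrite inE => /andP [hx xX].
  have xr : x != r by apply: contraNneq hx => ->; apply: porbit_id.
  rewrite po //; apply/setP => y; rewrite !inE andb_idl // => hy.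
  by apply: contraNneq hx => e3; rewrite porbit_sym; move: hy; rewrite e3.
move=> [s a] /= /andP [/andP [/and4P [_ hs _ _] _] hl].
rewrite !inE perm_closed // hr andbT -porbit_card1; by rewrite (eqP hl).
Qed.

(** The merged vertex, with the leg [d], has degree l' + 1, one less than the sum of the two
    original degrees; the root had degree l + 1, so the other end had degree l' - l + 1. *)
Definition nonloop X d b l : A :=
  \sum_(l' < #|X| | (l <= l')%N) gam (l' - l).+1 * Zs (X :\ b) d l'.
(** [Y] is the set of darts on the side of [d]. The two root vertices have degrees i + 1 and l - i,
    which add up to the degree l + 1 of the vertex before it is split. *)
Definition loopsum X d b l : A :=
  \sum_(Y in powerset X | (d \in Y) && (b \notin Y))
    \sum_(i < l) Zs Y d i * Zs (X :\: Y) b (l.-1 - i).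

Lemma nonloop_eq X d b l : b \in X :\ d ->
  \sum_(sa : {perm T} * {perm T} | [&& dm X d sa.1 sa.2, #|porbit sa.1 d| == l.+1,
      sa.2 d == b & b \notin porbit sa.1 d]) wt X d sa.1 sa.2 = nonloop X d b l.
Proof.
rewrite !inE => /andP [nbd bX].
rewrite (reindex_onto (cls d b l) (opn d b)) /=; last first.
  by move=> [s a] /= /and4P [h /eqP h2 /eqP h3 h4]; apply: cls_opn h _ h4 h2.
transitivity (\sum_(j : {perm T} * {perm T} | lm (X :\ b) d j.1 j.2 && (l < #|porbit j.1 d|)%N)
    gam (#|porbit j.1 d| - l) * wt (X :\ b) d j.1 j.2).
  apply: eq_big => [[s3 a3]|[s3 a3]].
    apply/idP/idP => /=.
      move=> /andP [/and4P [h1 /eqP h2 /eqP h3 h4] /eqP h5].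
      have [c1 c2 _ _ _] := opn_fwd h1 h3 h4.
      case: h5 => e1 e2; rewrite e1 e2 in c1 c2; rewrite c1 /=.
      have : (0 < #|porbit (cut d b (s3 * tperm b (iter l s3^-1 d)))%g b|)%N.
        by apply/card_gt0P; exists b; apply: porbit_id.
      by move: c2; rewrite h2; clear; lia.
    move=> /andP [h1 h2]; have [c1 c2 c3 c4 c5] := cls_bwd bX h1 h2.
    by move: c1 c2 c3 c4 c5; rewrite /cls /= => -> -> -> -> ->; rewrite !eqxx.
  move=> /= /andP [/and4P [h1 /eqP h2 /eqP h3 h4] /eqP h5].
  have [c1 c2 c3 c4 c6] := opn_fwd h1 h3 h4.
  case: h5 => e1 e2; rewrite e1 e2 in c1 c2 c3 c4 c6.
  rewrite /wt c3 mulrCA; congr (_ * _).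
  move: h1 h2 h3 h4 c2 c4 c6; set s := cut _ _ _; set a := (a3 * _)%g => h1 h2 h3 h4 c2 c4 c6.
  have k : (#|porbit s3 d| - l = #|porbit s b|)%N by move: c2; rewrite h2; clear; lia.
  rewrite k -PW_orbit -(@PW_eq s s3 (X :\ b :\: porbit s3 d)); last first.
    move=> x; rewrite c4 !inE => /andP [h6 /andP [xb xX]]; apply/esym/c6.
    by move: h6; rewrite xb /= inE.
  rewrite -PWU; last 2 first.
  - exact: stable_porbit.
  - apply/pred0P => x /=; rewrite c4 !inE; case: (x \in porbit s b); rewrite ?orbT //=.
    by case: (eqVneq x b).
  congr (PW _ _); rewrite c4; apply/setP => x; rewrite !inE.
  have hs : perm_on X s by case/andP: h1 => /and4P [].
  have sX y : y \in porbit s b -> y \in X.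
    by apply/subsetP; apply: porbit_min => //; apply: stable_out hs (subxx X).
  case: (boolP (x \in porbit s b)) => xb /=.
    rewrite sX // andbT; apply/negP => /porbit_eq e.
    by move/negP: h4; apply; rewrite -e porbit_sym.
  rewrite orbF; case: (eqVneq x b) => [e|] //=.
  by rewrite e porbit_id in xb.
rewrite /nonloop /Zs; under [RHS]eq_bigr => l' _ do rewrite mulr_sumr.
rewrite (exchange_big_dep (fun j : {perm T} * {perm T} => lm (X :\ b) d j.1 j.2 && (l < #|porbit j.1 d|)%N)) /=; last first.
  by move=> l' j hl /andP [-> /eqP ->]; rewrite ltnS.
apply: eq_bigr => -[s a] /= /andP [h1 h2].
have hO : (#|porbit s d|.-1 < #|X|)%N.
  rewrite prednK; last exact: leq_ltn_trans h2.
  apply/subset_leq_card/porbit_min; first by case/andP: h1 => /and4P [/setD1P []].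
  by apply: (stable_out (X := X :\ b)); [case/andP: h1 => /and4P [] | apply: subsetDl].
rewrite (big_pred1 (Ordinal hO)) => [|i] /=.
  by congr (gam _ * _); move: h2; clear; lia.
rewrite h1 /= -val_eqE /=; move: h2; clear; lia.
Qed.

Lemma loop_eq X d b l : d \in X -> b \in X :\ d ->
  \sum_(sa : {perm T} * {perm T} | [&& dm X d sa.1 sa.2, #|porbit sa.1 d| == l.+1,
      sa.2 d == b & b \in porbit sa.1 d]) wt X d sa.1 sa.2 = loopsum X d b l.
Proof.
rewrite !inE => dX /andP [nbd bX]; have ndb : d != b by rewrite eq_sym.
pose Yof (sa : {perm T} * {perm T}) := cpt (cut d b sa.1) (sa.2 * tperm d b)%g d.
rewrite (partition_big Yof (fun Y => (Y \in powerset X) && ((d \in Y) && (b \notin Y)))) /=; last first.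
  move=> [s a] /= /and4P [h1 _ /eqP h2 h3]; have [[h4 h5 h6 _] _ _ _] := loop_fwd h1 h2 h3.
  by rewrite powersetE h4 [d \in _]h5 /=; move: h6; rewrite inE => /andP [].
apply: eq_bigr => Y; rewrite powersetE => /and3P [YX dY bY].
have bZ : b \in X :\: Y by rewrite inE bY.
pose h (q : ({perm T} * {perm T}) * ({perm T} * {perm T})) : {perm T} * {perm T} :=
  (cut d b (q.1.1 * q.2.1)%g, ((q.1.2 * q.2.2) * tperm d b)%g).
pose h' (sa : {perm T} * {perm T}) : ({perm T} * {perm T}) * ({perm T} * {perm T}) :=
  let s1 := cut d b sa.1 in let a1 := (sa.2 * tperm d b)%g in
  ((restr_perm Y s1, restr_perm Y a1), (restr_perm (X :\: Y) s1, restr_perm (X :\: Y) a1)).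
rewrite (reindex_onto h h') /=; last first.
  move=> [s a] /= /andP [/and4P [h1 _ /eqP h2 h3] /eqP hY].
  have [[_ _ _ [st1 st2]] c1 c2 _] := loop_fwd h1 h2 h3; rewrite -[cpt _ _ _]/(Yof (s, a)) hY in st1 st2 c1 c2.
  have dj := disjD Y X.
  have XU : Y :|: X :\: Y = X by rewrite setDE setUIr setUCr setIT; apply/setUidPr.
  have hs1 : perm_on X (cut d b s) by apply: perm_on_cut => //; case/andP: h1 => /and4P [].
  have ha1 : perm_on X (a * tperm d b)%g.
    by apply: perm_onM; [apply: mtch_on; case/andP: h1 => /and4P [] | apply: perm_on_tperm].
  have st3 : stable (cut d b s) (X :\: Y) by apply: stableD => //; apply: stable_out hs1 (subxx X).
  have st4 : stable (a * tperm d b)%g (X :\: Y) by apply: stableD => //; apply: stable_out ha1 (subxx X).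
  rewrite /h /h' /= !rp_mul ?XU // cutK -mulgA tperm2 mulg1 //.
transitivity (\sum_(q : ({perm T} * {perm T}) * ({perm T} * {perm T}) |
    [&& lm Y d q.1.1 q.1.2, lm (X :\: Y) b q.2.1 q.2.2 &
       #|porbit q.1.1 d| + #|porbit q.2.1 b| == l.+1]%N)
    wt Y d q.1.1 q.1.2 * wt (X :\: Y) b q.2.1 q.2.2).
  have fwd s a : dm X d s a -> a d == b -> b \in porbit s d -> Yof (s, a) == Y ->
    let q := h' (s, a) in
    [/\ lm Y d q.1.1 q.1.2, lm (X :\: Y) b q.2.1 q.2.2,
      (#|porbit s d| = #|porbit q.1.1 d| + #|porbit q.2.1 b|)%N
      & wt X d s a = wt Y d q.1.1 q.1.2 * wt (X :\: Y) b q.2.1 q.2.2].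
    move=> h1 /eqP h2 h3 /eqP hY q.
    have [[_ _ _ [st1 st2]] c1 c2 c3] := loop_fwd h1 h2 h3; rewrite -[cpt _ _ _]/(Yof (s, a)) hY in st1 st2 c1 c2 c3.
    have hs : perm_on X s by case/andP: h1 => /and4P [].
    have [d1 d2 d3 d4] := loop_porbit ndb h3 st1 hs dX bX dY bZ.
    have hs1 : perm_on X (cut d b s) by apply: perm_on_cut.
    split=> //.
    rewrite /wt c3 exprD mulrACA; congr (_ * _).
    have stY : stable (restr_perm Y (cut d b s)) Y.
      by move=> x hx; rewrite rpE // hx st1.
    have stZ : stable (restr_perm (X :\: Y) (cut d b s)) (X :\: Y).
      by move=> x hx; rewrite perm_closed //; apply: restr_perm_on.
    have pY := porbit_min dY stY; have pZ := porbit_min bZ stZ.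
    have -> : X :\: porbit s d = (Y :\: porbit (restr_perm Y (cut d b s)) d) :|:
       (X :\: Y :\: porbit (restr_perm (X :\: Y) (cut d b s)) b).
      rewrite d1; apply/setP => x; rewrite !inE.
      case: (boolP (x \in Y)) => xY /=.
        have hz : x \notin porbit (restr_perm (X :\: Y) (cut d b s)) b.
          by apply: contraTN xY => /(subsetP pZ); rewrite inE => /andP [].
        by rewrite (subsetP YX) // (negPf hz) !andbF !orbF !andbT.
      have hz : x \notin porbit (restr_perm Y (cut d b s)) d.
        by apply: contraNN xY => /(subsetP pY).
      by rewrite (negPf hz) ?andbF.
    have stD : stable s (Y :\: porbit (restr_perm Y (cut d b s)) d).
      move=> x hx; have hx' := hx; move: hx'; rewrite inE => /andP [x1 x2].
      have : s x \in porbit s x by apply/porbit_step/porbit_id.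
      rewrite d3 // => hsx; rewrite inE; apply/andP; split.
        by rewrite porbit_sym in hsx; apply: contra x1 => /porbit_eq <-.
      by apply: (subsetP (porbit_min x2 stY)).
    rewrite PWU //; last first.
      by apply: disjointWl (subsetDl _ _) _; apply: disjointWr (subsetDl _ _) _; apply: disjD.
    by rewrite (PW_eq d3) (PW_eq d4).
  have key q : ((dm X d (h q).1 (h q).2 && [&& #|porbit (h q).1 d| == l.+1, (h q).2 d == b & b \in porbit (h q).1 d])
     && (Yof (h q) == Y) && (h' (h q) == q)) = 
     [&& lm Y d q.1.1 q.1.2, lm (X :\: Y) b q.2.1 q.2.2 &
       #|porbit q.1.1 d| + #|porbit q.2.1 b| == l.+1]%N.
    apply/idP/idP.
      move=> /andP [/andP [/and4P [h1 /eqP h2 h3 h4] h5] /eqP h6].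
      have [] := fwd _ _ h1 h3 h4 ltac:(by rewrite -surjective_pairing).
      by rewrite -surjective_pairing h6 => -> -> <- _; rewrite h2 eqxx.
    case: q => -[s' a'] [s'' a''] /= /and3P [h1 h2 /eqP h3].
    have [[c1 c2 c3 c4] [c5 c6 c7 c8]] := loop_bwd dX YX dY bZ h1 h2.
    have e : h' (h (s', a', (s'', a''))) = (s', a', (s'', a'')).
      by rewrite /h' /h /= cutK -!mulgA tperm2 mulg1 c5 c6 c7 c8.
    have eY : Yof (h (s', a', (s'', a''))) = Y.
      by rewrite /Yof /h /= cutK -!mulgA tperm2 mulg1.
    rewrite e eY /h /= c1 c2 c3 !eqxx !andbT /=.
    have [] := fwd _ _ c1 ltac:(by rewrite c2) c3 ltac:(by rewrite -[(_, _)]/(h (s', a', (s'', a''))) eY).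
    by rewrite -[(_, _)]/(h (s', a', (s'', a''))) e /= => _ _ -> _; rewrite h3.
  apply: eq_big => q; first exact: key.
  rewrite key => /and3P [h1 h2 h3].
  have := key q; rewrite h1 h2 h3 [RHS]/= => /andP [/andP [/and4P [g1 _ g3 g4] g5] /eqP g6].
  have [_ _ _] := fwd _ _ g1 g3 g4 ltac:(by rewrite -surjective_pairing).
  by rewrite -surjective_pairing g6.
rewrite -(pair_big_dep (fun p : {perm T} * {perm T} => lm Y d p.1 p.2)
   (fun p q : {perm T} * {perm T} => lm (X :\: Y) b q.1 q.2 && (#|porbit p.1 d| + #|porbit q.1 b| == l.+1)%N)
   (fun p q => wt Y d p.1 p.2 * wt (X :\: Y) b q.1 q.2)) /=.
under [RHS]eq_bigr => i _ do rewrite /Zs mulr_suml.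
rewrite [RHS](exchange_big_dep (fun p : {perm T} * {perm T} => lm Y d p.1 p.2)) /=; last first.
  by move=> i p _ /andP [].
apply: eq_bigr => p hp.
have p0 : (0 < #|porbit p.1 d|)%N by apply/card_gt0P; exists d; apply: porbit_id.
case: (leqP #|porbit p.1 d| l) => hl; last first.
  rewrite !big1 //.
    by move=> i; rewrite hp /= => /eqP e; move: hl (ltn_ord i); rewrite e; clear; lia.
  move=> q /andP [_ /eqP e].
  have q0 : (0 < #|porbit q.1 b|)%N by apply/card_gt0P; exists b; apply: porbit_id.
  have f (u v n : nat) : (u + v = n.+1)%N -> (n < u)%N -> (0 < v)%N -> False by clear; lia.
  by case: (f _ _ _ e hl q0).
have hO : (#|porbit p.1 d|.-1 < l)%N by move: p0 hl; clear; lia.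
rewrite [RHS](big_pred1 (Ordinal hO)) => [|i] /=; last first.
  rewrite hp /= -val_eqE /=.
  have f (u v : nat) : (0 < u)%N -> (u == v.+1)%N = (v == u.-1)%N by clear; lia.
  exact: f p0.
rewrite -mulr_sumr; congr (_ * _); apply: eq_bigl => q; congr (_ && _).
have q0 : (0 < #|porbit q.1 b|)%N by apply/card_gt0P; exists b; apply: porbit_id.
have f (u v n : nat) : (0 < u)%N -> (0 < v)%N -> (u <= n)%N ->
  (u + v == n.+1)%N = (v == (n.-1 - u.-1).+1)%N by clear; lia.
exact: f p0 q0 hl.
Qed.

Lemma DsE X d l : d \in X -> Ds X d l = \sum_(b in X :\ d) (loopsum X d b l + nonloop X d b l).
Proof.
move=> dX; rewrite /Ds (partition_big (fun sa : {perm T} * {perm T} => sa.2 d) (mem (X :\ d))) /=; last first.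
  move=> [s a] /= /andP [/andP [/and4P [_ _ ha _] _] _].
  by rewrite !inE perm_closed ?(mtch_on ha) // dX andbT (mtch_in _ ha).
apply: eq_bigr => b hb; rewrite -loop_eq // -nonloop_eq //.
rewrite (bigID (fun sa : {perm T} * {perm T} => b \in porbit sa.1 d)) /=.
by congr (_ + _); apply: eq_bigl => sa; rewrite -!andbA.
Qed.

End Sums.

(** * Tutte's recursion for the weights *)

Section Tutte.
Variables (A : comNzRingType) (z : A) (gam : nat -> A).

(** The first sum belongs to a root edge that is a loop with a map on either side, the second to a
    root edge whose contraction merges a vertex of degree l' - l0 + 1 into the root. The bound on l'
    exceeds every root degree possible with n edges, which is at most 2 n. *)
Definition Wstep (V : nat -> nat -> A) n l : A :=
  if l is l0.+1 then
    \sum_(i < n.+1) \sum_(j < l0) V i j * V (n - i)%N (l0.-1 - j)%N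
    + \sum_(l' < n.*2.+2 | (l0 <= l')%N) gam (l' - l0).+1 * V n l'
  else 0.

(* [Wnl n l] is the weight of planar maps with n edges and root degree l; the table
   makes the recursion on all smaller numbers of edges structural. *)
Fixpoint Wtab n : nat -> nat -> A :=
  if n is n'.+1 then
    fun m l => if (m <= n')%N then Wtab n' m l else Wstep (Wtab n') n' l
  else fun _ l => if l == 0%N then z else 0.

Definition Wnl n l := Wtab n n l.

Lemma WtabE n m l : (m <= n)%N -> Wtab n m l = Wnl m l.
Proof.
elim: n => [|n IH]; first by rewrite leqn0 => /eqP ->.
rewrite leq_eqVlt => /orP [/eqP -> //|]; rewrite ltnS => h.
by rewrite /= h IH.
Qed.

Lemma WnlS n l : Wnl n.+1 l = Wstep Wnl n l.
Proof.
rewrite /Wnl /= ltnn; case: l => // l; rewrite /Wstep; congr (_ + _).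
  apply: eq_bigr => i _; apply: eq_bigr => j _; rewrite !WtabE ?leq_subr //.
  by rewrite -ltnS.
Qed.

Variable T : finType.
Implicit Types (X Y : {set T}) (r d b : T).

(** Such a set is [d] together with an arbitrary subset of the other [#|X| - 2] elements. This turns
    the sum over the sides of a loop into binomial coefficients. *)
Lemma sum_subsets X d b (f : nat -> A) : d \in X -> b \in X -> d != b ->
  \sum_(Y in powerset X | (d \in Y) && (b \notin Y)) f #|Y| =
  \sum_(m < (#|X| - 2).+1) f m.+1 *+ 'C(#|X| - 2, m).
Proof.
move=> dX bX ndb; set B := X :\ d :\ b.
have cB : #|B| = (#|X| - 2)%N.
  have := cardsD1 d X; have := cardsD1 b (X :\ d).
  by rewrite dX !inE eq_sym ndb bX -/B /=; clear; lia.
rewrite (reindex_onto (fun U => d |: U) (fun Y => Y :\ d)) /=; last first.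
  by move=> Y /and3P [_ dY _]; rewrite setD1K.
rewrite -cB (partition_big (fun U : {set T} => inord #|U| : 'I_#|B|.+1) predT) //=.
apply: eq_bigr => m _; rewrite -cards_draws -sumr_const.
apply: eq_big => [U|U].
  rewrite !inE subUset sub1set dX eqxx /= negb_or.
  apply/idP/idP.
    move=> /andP [/andP [/andP [UX /andP [bd bU]] /eqP e] /eqP e2].
    have UB : U \subset B.
      apply/subsetP => x xU; rewrite !inE (subsetP UX) // andbT.
      apply/andP; split; first by apply: contraNneq bU => <-.
      by move: xU; rewrite -e !inE => /andP [].
    rewrite UB /= -e2 inordK // ltnS; exact: subset_leq_card.
  move=> /andP [UB /eqP e].
  have dU : d \notin U by apply/negP => /(subsetP UB); rewrite !inE eqxx andbF.
  have bU : b \notin U by apply/negP => /(subsetP UB); rewrite !inE eqxx.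
  rewrite (subset_trans UB) /=; last by apply: subset_trans (subsetDl _ _) (subsetDl _ _).
  by rewrite setU1K // bU e inord_val !eqxx eq_sym ndb.
move=> /andP [/andP [/and3P [h1 _ h3] /eqP h4] /eqP h2].
have dU : d \notin U by rewrite -h4 !inE eqxx.
rewrite cardsU1 dU add1n -h2 inordK // ltnS; apply/subset_leq_card/subsetP => x xU.
move: h1; rewrite powersetE subUset => /andP [_ /subsetP /(_ _ xU) xX].
rewrite !inE xX andbT; apply/andP; split.
  by apply: contraNneq h3 => <-; rewrite !inE xU orbT.
by apply: contraNneq dU => <-.
Qed.

Lemma sum_even n (F : nat -> A) :
  \sum_(m < n.*2.+1) (if odd m then 0 else F m./2) = \sum_(i < n.+1) F i.
Proof.
elim: n => [|n IH]; first by rewrite !big_ord_recr !big_ord0.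
rewrite big_ord_recr [RHS]big_ord_recr /= -IH !doubleS big_ord_recr /= odd_double /= addr0.
by rewrite doubleK.
Qed.

(* The factorial counts labellings of the non-root darts; as X is an arbitrary set of
   darts, no relabelling is needed when a map is cut into pieces. *)
Definition Zspec N := forall X r l, #|X| = N -> r \in X ->
  Zs z gam X r l = if odd N then (N.-1)`!%:R * Wnl N./2 l else 0.

(** Each side of a loop carries one leg and therefore has an odd number of darts, so only even
    values of [#|Y| - 1] contribute and M has to be even. *)
Lemma Ds_aux M X d l : (forall N, (N <= M)%N -> Zspec N) -> #|X| = M -> d \in X ->
  Ds z gam X d l = if odd M then 0 else (M.-1)`!%:R * Wnl M./2 l.+1.
Proof.
move=> IH cX dX; rewrite DsE //.
  have M0 : (0 < M)%N by rewrite -cX; apply/card_gt0P; exists d.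
  have cXd : #|X :\ d| = M.-1 by have := cardsD1 d X; rewrite dX cX => ->.
  transitivity (\sum_(b in X :\ d) (if odd M then 0 else (M - 2)`!%:R * Wnl M./2 l.+1)); last first.
    rewrite sumr_const cXd; case: ifP => oM; first by rewrite mul0rn.
    rewrite -mulrnAl -mulrnA; case: (M) M0 oM => // -[|M'] // _ _.
    by rewrite /= !subSS subn0 mulnC.
  apply: eq_bigr => b; rewrite !inE => /andP [nbd bX].
  have ndb : d != b by rewrite eq_sym.
  have cXb : #|X :\ b| = M.-1 by have := cardsD1 b X; rewrite bX cX => ->.
  have dXb : d \in X :\ b by rewrite !inE ndb.
  pose f m := \sum_(j < l) (if odd m && odd (M - m) then
     (m.-1)`!%:R * Wnl m./2 j * ((M - m).-1`!%:R * Wnl (M - m)./2 (l.-1 - j)%N) else 0).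
  have -> : loopsum z gam X d b l = \sum_(m < (M - 2).+1) f m.+1 *+ 'C(M - 2, m).
    rewrite -cX -(sum_subsets _ dX bX ndb); apply: eq_bigr => Y; rewrite powersetE => /and3P [YX dY bY].
    have cY : #|X :\: Y| = (M - #|Y|)%N by rewrite cardsD (setIidPr YX) cX.
    have bZ : b \in X :\: Y by rewrite inE bY.
    have lt1 : (#|Y| <= M)%N by rewrite -cX subset_leq_card.
    have lt2 : (#|X :\: Y| <= M)%N by rewrite -cX subset_leq_card ?subsetDl.
    apply: eq_bigr => j _; rewrite (IH _ lt1 Y d j) // (IH _ lt2 (X :\: Y) b) // cY.
    by case: (odd #|Y|); case: (odd (M - #|Y|)); rewrite ?mul0r ?mulr0.
  have lt3 : (M.-1 <= M)%N by rewrite leq_pred.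
  have -> : nonloop z gam X d b l = \sum_(l' < M | (l <= l')%N) gam (l' - l).+1 *
     (if odd M.-1 then (M.-2)`!%:R * Wnl M.-1./2 l' else 0).
    by rewrite /nonloop cX; apply: eq_bigr => l' _; rewrite (IH _ lt3 (X :\ b) d).
  have M1 : (1 < M)%N.
    rewrite -cX (cardsD1 d X) dX (cardsD1 b (X :\ d)) !inE nbd bX //.
  case: (boolP (odd M)) => oM.
    rewrite !big1 ?addr0 // => [i _|i _].
      by rewrite (_ : odd M.-1 = false) ?mulr0 //; move: M0 oM; clear; lia.
    rewrite /f big1 ?mul0rn // => j _; rewrite ifF //.
    by apply/negbTE; move: oM (ltn_ord i) M1; clear; lia.
  pose n := M./2.-1; have Mn : M = n.*2.+2 by rewrite /n; move: oM M1; clear; lia.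
  rewrite Mn /= odd_double /= !subSS subn0 uphalf_double doubleK WnlS /Wstep mulrDr; congr (_ + _); last first.
    by rewrite mulr_sumr; apply: eq_bigr => l' _; rewrite mulrCA.
  rewrite mulr_sumr -(sum_even n (fun i => n.*2`!%:R * \sum_(j < l) Wnl i j * Wnl (n - i) (l.-1 - j))).
  apply: eq_bigr => m _; case: ifP => om.
    rewrite /f big1 ?mul0rn // => j _; rewrite /= om //.
  have [i mi] : exists i, m = i.*2 :> nat by exists m./2; move: om; clear; lia.
  have hi : (i <= n)%N by have := ltn_ord m; rewrite mi; clear; lia.
  rewrite mi /f Mn doubleK mulr_sumr -sumrMnl; apply: eq_bigr => j _.
  rewrite (_ : (n.*2.+2 - i.*2.+1)%N = (n - i).*2.+1); last by move: hi; clear; lia.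
  rewrite /= !odd_double /= !uphalf_double.
  (* The labels of the other 2 n darts are distributed over the two sides; the binomial coefficient
     turns the factorials of the sides into (2 n)!. *)
  rewrite -(@bin_fact n.*2 i.*2); last by rewrite leq_double.
  rewrite (_ : (n.*2 - i.*2)%N = (n - i).*2); last by rewrite doubleB.
  by rewrite !natrM; ring.
Qed.

Lemma Zs_val N : Zspec N.
Proof.
elim/ltn_ind: N => N IH X r l cX rX.
case: l => [|l].
  rewrite Zs0; case: eqP => [e|ne].
    by move: cX; rewrite e cards1 => <- /=; rewrite fact0 mul1r.
  case: ifP => // oN; case: (N) oN cX => [|[|m]] // oN cX.
    have /cards1P [y e] : #|X| == 1%N by rewrite cX.
    by case: ne; move: rX; rewrite e inE => /eqP ->.
  by rewrite /= WnlS /= mulr0.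
rewrite ZsS //.
have N0 : (0 < N)%N by rewrite -cX; apply/card_gt0P; exists r.
pose M := N.-1; have cXr : #|X :\ r| = M by have := cardsD1 r X; rewrite rX cX /M => ->.
have IH' N' : (N' <= M)%N -> Zspec N' by move=> h; apply: IH; rewrite -(prednK N0).
rewrite (eq_bigr _ (fun d dX => @Ds_aux M (X :\ r) d l IH' cXr dX)) sumr_const cXr.
case: (boolP (odd N)) => oN.
  have -> : odd M = false by rewrite /M; move: N0 oN; clear; lia.
  case: (posnP M) => M0.
    have e1 : N = 1%N by move: M0 N0; rewrite /M; clear; lia.
    by rewrite M0 mulr0n e1 /= /Wnl /= mulr0.
  rewrite -mulrnAl -mulrnA -/M (_ : M./2 = N./2); last by rewrite /M; move: oN; clear; lia.
  by congr (_%:R * _); case: (M) M0 => // M' _; rewrite factS mulnC.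
have -> : odd M by rewrite /M; move: N0 oN; clear; lia.
by rewrite mul0rn.
Qed.

Lemma Ds_val n X d l : #|X| = n.*2.+2 -> d \in X ->
  Ds z gam X d l = (n.*2.+1)`!%:R * Wnl n.+1 l.+1.
Proof.
move=> cX dX; rewrite (@Ds_aux n.*2.+2) //= => [|N _]; last exact: Zs_val.
by rewrite odd_double /= doubleK.
Qed.

End Tutte.

(** * Formal power series *)

HB.instance Definition _ k := gen_eqMixin (series k).
HB.instance Definition _ k := gen_choiceMixin (series k).

Definition sopp k (f : series k) : series k := fun m => - f m.

Lemma serP k (f g : series k) : (forall m, f m = g m) -> f = g.
Proof. by move=> h; apply: funext. Qed.

Lemma saddA k : associative (@sadd k).
Proof. by move=> f g h; apply: serP => m; rewrite /sadd addrA. Qed.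
Lemma saddC k : commutative (@sadd k).
Proof. by move=> f g; apply: serP => m; rewrite /sadd addrC. Qed.
Lemma sadd0 k : left_id (@szero k) (@sadd k).
Proof. by move=> f; apply: serP => m; rewrite /sadd /szero add0r. Qed.
Lemma saddN k : left_inverse (@szero k) (@sopp k) (@sadd k).
Proof. by move=> f; apply: serP => m; rewrite /sadd /szero /sopp addNr. Qed.

HB.instance Definition _ k :=
  GRing.isZmodule.Build (series k) (@saddA k) (@saddC k) (@sadd0 k) (@saddN k).

(** Coefficients of a product in degree below N depend only on the truncations at N. The ring laws
    of series, and later the rules for derivatives and substitution, are thus imported from
    polynomials. *)
Definition trunc k (N : nat) (f : series k) : {mpoly rat[k]} :=
  \sum_(m : 'X_{1..k < N}) f m *: 'X_[m].

Lemma mcoeff_trunc k N (f : series k) m :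
  (trunc N f)@_m = if (mdeg m < N)%N then f m else 0.
Proof.
rewrite /trunc raddf_sum /=; case: ifP => hm.
  rewrite (bigD1 (BMultinom hm)) //= mcoeffZ mcoeffX eqxx mulr1 big1 ?addr0 // => i ni.
  rewrite mcoeffZ mcoeffX; case: eqP => [e|_]; last by rewrite mulr0.
  by case/eqP: ni; apply: val_inj.
rewrite big1 // => i _; rewrite mcoeffZ mcoeffX; case: eqP => [e|_]; last by rewrite mulr0.
by move: (bmdeg i); rewrite e hm.
Qed.

Opaque trunc.

Lemma sderivE k (i : 'I_k) (f : series k) m : sderiv i f m = (m i).+1%:R * f (m + U_(i))%MM.
Proof. by []. Qed.

Lemma smul_mcoeff k N (f g : series k) m : (mdeg m < N)%N ->
  smul f g m = (trunc N f * trunc N g)@_m.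
Proof.
move=> hm; rewrite mcoeffM /smul pair_big /= [RHS]big_mkcond /=.
apply: eq_bigr => -[e e'] _ /=; rewrite eq_sym; case: eqP => // h.
rewrite !mcoeff_trunc.
have := bmdeg e; have := bmdeg e'; rewrite !ltnS => h1 h2.
by rewrite (leq_ltn_trans h2 hm) (leq_ltn_trans h1 hm).
Qed.

Lemma mdeg_leqD k (m a b : 'X_{1..k}) : m = (a + b)%MM -> (mdeg a <= mdeg m)%N.
Proof. by move->; rewrite mdegD leq_addr. Qed.

Lemma mcoeffM_trunc k N (p q : {mpoly rat[k]}) m : (mdeg m < N)%N ->
  (trunc N (spoly p) * q)@_m = (p * q)@_m.
Proof.
move=> hm; rewrite !mcoeffM; apply: eq_bigr => -[e e'] /= /eqP h.
by rewrite mcoeff_trunc (leq_ltn_trans (mdeg_leqD h) hm).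
Qed.

Lemma trunc_spoly k N (p q : {mpoly rat[k]}) m : (mdeg m < N)%N ->
  (trunc N (spoly p) * trunc N (spoly q))@_m = (p * q)@_m.
Proof. by move=> hm; rewrite mcoeffM_trunc // mulrC mcoeffM_trunc // mulrC. Qed.

Lemma spolyM k (p q : {mpoly rat[k]}) : spoly (p * q) = smul (spoly p) (spoly q).
Proof.
apply: serP => m; rewrite (@smul_mcoeff _ (mdeg m).+1) ?ltnSn //.
by rewrite trunc_spoly.
Qed.

Lemma trunc_smul k N (f g : series k) m : (mdeg m < N)%N ->
  forall p, (trunc N (smul f g) * p)@_m = (trunc N f * trunc N g * p)@_m.
Proof.
move=> hm p; rewrite !mcoeffM; apply: eq_bigr => -[e e'] /= /eqP h.
have he : (mdeg e < N)%N := leq_ltn_trans (mdeg_leqD h) hm.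
by rewrite mcoeff_trunc he (smul_mcoeff _ _ he).
Qed.

Lemma smulC k : commutative (@smul k).
Proof.
by move=> f g; apply: serP => m; rewrite !(@smul_mcoeff _ (mdeg m).+1) ?ltnSn // mulrC.
Qed.
Lemma smulA k : associative (@smul k).
Proof.
move=> f g h; apply: serP => m; rewrite !(@smul_mcoeff _ (mdeg m).+1) ?ltnSn //.
by rewrite trunc_smul // mulrC trunc_smul // mulrC mulrA.
Qed.
Lemma smul1 k : left_id (@sone k) (@smul k).
Proof.
move=> f; apply: serP => m; rewrite (@smul_mcoeff _ (mdeg m).+1) ?ltnSn //.
have -> : trunc (mdeg m).+1 (@sone k) = 1.
  apply/mpolyP => e; rewrite mcoeff_trunc mcoeff1 /sone.
  by case: eqP => [->|]; rewrite ?mdeg0 //; case: ifP.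
by rewrite mul1r mcoeff_trunc ltnSn.
Qed.
Lemma truncD k N (f g : series k) : trunc N (f + g) = trunc N f + trunc N g.
Proof.
by apply/mpolyP => m; rewrite mcoeffD !mcoeff_trunc; case: ifP; rewrite ?addr0.
Qed.
Lemma smulDl k : left_distributive (@smul k) (@sadd k).
Proof.
move=> f g h; apply: serP => m; rewrite /sadd !(@smul_mcoeff _ (mdeg m).+1) ?ltnSn //.
by rewrite -mcoeffD -mulrDl -truncD.
Qed.
Lemma sone_neq0 k : @sone k != 0.
Proof. by apply/eqP => /(congr1 (fun f : series k => f 0%MM)); rewrite /sone eqxx. Qed.

HB.instance Definition _ k :=
  GRing.Zmodule_isComNzRing.Build (series k) (@smulA k) (@smulC k) (@smul1 k) (@smulDl k) (@sone_neq0 k).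

Lemma ser0E k m : (0 : series k) m = 0. Proof. by []. Qed.
Lemma serDE k (f g : series k) m : (f + g) m = f m + g m. Proof. by []. Qed.
Lemma serNE k (f : series k) m : (- f) m = - f m. Proof. by []. Qed.
Lemma serBE k (f g : series k) m : (f - g) m = f m - g m. Proof. by []. Qed.
Lemma ser1E k m : (1 : series k) m = (m == 0%MM)%:R.
Proof. by rewrite /GRing.one /= /sone; case: eqP. Qed.
Lemma ser_sumE k I (r : seq I) P (F : I -> series k) m :
  (\sum_(i <- r | P i) F i) m = \sum_(i <- r | P i) F i m.
Proof. by elim/big_rec2: _ => // i y1 y2 _ <-. Qed.
Lemma serM k (f g : series k) N m : (mdeg m < N)%N -> (f * g) m = (trunc N f * trunc N g)@_m.
Proof. exact: smul_mcoeff. Qed.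

Lemma spoly_is_zmod k : zmod_morphism (@spoly k).
Proof. by move=> p q; apply: serP => m; rewrite serBE /spoly mcoeffB. Qed.
Lemma spoly_is_monoid k : monoid_morphism (@spoly k).
Proof.
split; last by move=> p q; exact: spolyM.
by apply: serP => m; rewrite ser1E /spoly mcoeff1.
Qed.
HB.instance Definition _ k := GRing.isZmodMorphism.Build _ _ (@spoly k) (@spoly_is_zmod k).
HB.instance Definition _ k := GRing.isMonoidMorphism.Build _ _ (@spoly k) (@spoly_is_monoid k).

Lemma spoly_inj k : injective (@spoly k).
Proof. by move=> p q h; apply/mpolyP => m; rewrite -[p@_m]/(spoly p m) h. Qed.

Lemma spoly_eq0 k (p : {mpoly rat[k]}) : (spoly p == 0) = (p == 0).
Proof. by rewrite -(rmorph0 (@spoly k)) (inj_eq (@spoly_inj k)). Qed.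

Definition cst k (c : rat) : series k := spoly c%:MP.
Arguments cst : clear implicits.
Lemma cst_is_zmod k : zmod_morphism (@cst k).
Proof. by move=> a b; rewrite /cst mpolyCB rmorphB. Qed.
Lemma cst_is_monoid k : monoid_morphism (@cst k).
Proof. by split=> [|a b]; rewrite /cst ?mpolyC1 ?rmorph1 // mpolyCM rmorphM. Qed.
HB.instance Definition _ k := GRing.isZmodMorphism.Build _ _ (@cst k) (@cst_is_zmod k).
HB.instance Definition _ k := GRing.isMonoidMorphism.Build _ _ (@cst k) (@cst_is_monoid k).

Definition X k (i : 'I_k) : series k := spoly 'X_i.

Lemma spolyX k (e m : 'X_{1..k}) : spoly 'X_[e] m = (m == e)%:R.
Proof. by rewrite /spoly mcoeffX eq_sym. Qed.

Lemma svarE k (i : 'I_k) : svar i = X i.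
Proof. by apply: serP => m; rewrite /X spolyX /svar /smono; case: eqP. Qed.

Lemma smonoE k (e : 'X_{1..k}) : smono e = spoly 'X_[e].
Proof. by apply: serP => m; rewrite spolyX /smono; case: eqP. Qed.

Lemma monoM k (e m : 'X_{1..k}) (f : series k) :
  (spoly 'X_[e] * f) m = if (e <= m)%MM then f (m - e)%MM else 0.
Proof.
rewrite (@serM _ _ _ (mdeg m).+1) // mcoeffM_trunc // mulrC.
case: ifP => h.
  move/submK: h; move: (m - e)%MM => m' <-.
  by rewrite [in X in X = _](addmC m' e) mcoeffMX mcoeff_trunc mdegD ltnS leq_addl.
rewrite mcoeffM big1 // => -[a b] /= /eqP hab.
rewrite mcoeffX; case: eqP => [e2|_]; last by rewrite mulr0.
by move/negP: h; case; move: (lem_addl (bmnm a) (bmnm b)); rewrite -hab e2.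
Qed.

Lemma cstM k c (f : series k) m : (cst k c * f) m = c * f m.
Proof.
rewrite (@serM _ _ _ (mdeg m).+1) // mcoeffM_trunc //.
by rewrite mcoeffCM mcoeff_trunc ltnSn.
Qed.

(** The filtration by order. It replaces a topology: identities between series are proved modulo
    every order, and maps that raise the order are contractions. *)
Definition inF k N (f : series k) := forall m, (mdeg m < N)%N -> f m = 0.

Lemma inF0 k N : inF N (0 : series k). Proof. by []. Qed.
Lemma inF_le k N M (f : series k) : (M <= N)%N -> inF N f -> inF M f.
Proof. by move=> h hf m hm; apply: hf; apply: leq_trans hm h. Qed.
Lemma inF00 k (f : series k) : inF 0 f. Proof. by []. Qed.
Lemma inFD k N (f g : series k) : inF N f -> inF N g -> inF N (f + g).
Proof. by move=> hf hg m hm; rewrite serDE hf // hg // addr0. Qed.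
Lemma inFN k N (f : series k) : inF N f -> inF N (- f).
Proof. by move=> hf m hm; rewrite serNE hf // oppr0. Qed.
Lemma inFB k N (f g : series k) : inF N f -> inF N g -> inF N (f - g).
Proof. by move=> hf hg; apply: inFD => //; apply: inFN. Qed.
Lemma inF_sum k N I (r : seq I) (P : pred I) (F : I -> series k) :
  (forall i, P i -> inF N (F i)) -> inF N (\sum_(i <- r | P i) F i).
Proof. by move=> h; elim/big_rec: _ => // i x Pi hx; apply: inFD => //; apply: h. Qed.

Lemma smul_def k (f g : series k) m : (f * g) m =
  \sum_(e : 'X_{1..k < (mdeg m).+1, (mdeg m).+1} | m == (e.1 + e.2)%MM) f e.1 * g e.2.
Proof.
rewrite (@serM _ _ _ (mdeg m).+1) // mcoeffM; apply: eq_bigr => -[e e'] /= _.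
by rewrite !mcoeff_trunc !bmdeg.
Qed.

Lemma serM_cong k (f f' g g' : series k) n :
  (forall m, (mdeg m <= mdeg n)%N -> f m = f' m) ->
  (forall m, (mdeg m <= mdeg n)%N -> g m = g' m) -> (f * g) n = (f' * g') n.
Proof.
move=> hf hg; rewrite !smul_def; apply: eq_bigr => -[u v] /= /eqP huv.
rewrite hf ?hg ?(mdeg_leqD huv) //.
by rewrite addmC in huv; rewrite (mdeg_leqD huv).
Qed.

Lemma inFM k N M (f g : series k) : inF N f -> inF M g -> inF (N + M) (f * g).
Proof.
move=> hf hg m hm; rewrite smul_def big1 // => -[e e'] /= /eqP he.
case: (ltnP (mdeg e) N) => h1; first by rewrite hf ?mul0r.
rewrite hg ?mulr0 //.
by have := congr1 (@mdeg k) he; rewrite mdegD; lia.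
Qed.
Lemma inFMl k N (f g : series k) : inF N f -> inF N (f * g).
Proof. by move=> hf; rewrite -[N]addn0; apply: inFM. Qed.
Lemma inFMr k N (f g : series k) : inF N g -> inF N (f * g).
Proof. by move=> hf; rewrite -[N]add0n; apply: inFM. Qed.
Lemma inFX k N n (f : series k) : inF N f -> inF (n * N) (f ^+ n).
Proof. by move=> hf; elim: n => // n IH; rewrite exprS mulSn; apply: inFM. Qed.
Lemma inF_eq k (f g : series k) : (forall N, inF N (f - g)) -> f = g.
Proof.
move=> h; apply: serP => m; apply/eqP; rewrite -subr_eq0 -serBE; apply/eqP.
exact: (h (mdeg m).+1).
Qed.
Lemma inF_X k (i : 'I_k) : inF 1 (X i).
Proof.
move=> m; rewrite ltnS leqn0 mdeg_eq0 => /eqP ->; rewrite /X spolyX.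
by rewrite eq_sym mnm1_eq0.
Qed.

Lemma inF_order k (f : series k) : f != 0 -> exists2 d, inF d f & exists2 m, mdeg m = d & f m != 0.
Proof.
move=> nf; have [m0 hm0] : exists m, f m != 0.
  apply: contrapT => h; case/eqP: nf; apply: serP => m; apply: contrapT => /eqP hm.
  by apply: h; exists m.
have ex : exists n, `[< exists2 m, mdeg m = n & f m != 0 >].
  by exists (mdeg m0); apply/asboolP; exists m0.
case: (ex_minnP ex) => d /asboolP hd hmin; exists d => // m hm.
apply: contrapT => /eqP hf; move: (hmin (mdeg m)); rewrite leqNgt hm => /implyP.
by rewrite implybF => /asboolP; apply; exists m.
Qed.

(** The homogeneous parts of lowest degree multiply to the part of degree d + d' of the product, and
    polynomials over a field have no zero divisors. *)
Lemma ser_mul_neq0 k (f g : series k) : f != 0 -> g != 0 -> f * g != 0.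
Proof.
move=> /inF_order [d hd [m md fm]] /inF_order [d' hd' [m' md' gm']].
pose low n (h : series k) : {mpoly rat[k]} := trunc n.+1 h.
have lc n h e : inF n h -> (low n h)@_e = if mdeg e == n then h e else 0.
  move=> hh; rewrite mcoeff_trunc ltnS leq_eqVlt; case: eqP => //= ne.
  by case: ifP => // /hh.
have l1 : low d f != 0.
  by apply/eqP => /mpolyP /(_ m); rewrite lc // md eqxx mcoeff0; apply/eqP.
have l2 : low d' g != 0.
  by apply/eqP => /mpolyP /(_ m'); rewrite lc // md' eqxx mcoeff0; apply/eqP.
have : low d f * low d' g != 0 by rewrite mulf_neq0.
move=> nz; have [e he] : exists e, (low d f * low d' g)@_e != 0.
  apply: contrapT => h; case/eqP: nz; apply/mpolyP => e; rewrite mcoeff0.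
  by apply: contrapT => /eqP hh; apply: h; exists e.
have de : mdeg e = (d + d')%N.
  move: he; rewrite mcoeffM; apply: contraNeq => ne; rewrite big1 // => -[a b] /= /eqP hab.
  rewrite !lc //; case: eqP => ea; last by rewrite mul0r.
  case: eqP => eb; last by rewrite mulr0.
  by move/eqP: ne; case; have := congr1 (@mdeg k) hab; rewrite mdegD ea eb.
apply/eqP => /(congr1 (fun h : series k => h e)) h0; case/eqP: he.
rewrite ser0E in h0; rewrite -{}h0 smul_def mcoeffM; apply: eq_bigr => -[a b] /= /eqP hab.
rewrite !lc //; have dd : (d + d' = mdeg a + mdeg b)%N by rewrite -de -mdegD -hab.
case: (ltngtP (mdeg a) d) => ha.
- by rewrite mul0r hd // mul0r.
- by rewrite mul0r hd' ?mulr0 //; lia.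
- by rewrite (_ : mdeg b == d') //; apply/eqP; lia.
Qed.

Lemma ser_mulI k (f g : series k) : f != 0 -> f * g = 0 -> g = 0.
Proof.
by move=> nf h; apply/eqP; apply: contraTT isT => ng; move/eqP: h (ser_mul_neq0 nf ng) => ->.
Qed.

Opaque smul.

Lemma serM2 k N M (f g : series k) m : (mdeg m < N)%N -> (mdeg m < M)%N ->
  (f * g) m = (trunc N f * trunc M g)@_m.
Proof.
move=> hN hM; rewrite (serM _ _ hN) !mcoeffM; apply: eq_bigr => -[a b] /= /eqP hab.
rewrite !mcoeff_trunc (leq_ltn_trans (mdeg_leqD hab) hN).
by rewrite addmC in hab; rewrite (leq_ltn_trans (mdeg_leqD hab) hN) (leq_ltn_trans (mdeg_leqD hab) hM).
Qed.

Lemma trunc_sderiv k N i (f : series k) : trunc N (sderiv i f) = (trunc N.+1 f)^`M(i).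
Proof.
apply/mpolyP => m; rewrite mcoeff_mderiv !mcoeff_trunc mdegD mdeg1 addn1 ltnS.
by case: ifP => _; rewrite ?mul0rn // sderivE mulr_natl.
Qed.

Lemma sderiv_is_zmod k (i : 'I_k) : zmod_morphism (@sderiv k i).
Proof. by move=> f g; apply: serP => m; rewrite /sderiv !serBE mulrBr. Qed.
HB.instance Definition _ k i := GRing.isZmodMorphism.Build _ _ (@sderiv k i) (@sderiv_is_zmod k i).

Lemma sderivM k i (f g : series k) : sderiv i (f * g) = sderiv i f * g + f * sderiv i g.
Proof.
apply: serP => m; rewrite sderivE (@serM _ _ _ (mdeg m).+2) ?mdegD ?mdeg1 ?addn1 //.
rewrite mulr_natl -mcoeff_mderiv mderivM mcoeffD serDE -!trunc_sderiv.
by rewrite -!serM2.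
Qed.

Lemma sderiv_spoly k i (p : {mpoly rat[k]}) : sderiv i (spoly p) = spoly (p^`M(i)).
Proof. by apply: serP => m; rewrite sderivE /spoly mcoeff_mderiv mulr_natl. Qed.

Lemma submm k (m : 'X_{1..k}) : (m - m = 0)%MM.
Proof. by apply/mnmP => i; rewrite mnmBE mnm0E subnn. Qed.

Lemma sderiv_X k (i j : 'I_k) : sderiv i (X j) = (i == j)%:R.
Proof.
rewrite /X sderiv_spoly mderivX mnm1E eq_sym; case: eqP => [->|_].
  by rewrite submm mpolyX0 scale1r rmorph1.
by rewrite scale0r rmorph0.
Qed.

Lemma sderiv_cst k (i : 'I_k) c : sderiv i (cst k c) = 0.
Proof. by rewrite /cst sderiv_spoly mderivC rmorph0. Qed.

Lemma sderiv1 k (i : 'I_k) : sderiv i 1 = 0.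
Proof. by rewrite -(rmorph1 (cst k)) sderiv_cst. Qed.

Lemma sderiv_comm k (i j : 'I_k) (f : series k) : sderiv i (sderiv j f) = sderiv j (sderiv i f).
Proof.
apply: serP => m; rewrite !sderivE !mnmDE !mnm1E -!addmA [(U_(i) + U_(j))%MM]addmC !mulrA.
congr (_ * _); rewrite [_ == j]eq_sym; case: eqP => [->|]; first by [].
by rewrite !addn0 mulrC.
Qed.

Lemma inF_sderiv k N i (f : series k) : inF N.+1 f -> inF N (sderiv i f).
Proof. by move=> h m hm; rewrite sderivE h ?mulr0 // mdegD mdeg1 addn1. Qed.

(** * Substitution of series *)

Definition nc j (f : series j) : series j := f - cst j (f 0%MM).

Lemma cst0E k c : cst k c 0%MM = c.
Proof. by rewrite /cst /spoly mcoeffC eqxx mulr1. Qed.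

Lemma inF_nc j (f : series j) : inF 1 (nc f).
Proof.
by move=> m; rewrite ltnS leqn0 mdeg_eq0 => /eqP ->; rewrite /nc serBE cst0E subrr.
Qed.
Lemma nc_id j (f : series j) : inF 1 f -> nc f = f.
Proof. by move=> h; rewrite /nc h ?mdeg0 // rmorph0 subr0. Qed.

(** Dropping the constant terms of [a] makes the substitution defined for every [a], so that
    [comp a] is a ring morphism with no side condition. For series without constant term nothing is
    changed. *)
Definition pcomp k j (a : 'I_k -> series j) : {mpoly rat[k]} -> series j :=
  mmap (cst j) (fun i => nc (a i)).

HB.instance Definition _ k j (a : 'I_k -> series j) := GRing.RMorphism.on (pcomp a).

Lemma inF_prod j I (r : seq I) (P : pred I) (F : I -> series j) (n : I -> nat) :
  (forall i, P i -> inF (n i) (F i)) -> inF (\sum_(i <- r | P i) n i) (\prod_(i <- r | P i) F i).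
Proof.
move=> h; elim: r => [|i r IH]; rewrite ?big_nil // !big_cons.
by case: ifP => // Pi; apply: inFM => //; apply: h.
Qed.

Lemma pcomp_inF k j (a : 'I_k -> series j) N p :
  (forall m, (mdeg m < N)%N -> p@_m = 0) -> inF N (pcomp a p).
Proof.
move=> h; rewrite /pcomp /mmap; apply: inF_sum => m _.
case: (ltnP (mdeg m) N) => hm; first by rewrite h // rmorph0 mul0r; apply: inF0.
apply: inFMr; apply: inF_le hm _; rewrite mdegE /mmap1; apply: inF_prod => i _.
by rewrite -{1}[m i]muln1; apply: inFX; apply: inF_nc.
Qed.

Opaque pcomp.

Definition comp k j (a : 'I_k -> series j) (f : series k) : series j :=
  fun n => pcomp a (trunc (mdeg n).+1 f) n.

Lemma comp_pcomp k j (a : 'I_k -> series j) (f : series k) p N n : (mdeg n < N)%N ->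
  (forall m, (mdeg m < N)%N -> p@_m = f m) -> comp a f n = pcomp a p n.
Proof.
move=> hn hp; apply/eqP; rewrite -subr_eq0 /comp.
rewrite -[_ - _]/((pcomp a (trunc (mdeg n).+1 f) - pcomp a p) n) -rmorphB.
apply/eqP; apply: (@pcomp_inF _ _ _ (mdeg n).+1) => // m hm.
rewrite mcoeffB mcoeff_trunc hm hp ?subrr //.
by apply: leq_ltn_trans hn; rewrite -ltnS.
Qed.

Lemma compN k j (a : 'I_k -> series j) (f : series k) N n : (mdeg n < N)%N ->
  comp a f n = pcomp a (trunc N f) n.
Proof. by move=> h; apply: comp_pcomp h _ => m hm; rewrite mcoeff_trunc hm. Qed.

Opaque comp.

Lemma comp_spoly k j (a : 'I_k -> series j) p : comp a (spoly p) = pcomp a p.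
Proof. by apply: serP => n; apply: comp_pcomp (ltnSn _) _. Qed.

Lemma comp_is_zmod k j (a : 'I_k -> series j) : zmod_morphism (comp a).
Proof.
move=> f g; apply: serP => n; rewrite serBE !(@compN _ _ _ _ (mdeg n).+1) //.
rewrite -[RHS]/((pcomp a _ - pcomp a _) n) -rmorphB.
congr (pcomp a _ n); apply/mpolyP => m; rewrite mcoeffB !mcoeff_trunc serBE.
by case: ifP; rewrite ?subr0.
Qed.
Lemma pcomp_cong k j (a : 'I_k -> series j) p q n :
  (forall m, (mdeg m <= mdeg n)%N -> p@_m = q@_m) -> pcomp a p n = pcomp a q n.
Proof.
move=> h; apply/eqP; rewrite -subr_eq0 -[_ - _]/((pcomp a p - pcomp a q) n) -rmorphB.
apply/eqP; apply: (@pcomp_inF _ _ _ (mdeg n).+1) => // m hm.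
by rewrite mcoeffB h ?subrr.
Qed.
Lemma comp_is_monoid k j (a : 'I_k -> series j) : monoid_morphism (comp a).
Proof.
split; first by rewrite -(rmorph1 (@spoly k)) comp_spoly rmorph1.
move=> f g; apply: serP => n; rewrite (@compN _ _ _ _ (mdeg n).+1) //.
have hc h m : (mdeg m <= mdeg n)%N -> comp a h m = pcomp a (trunc (mdeg n).+1 h) m.
  by move=> hm; apply: (@compN _ _ a h (mdeg n).+1 m); rewrite ltnS.
rewrite [RHS](serM_cong (hc f) (hc g)).
rewrite -rmorphM; apply: pcomp_cong => m hm.
by rewrite mcoeff_trunc ltnS hm (serM f g (N:=(mdeg n).+1)).
Qed.
HB.instance Definition _ k j a := GRing.isZmodMorphism.Build _ _ (@comp k j a) (@comp_is_zmod k j a).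
HB.instance Definition _ k j a := GRing.isMonoidMorphism.Build _ _ (@comp k j a) (@comp_is_monoid k j a).

Transparent pcomp.
Lemma pcompXn k j (a : 'I_k -> series j) i : pcomp a 'X_i = nc (a i).
Proof. by rewrite /pcomp mmapX mmap1U. Qed.
Lemma pcompX k j (a : 'I_k -> series j) i : inF 1 (a i) -> pcomp a 'X_i = a i.
Proof. by move=> h; rewrite pcompXn nc_id. Qed.
Lemma pcompC k j (a : 'I_k -> series j) c : pcomp a c%:MP = cst j c.
Proof. by rewrite /pcomp mmapC. Qed.
Opaque pcomp.
Lemma comp_X k j (a : 'I_k -> series j) i : inF 1 (a i) -> comp a (X i) = a i.
Proof. by move=> h; rewrite /X comp_spoly pcompX. Qed.
Lemma comp_cst k j (a : 'I_k -> series j) c : comp a (cst k c) = cst j c.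
Proof. by rewrite /cst comp_spoly pcompC. Qed.

Lemma comp_inF k j (a : 'I_k -> series j) N f : inF N f -> inF N (comp a f).
Proof.
move=> h n hn; rewrite (compN _ _ hn); apply: pcomp_inF (hn) => m hm.
by rewrite mcoeff_trunc hm h.
Qed.

Lemma eq_comp k j (a b : 'I_k -> series j) f : a =1 b -> comp a f = comp b f.
Proof. by move=> h; congr (comp _ f); apply: funext. Qed.

Lemma mpoly_ind' k (P : {mpoly rat[k]} -> Prop) :
  (forall c, P c%:MP) -> (forall i, P 'X_i) -> (forall p q, P p -> P q -> P (p + q)) ->
  (forall p q, P p -> P q -> P (p * q)) -> forall p, P p.
Proof.
move=> hC hX hD hMM p; rewrite [p]mpolyE; elim/big_rec: _ => [|m q _ hq].
  by rewrite -mpolyC0.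
apply: (hD) hq; rewrite -mul_mpolyC; apply: (hMM _ _ (hC _)).
rewrite mpolyXE_id; elim/big_rec: _ => [|i r _ hr]; first by rewrite -mpolyC1.
apply: (hMM) hr; elim: (m i) => [|n IH]; first by rewrite expr0 -mpolyC1.
by rewrite exprS; apply: hMM.
Qed.

Lemma pcomp_deriv k j (a : 'I_k -> series j) p i :
  sderiv i (pcomp a p) = \sum_l pcomp a (p^`M(l)) * sderiv i (nc (a l)).
Proof.
elim/mpoly_ind': p => [c|l|p q hp hq|p q hp hq].
- rewrite pcompC sderiv_cst big1 // => l _.
  by rewrite mderivC rmorph0 mul0r.
- rewrite pcompXn (bigD1 l) //= big1 => [|m hm]; last first.
    by rewrite mderivX mnm1E eq_sym (negPf hm) scale0r rmorph0 mul0r.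
  by rewrite mderivX mnm1E eqxx submm mpolyX0 scale1r rmorph1 mul1r addr0.
- rewrite !rmorphD raddfD /= hp hq -big_split /=; apply: eq_bigr => l _.
  by rewrite mderivD rmorphD mulrDl.
- rewrite !rmorphM sderivM /= hp hq mulr_suml mulr_sumr -big_split /=; apply: eq_bigr => l _.
  rewrite mderivM [in RHS]rmorphD ![in RHS]rmorphM /=.
  move: (pcomp a _) (pcomp a _) (pcomp a _) (pcomp a _) (sderiv _ _) => A B C D E.
  by ring.
Qed.

Lemma comp_deriv k j (a : 'I_k -> series j) f i : (forall l, inF 1 (a l)) ->
  sderiv i (comp a f) = \sum_l comp a (sderiv l f) * sderiv i (a l).
Proof.
move=> ha; apply: serP => n.
rewrite sderivE (@compN _ _ _ _ (mdeg n).+2) ?mdegD ?mdeg1 ?addn1 //.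
rewrite -sderivE pcomp_deriv !ser_sumE; apply: eq_bigr => l _.
rewrite (nc_id (ha l)); apply: serM_cong => m hm; last by [].
by rewrite -trunc_sderiv; symmetry; apply: (@compN _ _ a _ (mdeg n).+1 m); rewrite ltnS.
Qed.

Lemma comp_comp k j l (a : 'I_k -> series j) (b : 'I_j -> series l) f :
  (forall i, inF 1 (a i)) ->
  comp b (comp a f) = comp (fun i => comp b (a i)) f.
Proof.
move=> ha; apply: inF_eq => N.
have step p : comp b (pcomp a p) = pcomp (fun i => comp b (a i)) p.
  elim/mpoly_ind': p => [c|i|p q hp hq|p q hp hq].
  - by rewrite !pcompC comp_cst.
  - by rewrite !pcompX //; apply: comp_inF.
  - by rewrite !rmorphD /= hp hq.
  - by rewrite !rmorphM /= hp hq.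
have dec m (c : 'I_k -> series m) : inF N (comp c f - pcomp c (trunc N f)).
  by rewrite -comp_spoly -rmorphB; apply: comp_inF => n hn; rewrite serBE /spoly mcoeff_trunc hn subrr.
rewrite -(subrKA (pcomp (fun i => comp b (a i)) (trunc N f))).
apply: inFD; last by rewrite -opprB; apply: inFN.
rewrite -step -rmorphB; exact: comp_inF.
Qed.

Lemma sfoldE k (l : seq (series k)) : sfold l = \prod_(f <- l) f.
Proof. by elim: l => [|f l IH]; rewrite ?big_nil // big_cons -IH. Qed.

Lemma spoly_mono_exp k (i : 'I_k) n : X i ^+ n = spoly 'X_[U_(i) *+ n].
Proof. by rewrite /X -rmorphXn mpolyXn. Qed.

Lemma ser_natM k n (f : series k) m : (n%:R * f) m = n%:R * f m.
Proof. by rewrite -(rmorph_nat (cst k)) cstM. Qed.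

Lemma smono_mono3 a b c :
  smono (mono3 a b c) = X var_z ^+ a * X var_u ^+ b * X var_t ^+ c.
Proof.
rewrite smonoE !spoly_mono_exp -!rmorphM -!mpolyXD; congr (spoly 'X_[_]).
apply/mnmP => i; rewrite !mnmDE !mulmnE !mnm1E mnmE.
by case: i => -[|[|[|i]]] hi //=; rewrite ?muln1 ?muln0 ?mul0n ?mul1n ?addn0.
Qed.

(** [p] carries the cycles of [p * q] onto those of [q * p]. Faces are cycles of [s * a] in the
    definition of planarity and of [a * s] in the recursion. *)
Lemma card_porbits_conj (T : finType) (p q : {perm T}) : #|porbits (p * q)%g| = #|porbits (q * p)%g|.
Proof.
have e x : porbit (q * p)%g (p x) = [set p y | y in porbit (p * q)%g x].
  have it i : (((q * p) ^+ i) (p x))%g = p (((p * q) ^+ i)%g x).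
    by elim: i => [|i IH]; rewrite ?expg0 ?perm1 // !expgSr !permM IH.
  apply/setP => y; apply/porbitP/imsetP => [[i ->]|[w /porbitP [i ->] ->]].
    by exists (((p * q) ^+ i)%g x) => //; apply/porbitP; exists i.
  by exists i.
have -> : porbits (q * p)%g = [set [set p y | y in B] | B : {set T} in porbits (p * q)%g].
  apply/setP => B; apply/imsetP/imsetP => [[x _ ->]|[B' /imsetP [x _ ->] ->]].
    by exists (porbit (p * q)%g ((p^-1)%g x)); rewrite ?imset_f // -e permKV.
  by exists (p x) => //; rewrite e.
by rewrite card_imset //; apply/imset_inj/perm_inj.
Qed.

Lemma nv_setT (T : finType) (s : {perm T}) : nv setT s = #|porbits s|.
Proof. by rewrite (nv_porbits (X := setT)) ?setCT ?cards0 ?addn0 //; apply/subsetP => x; rewrite inE. Qed.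

Lemma planar_dm n (s a : {perm darts n}) : is_planar_map s a = dm setT (root_dart n) s a.
Proof.
rewrite /is_planar_map /dm /cd inE /= -[LHS]andbA.
have -> : perm_on setT s by apply/subsetP => x; rewrite inE.
rewrite /= -[RHS]andbA; congr [&& _, _ & _].
- apply/forallP/mtchP => [h|[h1 h2] x]; last by rewrite h1 eqxx h2 inE.
  by split=> x; have /andP [/eqP h1 h2] := h x; rewrite // inE.
- apply/imsetP/eqP => [[x _ e]|h].
    have e' : cpt s a x = [set: darts n] by rewrite e.
    by rewrite -[RHS]e'; apply: cpt_eq; rewrite e' inE.
  by exists (root_dart n).
- rewrite !nv_setT cardsT card_ord (card_porbits_conj a s).
  move: #|porbits s| #|porbits (s * a)%g| => u v; clear; lia.
Qed.

(** * The generating function in terms of the recursion *)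

Section Link.
Variables (g h : nat -> series 3).
(** The weight u of a non-root vertex is absorbed into its degree weight. *)
Let gam k := X var_u * g k.

Lemma map_weightE n (s a : {perm darts n}) :
  map_weight g h s a = h #|porbit s (root_dart n)| * X var_t ^+ n.+1 *
     wt (X var_z) gam setT (root_dart n) s a.
Proof.
rewrite /map_weight sfoldE big_cat /= !big_cons big_nil smono_mono3 big_map big_enum_cond /=.
rewrite /wt nv_setT (card_porbits_conj a s) /PW.
set r := root_dart n; set O := porbit s r.
have -> : [set porbit s x | x in setT :\: O] = porbits s :\ O.
  apply/setP => B; apply/imsetP/setD1P => [[x]|[h1 /imsetP [x _ e]]].
    rewrite !inE andbT => hx ->; split; last exact: imset_f.
    by apply: contraNneq hx => <-; apply: porbit_id.
  exists x => //; rewrite !inE andbT; apply: contra h1 => hx.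
  by rewrite e (porbit_eq hx).
rewrite /gam big_split /= prodr_const.
have -> : #|porbits s :\ O| = #|porbits s|.-1.
  by rewrite (cardsD1 O (porbits s)) imset_f.
rewrite (eq_bigl (mem (porbits s :\ O))); last by move=> B /=; rewrite andbT.
rewrite mulr1.
move: (X var_z ^+ _) (X var_u ^+ _) (X var_t ^+ _) (h _) (\prod_(_ in _) _) => a1 a2 a3 a4 a5.
by ring.
Qed.

(** The factorial in [Ds_val] cancels the normalization of the sum over labelled maps. *)
Lemma C_maps_Wnl m : C_maps g h m =
  \sum_(n < m var_t) (X var_t ^+ n.+1 * \sum_(l < n.*2.+2) h l.+1 * Wnl (X var_z) gam n.+1 l.+1) m.
Proof.
apply: eq_bigr => n _.
have -> : \sum_(sa : {perm darts n} * {perm darts n} | is_planar_map sa.1 sa.2) map_weight g h sa.1 sa.2 m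
  = ((n.*2.+1)`!%:R * (X var_t ^+ n.+1 * \sum_(l < n.*2.+2) h l.+1 * Wnl (X var_z) gam n.+1 l.+1)) m.
  transitivity ((\sum_(sa : {perm darts n} * {perm darts n} | is_planar_map sa.1 sa.2)
     map_weight g h sa.1 sa.2) m); first by rewrite ser_sumE.
  congr (_ m).
  transitivity (\sum_(l < n.*2.+2) h l.+1 * X var_t ^+ n.+1 * Ds (X var_z) gam [set: darts n] (root_dart n) l).
    rewrite /Ds; under [RHS]eq_bigr => l _ do rewrite mulr_sumr.
    rewrite [RHS](exchange_big_dep (fun sa : {perm darts n} * {perm darts n} => is_planar_map sa.1 sa.2)) /=; last first.
      by move=> l sa _ /andP [h1 _]; rewrite planar_dm.
    apply: eq_bigr => -[s a] /= hp.
    have O0 : (0 < #|porbit s (root_dart n)|)%N by apply/card_gt0P; exists (root_dart n); apply: porbit_id.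
    have hO : (#|porbit s (root_dart n)|.-1 < n.*2.+2)%N.
      by rewrite prednK //; apply: leq_trans (max_card _) _; rewrite card_ord.
    rewrite (big_pred1 (Ordinal hO)) => [|i] /=; last first.
      rewrite -planar_dm hp /= -val_eqE /=; move: O0; move: #|porbit s (root_dart n)| => u.
      by move: (nat_of_ord i) => v; clear; lia.
    by rewrite prednK // map_weightE.
  rewrite !mulr_sumr; apply: eq_bigr => l _.
  rewrite (@Ds_val _ _ _ _ n) ?inE ?cardsT ?card_ord //.
  have E (R : comNzRingType) (a b c d : R) : a * b * (d * c) = d * (b * (a * c)) by ring.
  exact: (E (series 3 : comNzRingType)).
rewrite ser_natM mulrA mulVf ?mul1r //.
by rewrite pnatr_eq0 -lt0n fact_gt0.
Qed.

End Link.

(** * Solving the recursion by Motzkin paths *)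

Section Motzkin.
Variables (A : comNzRingType) (R S : A).

(* Coefficients of (a + S + b)^m = ee m 0 + sum_(k > 0) ee m k (a^k + b^k) when a b = R. *)
Fixpoint ee m k : A :=
  if m is m'.+1 then
    if k is k'.+1 then ee m' k' + S * ee m' k + R * ee m' k.+1
    else S * ee m' 0 + 2%:R * (R * ee m' 1)
  else (k == 0%N)%:R.

(** By the reflection principle this counts the paths of length n from 0 to height k that never go
    below 0, with weight S for a level step and R for a down step. *)
Definition MM n k := ee n k - R * ee n k.+2.
Definition bt m n := \sum_(k < m) R ^+ k.+1 * ee m k.+1 * MM n k.

Lemma ee_gt m k : (m < k)%N -> ee m k = 0.
Proof.
elim: m k => [|m IH] [|k] //= h.
by rewrite !IH ?mulr0 ?addr0 //; move: h; clear; lia.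
Qed.

Lemma MMS0 n : MM n.+1 0 = S * MM n 0 + R * MM n 1.
Proof. by rewrite /MM /=; ring. Qed.
Lemma MMSS n k : MM n.+1 k.+1 = MM n k + S * MM n k.+1 + R * MM n k.+2.
Proof. by rewrite /MM /=; ring. Qed.

Lemma MM0 k : MM 0 k = (k == 0%N)%:R.
Proof. by rewrite /MM /= mulr0 subr0. Qed.

Lemma btE K m n : (m <= K)%N -> bt m n = \sum_(k < K) R ^+ k.+1 * ee m k.+1 * MM n k.
Proof.
move=> h; rewrite /bt (big_ord_widen _ (fun k => R ^+ k.+1 * ee m k.+1 * MM n k) h).
rewrite [RHS](bigID (fun k : 'I_K => (k < m)%N)) /= [X in _ = _ + X]big1 ?addr0 // => k.
by rewrite -leqNgt => hk; rewrite ee_gt ?mulr0 ?mul0r // ltnS.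
Qed.

Lemma bt1 n : bt 1 n = R * MM n 0.
Proof. by rewrite /bt big_ord1 expr1 /= !mulr0 !addr0 mulr1. Qed.

Lemma bt0 n : bt 0 n = 0. Proof. by rewrite /bt big_ord0. Qed.

Lemma bt_n0 m : bt m 0 = R * ee m 1.
Proof.
rewrite (@btE m.+1) // big_ord_recl big1 => [|k _]; first by rewrite MM0 expr1 mulr1 addr0.
by rewrite MM0 mulr0.
Qed.

(** One step moves from the first path to the second, and only the boundary term k = 0 does not
    match. This is what drives the induction for [JJ]. *)
Lemma btS m n : bt m.+1 n = bt m n.+1 + ee m 0 * bt 1 n.
Proof.
rewrite (@btE m.+1 m.+1) // (@btE m.+1 m) // bt1.
pose F k := R ^+ k.+1 * ee m k * MM n k.
pose G k := R ^+ k.+2 * ee m k.+2 * MM n k.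
have -> : \sum_(k < m.+1) R ^+ k.+1 * ee m.+1 k.+1 * MM n k =
  \sum_(k < m.+1) F k + \sum_(k < m.+1) R ^+ k.+1 * ee m k.+1 * (S * MM n k) + \sum_(k < m.+1) G k.
  by rewrite -!big_split /=; apply: eq_bigr => k _; rewrite /F /G /= !exprS; ring.
have -> : \sum_(k < m.+1) R ^+ k.+1 * ee m k.+1 * MM n.+1 k =
  \sum_(k < m.+1) F k.+1 + \sum_(k < m.+1) R ^+ k.+1 * ee m k.+1 * (S * MM n k) +
  \sum_(k < m) G k.
  rewrite [in LHS]big_ord_recl [X in _ + X + _]big_ord_recl [X in X + _ + _]big_ord_recl.
  have -> : \sum_(i < m) R ^+ (lift ord0 i).+1 * ee m (lift ord0 i).+1 * MM n.+1 (lift ord0 i) =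
    \sum_(i < m) F (lift ord0 i).+1 + \sum_(i < m) R ^+ (lift ord0 i).+1 * ee m (lift ord0 i).+1 * (S * MM n (lift ord0 i)) + \sum_(i < m) G i.
    rewrite -!big_split /=; apply: eq_bigr => k _; rewrite /F /G /bump /= !add1n MMSS !exprS; ring.
  by rewrite MMS0 /F /= !exprS; ring.
rewrite [X in X + _ + _ = _]big_ord_recl [X in _ = X + _ + _ + _]big_ord_recr [X in _ + X = _]big_ord_recr /=.
have -> : F m.+1 = 0 by rewrite /F ee_gt // mulr0 mul0r.
have -> : G m = 0 by rewrite /G ee_gt ?mulr0 ?mul0r.
have -> : F 0%N = ee m 0 * (R * MM n 0) by rewrite /F expr1; ring.
rewrite /= (eq_bigr (fun i : 'I_m => F i.+1)) => [|i _]; last by [].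
by ring.
Qed.

(** Decomposition at the last visit a to height 0: an excursion of length a, an up step, and a path
    that stays at height at least 1. *)
Lemma MM_conv i k : MM i k.+1 = \sum_(a < i) MM a 0 * MM (i.-1 - a)%N k.
Proof.
elim: i k => [|i IH] k; first by rewrite big_ord0 MM0.
rewrite MMSS big_ord_recr /= subnn MM0.
have e (j : 'I_i) : (i - j = (i.-1 - j).+1)%N by move: (ltn_ord j); clear; lia.
case: k => [|k].
  rewrite !IH mulr1 !mulr_sumr -addrA addrC -big_split /=; congr (_ + _).
  by apply: eq_bigr => j _; rewrite e MMS0; ring.
rewrite !IH mulr0 addr0 !mulr_sumr -!big_split /=.
by apply: eq_bigr => j _; rewrite e MMSS; ring.
Qed.

(** The quadratic loop equation [loop_eqn], polarized at the coefficients [psi m] and [psi n]. *)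
Definition JJ l m n := bt m (l + n)%N + bt n (l + m)%N =
  2%:R * (\sum_(i < l) bt m i * bt n (l.-1 - i)%N) + ee n 0 * bt m l + ee m 0 * bt n l.

Lemma JJ_sym l m n : JJ l m n -> JJ l n m.
Proof.
rewrite /JJ addrC => ->; rewrite -!addrA [ee m 0 * _ + _]addrC; congr (2%:R * _ + _).
rewrite (reindex_inj rev_ord_inj) /=; apply: eq_bigr => i _; rewrite mulrC.
by congr (bt n _ * bt m _); move: (ltn_ord i); clear; lia.
Qed.

Lemma JJ0 l n : JJ l 0 n.
Proof.
rewrite /JJ bt0 addn0 big1 => [|i _]; last by rewrite bt0 mul0r.
by rewrite /= bt0 !mulr0 !add0r mul1r.
Qed.

Lemma JJ11 l : JJ l 1 1.
Proof.
rewrite /JJ.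
have -> : \sum_(i < l) bt 1 i * bt 1 (l.-1 - i)%N = R * R * MM l 1.
  by rewrite MM_conv mulr_sumr; apply: eq_bigr => i _; rewrite !bt1; ring.
by rewrite addn1 !bt1 MMS0 /= !mulr1 !mulr0 !addr0; ring.
Qed.

(** [btS] lowers m at the price of raising l, and the correction terms are multiples of the case m =
    1. *)
Lemma JJS l m n : JJ l.+1 m n -> JJ l 1 n -> JJ l m.+1 n.
Proof.
rewrite /JJ => h1 h2.
rewrite btS -addSn; have -> : bt n (l + m.+1)%N = bt n (l.+1 + m)%N by rewrite addnS.
rewrite addrAC h1.
have {h2} -> : bt 1 (l + n) = 2%:R * (\sum_(i < l) bt 1 i * bt n (l.-1 - i)%N)
    + ee n 0 * bt 1 l + ee 1 0 * bt n l - bt n l.+1.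
  by rewrite -h2 addn1 addrK.
have -> : \sum_(i < l) bt m.+1 i * bt n (l.-1 - i)%N =
   \sum_(i < l) bt m i.+1 * bt n (l.-1 - i)%N + ee m 0 * \sum_(i < l) bt 1 i * bt n (l.-1 - i)%N.
  by rewrite mulr_sumr -big_split; apply: eq_bigr => i _; rewrite /= btS; ring.
have -> : \sum_(i < l.+1) bt m i * bt n (l.+1.-1 - i)%N =
   bt m 0 * bt n l + \sum_(i < l) bt m i.+1 * bt n (l.-1 - i)%N.
  rewrite big_ord_recl /= subn0; congr (_ + _); apply: eq_bigr => i _.
  by rewrite /bump /= add1n; congr (_ * bt n _); move: (ltn_ord i); clear; lia.
rewrite (btS m l) bt_n0; move: (\sum_(i < l) _) (\sum_(i < l) _) => s1 s2.
by rewrite /= !mulr1 !mulr0 !addr0; ring.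
Qed.

Lemma JJ_all l m n : JJ l m n.
Proof.
have J1 l' n' : JJ l' n' 1.
  elim: n' l' => [|n' IH] l'; first exact: JJ0.
  by apply: JJS; [exact: IH | exact: JJ11].
elim: m l => [|m IH] l; first exact: JJ0.
by apply: JJS; [exact: IH | exact/JJ_sym/J1].
Qed.

Variables (K : nat) (psi : nat -> A) (hf : A).
Hypothesis hf2 : hf * 2%:R = 1.

Definition ws l := \sum_(m < K) psi m * bt m l.

(** Both sides are quadratic in [psi]. After doubling, their coefficients can be symmetrized and
    compared by [JJ_all]; this is where [hf], the inverse of 2, is used. *)
Lemma loop_eqn l : \sum_(n < K) psi n * ws (l + n)%N =
  \sum_(i < l) ws i * ws (l.-1 - i)%N + (\sum_(n < K) psi n * ee n 0) * ws l.
Proof.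
have key : 2%:R * (\sum_(n < K) psi n * ws (l + n)%N) =
  2%:R * (\sum_(i < l) ws i * ws (l.-1 - i)%N + (\sum_(n < K) psi n * ee n 0) * ws l).
  have -> : 2%:R * (\sum_(n < K) psi n * ws (l + n)%N) =
     \sum_(n < K) \sum_(m < K) psi n * psi m * (bt m (l + n)%N + bt n (l + m)%N).
    rewrite mulr_natl mulr2n {2}/ws.
    under [in RHS]eq_bigr => n _ do under eq_bigr => m _ do rewrite mulrDr.
    under [in RHS]eq_bigr => n _ do rewrite big_split.
    rewrite big_split /=; congr (_ + _).
      by apply: eq_bigr => n _; rewrite mulr_sumr; apply: eq_bigr => m _; rewrite mulrA.
    rewrite exchange_big /=; apply: eq_bigr => n _; rewrite mulr_sumr; apply: eq_bigr => m _.
    by rewrite mulrA [psi m * _]mulrC.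
  transitivity (\sum_(n < K) \sum_(m < K) (2%:R * (\sum_(i < l) (psi m * bt m i) * (psi n * bt n (l.-1 - i)%N))
     + (psi n * ee n 0) * (psi m * bt m l) + (psi m * ee m 0) * (psi n * bt n l))).
    apply: eq_bigr => n _; apply: eq_bigr => m _; rewrite (JJ_all l m n).
    rewrite !mulrDr; congr (_ + _ + _); try by ring.
    rewrite mulrCA; congr (_ * _); rewrite mulr_sumr; apply: eq_bigr => i _; ring.
  under eq_bigr => n _ do rewrite !big_split.
  rewrite !big_split /= mulrDr -addrA; congr (_ + _).
    under eq_bigr => n _ do rewrite -mulr_sumr.
    rewrite -mulr_sumr; congr (_ * _).
    transitivity (\sum_(n < K) \sum_(i < l) \sum_(m < K) psi m * bt m i * (psi n * bt n (l.-1 - i)%N)).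
      by apply: eq_bigr => n _; rewrite exchange_big.
    rewrite exchange_big /=; apply: eq_bigr => i _.
    rewrite exchange_big /= /ws mulr_suml; apply: eq_bigr => m _.
    by rewrite [RHS]mulr_sumr.
  have e : (\sum_(n < K) psi n * ee n 0) * ws l =
     \sum_(i < K) \sum_(i0 < K) psi i * ee i 0 * (psi i0 * bt i0 l).
    by rewrite /ws mulr_suml; apply: eq_bigr => n _; rewrite mulr_sumr.
  rewrite mulr_natl mulr2n e; congr (_ + _).
  by rewrite exchange_big.
by rewrite -[LHS]mul1r -[RHS]mul1r -hf2 -!mulrA key.
Qed.

End Motzkin.

(** * The loop equation modulo an order and the uniqueness of its solution *)

Definition eqF k N (f g : series k) := inF N (f - g).
Lemma eqF_refl k N (f : series k) : eqF N f f.
Proof. by rewrite /eqF subrr. Qed.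
Lemma eqF_sym k N (f g : series k) : eqF N f g -> eqF N g f.
Proof. by move=> h; rewrite /eqF -opprB; apply: inFN. Qed.
Lemma eqF_trans k N (g f h : series k) : eqF N f g -> eqF N g h -> eqF N f h.
Proof. by move=> h1 h2; rewrite /eqF -(subrKA g); apply: inFD. Qed.
Lemma eqFD k N (f g f' g' : series k) : eqF N f f' -> eqF N g g' -> eqF N (f + g) (f' + g').
Proof. by move=> h1 h2; rewrite /eqF opprD addrACA; apply: inFD. Qed.
Lemma eqFN k N (f f' : series k) : eqF N f f' -> eqF N (- f) (- f').
Proof. by move=> h1; rewrite /eqF -opprD; apply: inFN. Qed.
Lemma eqFB k N (f g f' g' : series k) : eqF N f f' -> eqF N g g' -> eqF N (f - g) (f' - g').
Proof. by move=> h1 h2; apply: eqFD => //; apply: eqFN. Qed.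
Lemma eqFMr k N (f g g' : series k) : eqF N g g' -> eqF N (f * g) (f * g').
Proof. by move=> h; rewrite /eqF -mulrBr; apply: inFMr. Qed.
Lemma eqFMl k N (f g g' : series k) : eqF N g g' -> eqF N (g * f) (g' * f).
Proof. by move=> h; rewrite /eqF -mulrBl; apply: inFMl. Qed.
Lemma eqFM k N (f g f' g' : series k) : eqF N f f' -> eqF N g g' -> eqF N (f * g) (f' * g').
Proof. by move=> h1 h2; apply: eqF_trans (eqFMr _ h2); apply: eqFMl. Qed.
Lemma eqF_sum k N I (r : seq I) (P : pred I) (F G : I -> series k) :
  (forall i, P i -> eqF N (F i) (G i)) -> eqF N (\sum_(i <- r | P i) F i) (\sum_(i <- r | P i) G i).
Proof. by move=> h; rewrite /eqF -sumrB; apply: inF_sum. Qed.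
Lemma eqF0 k N (f : series k) : inF N f -> eqF N f 0.
Proof. by rewrite /eqF subr0. Qed.
Lemma eqF_le k N M (f g : series k) : (M <= N)%N -> eqF N f g -> eqF M f g.
Proof. exact: inF_le. Qed.
Lemma inF_Xn k (i : 'I_k) n : inF n (X i ^+ n).
Proof. by rewrite -{1}[n]muln1; apply/inFX/inF_X. Qed.

Lemma Wnl_gt (A : comNzRingType) (z : A) gam n l : (n.*2 < l)%N -> Wnl z gam n l = 0.
Proof.
elim/ltn_ind: n l => -[|n] IH [|l] // h.
rewrite WnlS /Wstep [X in _ + X]big1 => [|i]; last first.
  by move=> hi; rewrite IH ?mulr0 //; move: h hi; clear; lia.
rewrite addr0 big1 // => i _; rewrite big1 // => j _.
have := ltn_ord i; have := ltn_ord j => hj hi.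
case: (ltnP i.*2 j) => h2; first by rewrite IH ?mul0r.
by rewrite (IH (n - i)%N) ?mulr0 //; move: h hi h2 hj; clear; lia.
Qed.

Section Unique.
Variables (g h : nat -> series 3).
Local Notation z := (X var_z).
Local Notation u := (X var_u).
Local Notation t := (X var_t).
Let gam k := u * g k.

(** The additional factor t absorbs the power of t in front of the quadratic term of the recursion
    and gives every [wN N l] positive order, so that products of two of them gain an order. It is
    the reason why t C appears instead of C. *)
Definition wN N l : series 3 := \sum_(n < N) t ^+ n.+1 * Wnl z gam n l.

Lemma wN0 N : wN N.+1 0 = z * t.
Proof.
rewrite /wN big_ord_recl big1 => [|i _]; last by rewrite WnlS mulr0.
by rewrite addr0 expr1 mulrC.
Qed.

Lemma inF_wN N l : inF 1 (wN N l).
Proof.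
apply: inF_sum => n _; have h1 : inF n.+1 (t ^+ n.+1) := @inF_Xn _ _ _.
by apply: inFMl; apply: inF_le h1.
Qed.

(** The pairs missing from the Cauchy product have i + j > N, and their power of t' lies beyond the
    order of comparison. *)
Lemma conv_trunc k N (t' : series k) (a b : nat -> series k) : inF 1 t' ->
  eqF N.+2 (\sum_(n < N.+1) t' ^+ n.+2 * \sum_(i < n.+1) a i * b (n - i)%N)
   ((\sum_(n < N.+1) t' ^+ n.+1 * a n) * (\sum_(n < N.+1) t' ^+ n.+1 * b n)).
Proof.
move=> ht; have tn n : inF n (t' ^+ n) by rewrite -{1}[n]muln1; apply: inFX.
rewrite mulr_suml; under [X in eqF _ _ X]eq_bigr => i _ do rewrite mulr_sumr.
pose F (i j : nat) := t' ^+ (i + j).+2 * (a i * b j).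
apply: (@eqF_trans _ _ (\sum_(i < N.+1) \sum_(j < N.+1 | (i + j < N.+1)%N) F i j)).
  have -> : \sum_(n < N.+1) t' ^+ n.+2 * \sum_(i < n.+1) a i * b (n - i)%N =
      \sum_(n < N.+1) \sum_(i < N.+1 | (i < n.+1)%N) F i (n - i)%N.
    apply: eq_bigr => n _; rewrite mulr_sumr (big_ord_widen _ (fun i => t' ^+ n.+2 * (a i * b (n - i)%N)) (ltn_ord n)).
    by apply: eq_bigr => i hi; rewrite /F subnKC.
  rewrite (exchange_big_dep predT) //=.
  rewrite (_ : \sum_(i < N.+1) _ = \sum_(i < N.+1) \sum_(j < N.+1 | (i + j < N.+1)%N) F i j); first exact: eqF_refl.
  apply: eq_bigr => i _.
  rewrite (reindex_onto (fun j : 'I_N.+1 => inord (i + j) : 'I_N.+1) (fun n : 'I_N.+1 => inord (n - i) : 'I_N.+1)) /=; last first.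
    move=> n hn; apply: val_inj; rewrite /= [in (i + _)%N]inordK; last by apply: leq_ltn_trans (leq_subr _ _) (ltn_ord n).
    by rewrite subnKC // inordK.
  apply: eq_big => [j|j].
    case: (ltnP (i + j) N.+1) => hij.
      rewrite inordK // leq_addr /=; apply/eqP/val_inj.
      by rewrite /= addKn inordK.
    apply/negbTE/negP => /andP [h1 /eqP /(congr1 val)].
    rewrite /= inordK; last by apply: leq_ltn_trans (leq_subr _ _) (ltn_ord _).
    by have := ltn_ord (inord (i + j) : 'I_N.+1); move: h1 hij; clear; lia.
  move=> /andP [h1 h2]; case: (ltnP (i + j) N.+1) => hij.
    by rewrite inordK // addKn.
  move: h2 => /eqP /(congr1 val).
  rewrite /= inordK; last by apply: leq_ltn_trans (leq_subr _ _) (ltn_ord _).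
  by have := ltn_ord (inord (i + j) : 'I_N.+1); move: h1 hij => h1 hij h2 h3; exfalso; move: h1 hij h2 h3; clear; lia.
apply: eqF_sum => i _; rewrite big_mkcond; apply: eqF_sum => j _.
have E : t' ^+ i.+1 * a i * (t' ^+ j.+1 * b j) = F i j.
  by rewrite /F -addSn -addnS exprD; move: (t' ^+ _) (t' ^+ _) (a i) (b j) => p q r s; rewrite mulrACA.
rewrite E; case: ifP => hij; first exact: eqF_refl.
apply/eqF_sym/eqF0/inFMl; apply: (inF_le _ (tn _)).
by move: hij; clear; lia.
Qed.

(** Maps with at most N edges have root degree at most 2 N, so the bound on K guarantees that the
    sum over k loses nothing. *)
Lemma wN_rec N K l : (N.+1.*2 <= K)%N ->
  eqF N.+2 (wN N.+1 l.+1)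
   (t * u * (\sum_(k < K) g k.+1 * wN N.+1 (l + k)) + \sum_(i < l) wN N.+1 i * wN N.+1 (l.-1 - i)%N).
Proof.
move=> hK.
have step : eqF N.+2 (wN N.+1 l.+1) (\sum_(n < N.+1) t ^+ n.+2 * Wstep gam (Wnl z gam) n l.+1).
  rewrite /wN big_ord_recl /= mulr0 add0r big_ord_recr /=.
  rewrite -[X in eqF _ X _]addr0; apply: eqFD; last first.
    by apply/eqF_sym/eqF0/inFMl; apply: inF_Xn.
  rewrite (eq_bigr (fun n : 'I_N => t ^+ n.+2 * Wstep gam (Wnl z gam) n l.+1)); first exact: eqF_refl.
  by move=> n _; rewrite WnlS.
apply: eqF_trans step _.
rewrite /Wstep; under eq_bigr => n _ do rewrite mulrDr.
rewrite big_split /= addrC; apply: eqFD; last first.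
  under eq_bigr => n _ do rewrite exchange_big mulr_sumr /=.
  rewrite exchange_big /=; apply: eqF_sum => j _.
  exact: (conv_trunc (Wnl z gam ^~ j) (Wnl z gam ^~ (l.-1 - j)%N) (inF_X _)).
rewrite (_ : \sum_(i < N.+1) _ = t * u * \sum_(k < K) g k.+1 * wN N.+1 (l + k)); first exact: eqF_refl.
rewrite /wN mulr_sumr.
under [RHS]eq_bigr => k _ do rewrite mulr_sumr mulr_sumr.
rewrite [RHS]exchange_big /=; apply: eq_bigr => n _.
rewrite mulr_sumr.
pose F k := t * u * (g k.+1 * (t ^+ n.+1 * Wnl z gam n (l + k))).
have e1 : \sum_(j < K) F j = \sum_(j < n.*2.+2 | (l <= j)%N) F (j - l)%N.
  pose M := (l + K + n.*2.+2)%N.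
  have w1 : (K <= M)%N by rewrite /M; clear; lia.
  have w2 : (n.*2.+2 <= M)%N by rewrite /M; clear; lia.
  rewrite (big_ord_widen _ F w1) (big_ord_widen_cond _ (fun j => (l <= j)%N) (fun j => F (j - l)%N) w2).
  have e3 : \sum_(i < M | (i < K)%N) F i = \sum_(i < M | (l + i < n.*2.+2)%N) F i.
    rewrite big_mkcond [RHS]big_mkcond; apply: eq_bigr => i _.
    have hn := ltn_ord n; case: (ltnP i K) => h1; case: ifP => h2 //.
      by rewrite /F Wnl_gt ?mulr0 //; move: h2; clear; lia.
    by move: h2 hK h1 hn; clear; lia.
  rewrite e3.
  have w3 : (0 < M)%N by rewrite /M addnS.
  (* The index is shifted by l inside one large range. The default value of [insubd] is met only
     when l + i leaves the range, and then the conditions on both sides fail. *)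
  rewrite [RHS](reindex_onto (fun i : 'I_M => insubd i (l + i)%N) (fun i : 'I_M => insubd i (i - l)%N)) /=; last first.
    move=> i /andP [h1 h2]; apply: val_inj; rewrite /= [val (insubd _ _)]val_insubd.
    rewrite !val_insubd /= (leq_ltn_trans (leq_subr _ _) (ltn_ord i)) subnKC // ltn_ord //.
  have v1 (i : 'I_M) : val (insubd i (l + i)%N) = if (l + i < M)%N then (l + i)%N else i by rewrite val_insubd.
  apply: eq_big => i.
    case: (ltnP (l + i) M) => h1.
      rewrite v1 h1 leq_addr /=; case: (ltnP (l + i) n.*2.+2) => //= h2.
      apply/esym/eqP/val_inj; by rewrite val_insubd /= v1 h1 addKn ltn_ord.
    have n1 : (l + i < M)%N = false by rewrite ltnNge h1.
    have -> : (l + i < n.*2.+2)%N = false by rewrite ltnNge (leq_trans w2 h1).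
    rewrite v1 n1; symmetry; apply/negbTE/negP => /andP [/andP [h3 h2] /eqP].
    move/(congr1 val); rewrite val_insubd /= v1 n1.
    rewrite (leq_ltn_trans (leq_subr _ _) (ltn_ord i)).
    have := ltn_ord i; move: h1 h2 h3 w2; move: (nat_of_ord i) (nat_of_ord n) => a b.
    clear; lia.
  move=> h1; have h2 : (l + i < M)%N by apply: leq_trans h1 w2.
  by rewrite v1 h2 addKn.
transitivity (\sum_(j < K) F j); last by [].
rewrite e1; apply: eq_bigr => j hj; rewrite /F subnKC // /gam exprS.
have E (A : comNzRingType) (a b c d e : A) : a * b * (c * d * e) = a * c * (d * (b * e)) by ring.
exact: (E (series 3 : comNzRingType)).
Qed.

Lemma Xn_low k (i : 'I_k) n (f : series k) (m : 'X_{1..k}) : (m i < n)%N -> (X i ^+ n * f) m = 0.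
Proof.
move=> hm; rewrite spoly_mono_exp monoM ifF //; apply/negbTE/negP => /mnm_lepP /(_ i).
by rewrite mulmnE mnm1E eqxx mul1n leqNgt hm.
Qed.

Lemma mnm_le_mdeg k (m : 'X_{1..k}) i : (m i <= mdeg m)%N.
Proof. by rewrite mdegE (bigD1 i) //= leq_addr. Qed.

Lemma tC_wN N K : (N.+1.*2 <= K)%N ->
  eqF N.+2 (t * C_maps g h) (\sum_(l < K) h l.+1 * wN N.+1 l.+1).
Proof.
move=> hK; pose T n := t ^+ n.+1 * \sum_(l < n.*2.+2) h l.+1 * Wnl z gam n.+1 l.+1.
have h1 : eqF N.+1 (C_maps g h) (\sum_(n < N) T n).
  move=> m hm; rewrite serBE C_maps_Wnl ser_sumE -/gam.
  have le : (m var_t <= N)%N by apply: leq_trans (mnm_le_mdeg _ _) _.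
  rewrite (big_ord_widen _ (fun n => T n m) le) (bigID (fun n : 'I_N => (n < m var_t)%N) predT) /=.
  rewrite [X in _ - (_ + X)]big1 => [|n]; first by rewrite addr0 subrr.
  by rewrite -leqNgt => hn; rewrite /T Xn_low.
have h2 : eqF N.+2 (t * C_maps g h) (t * \sum_(n < N) T n).
  rewrite /eqF -mulrBr -[N.+2]add1n; apply: inFM => //; exact: inF_X.
apply: (eqF_trans h2).
rewrite (_ : t * _ = \sum_(l < K) h l.+1 * wN N.+1 l.+1); first exact: eqF_refl.
rewrite mulr_sumr /wN; under [RHS]eq_bigr => l _ do rewrite mulr_sumr.
rewrite [RHS]exchange_big [RHS]big_ord_recl /= [X in _ = X + _]big1 => [|l _]; last by rewrite !mulr0.
rewrite add0r; apply: eq_bigr => n _; rewrite /T mulr_sumr mulr_sumr.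
have hn : (n.*2.+2 <= K)%N by have := ltn_ord n; move: hK; clear; lia.
rewrite (big_ord_widen _ (fun l => t * (t ^+ n.+1 * (h l.+1 * Wnl z gam n.+1 l.+1))) hn).
rewrite big_mkcond; apply: eq_bigr => l _; case: ifP => hl; last first.
  by rewrite /bump add1n Wnl_gt ?mulr0 //; move: hl; clear; lia.
rewrite /bump add1n [in RHS]exprS.
have E (A : comNzRingType) (a b c d : A) : a * (b * (c * d)) = c * (a * b * d) by ring.
exact: (E (series 3 : comNzRingType)).
Qed.

(** The right-hand side is a contraction: the factor t u raises the order, and so do the factors of
    positive order in the products. Agreement modulo n therefore improves to n + 1. *)
Lemma loop_unique N K (a b : nat -> series 3) :
  (forall l, inF 1 (a l)) -> (forall l, inF 1 (b l)) -> eqF N (a 0%N) (b 0%N) ->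
  (forall l, eqF N (a l.+1) (t * u * (\sum_(k < K) g k.+1 * a (l + k)%N) + \sum_(i < l) a i * a (l.-1 - i)%N)) ->
  (forall l, eqF N (b l.+1) (t * u * (\sum_(k < K) g k.+1 * b (l + k)%N) + \sum_(i < l) b i * b (l.-1 - i)%N)) ->
  forall l, eqF N (a l) (b l).
Proof.
move=> a1 b1 e0 ea eb.
suff H n : (n <= N)%N -> forall l, eqF n (a l) (b l) by apply: H.
elim: n => [|n IH] hn l; first exact: inF00.
have {}IH := IH (ltnW hn).
case: l => [|l]; first exact: eqF_le hn e0.
apply: (eqF_trans (eqF_le hn (ea l))); apply: eqF_trans (eqF_sym (eqF_le hn (eb l))).
apply: eqFD.
  rewrite /eqF -mulrBr -mulrA -[n.+1]add1n; apply: inFM; first exact: inF_X.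
  apply: inFMr; rewrite -/(eqF n _ _); apply: eqF_sum => i _; exact: eqFMr.
apply: eqF_sum => i _.
rewrite /eqF (_ : a i * a (l.-1 - i)%N - b i * b (l.-1 - i)%N =
   (a i - b i) * a (l.-1 - i)%N + b i * (a (l.-1 - i)%N - b (l.-1 - i)%N)); last first.
  by rewrite mulrBl mulrBr subrKA.
apply: inFD; first by rewrite -[n.+1]addn1; apply: inFM => //; apply: IH.
by rewrite -[n.+1]add1n; apply: inFM => //; apply: IH.
Qed.

Definition psi n : series 3 := (n == 1%N)%:R - t * u * g n.+1.

(* Both sides solve the truncated loop equation, which determines its solution. *)
Lemma tC_formula (R S : series 3) N K : (N.+1.*2 <= K)%N -> inF 1 R ->
  eqF N.+2 S (t * u * \sum_(n < K) g n.+1 * ee R S n 0) ->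
  eqF N.+2 R (z * t + t * u * \sum_(n < K) g n.+1 * (R * ee R S n 1)) ->
  eqF N.+2 (t * C_maps g h) (\sum_(l < K) h l.+1 * ws R S K psi l.+1).
Proof.
move=> hK R1 eS eR.
apply: (eqF_trans (tC_wN hK)); apply: eqF_sum => l _; apply: eqFMr.
have K1 : (1 < K)%N by move: hK; clear; lia.
have psum (F : nat -> series 3) : \sum_(n < K) psi n * F n = F 1%N - t * u * \sum_(n < K) g n.+1 * F n.
  rewrite /psi; under eq_bigr => n _ do rewrite mulrBl -(mulrA (t * u)).
  rewrite sumrB [in RHS]mulr_sumr; congr (_ - _).
  rewrite (bigD1 (Ordinal K1)) //= mul1r big1 ?addr0 // => n; rewrite -val_eqE /= => /negPf ->.
  by rewrite mul0r.
have hf2 : cst 3 (2%:R^-1) * 2%:R = 1.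
  by rewrite -(rmorph_nat (cst 3)) -rmorphM mulVf ?rmorph1.
apply: (@loop_unique _ K); first exact: inF_wN.
- move=> j; apply: inF_sum => m _; apply: inFMr; apply: inF_sum => k _; apply: inFMl; apply: inFMl.
  by rewrite exprS; apply: inFMl.
(* At root degree 0 the required value z t is the equation for R. *)
- rewrite wN0 /ws; under [X in eqF _ _ X]eq_bigr => m _ do rewrite bt_n0.
  rewrite (psum (fun n => R * ee R S n 1)) /=; apply: eqF_sym.
  have e' : R * (1 + S * (0 : series 3) + R * 0) = R by rewrite !mulr0 !addr0 mulr1.
  rewrite /eqF e' -addrA -opprD [t * u * _ + _]addrC; exact: eR.
- by move=> j; apply: wN_rec.
move=> j; have := loop_eqn R S K psi hf2 j; rewrite (psum (fun n => ws R S K psi (j + n)%N)) addn1.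
set a := \sum_(i < j) _; set b := \sum_(n < K) _ => e.
have -> : ws R S K psi j.+1 = t * u * b + (a + (\sum_(n < K) psi n * ee R S n 0) * ws R S K psi j).
  by rewrite -e addrC subrK.
apply: eqFD; first exact: eqF_refl.
rewrite -[X in eqF _ _ X]addr0; apply: eqFD; first exact: eqF_refl.
(* The linear term disappears: its coefficient is S minus the right-hand side of the equation for
   S. *)
apply: eqF0; apply: inFMl; rewrite (psum (fun n => ee R S n 0)) /=.
by have -> : S * (1 : series 3) + 2%:R * (R * 0) = S by rewrite !mulr0 addr0 mulr1.
Qed.

End Unique.

(** * D-finite series *)

(** Gaussian elimination without division. The sets [E] of equations and [D] of admissible unknowns
    shrink during the induction while the index types stay fixed. *)
Lemma lin_dep_sets (P : idomainType) (I J : finType) n (E : {set J}) :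
  #|E| = n -> forall (D : {set I}) (A : I -> J -> P), (#|E| < #|D|)%N ->
  exists c : I -> P, [/\ exists i, c i != 0, forall i, i \notin D -> c i = 0
    & forall j, j \in E -> \sum_i c i * A i j = 0].
Proof.
elim: n E => [|n IH] E cE D A hD.
  have [i iD] : exists i, i \in D by apply/card_gt0P; apply: leq_ltn_trans hD.
  exists (fun k => (k == i)%:R); split.
  - by exists i; rewrite eqxx oner_eq0.
  - by move=> k; case: eqP => // -> /negP.
  - by move=> j; rewrite (cards0_eq cE) inE.
have [j0 j0E] : exists j, j \in E by apply/card_gt0P; rewrite cE.
have cE' : #|E :\ j0| = n by have := cardsD1 j0 E; rewrite j0E cE => -[].
case: (pickP [pred i in D | A i j0 != 0]) => [i0 /andP [i0D a0]|h0]; last first.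
  have [|c [h1 h2 h3]] := IH _ cE' D A; first by rewrite cE'; apply: ltn_trans hD; rewrite cE.
  exists c; split=> // j jE; case: (eqVneq j j0) => [->|nj]; last by apply: h3; rewrite !inE nj.
  rewrite big1 // => i _; case: (boolP (i \in D)) => iD; last by rewrite h2 ?mul0r.
  by have := h0 i; rewrite /= iD /= => /negbFE /eqP ->; rewrite mulr0.
pose B i j := A i0 j0 * A i j - A i j0 * A i0 j.
have [|c [[k ck] h2 h3]] := IH _ cE' (D :\ i0) B.
  by rewrite cE'; have := cardsD1 i0 D; rewrite i0D; move: hD; rewrite cE; clear; lia.
have ci0 : c i0 = 0 by apply: h2; rewrite !inE eqxx.
pose s := \sum_i c i * A i j0.
(* Since [c i0 = 0], the pivot [i0] receives the coefficient - s, which is what equation [j0]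
   requires. *)
exists (fun i => A i0 j0 * c i - (if i == i0 then s else 0)); split.
- exists k; case: (eqVneq k i0) => [e|_]; first by rewrite e ci0 eqxx in ck.
  by rewrite subr0 mulf_neq0.
- move=> i iD; rewrite h2 ?mulr0 ?ifN ?subr0 //; last by rewrite !inE negb_and iD orbT.
  by apply: contraNneq iD => ->.
- move=> j jE.
  have e : \sum_i (A i0 j0 * c i - (if i == i0 then s else 0)) * A i j = \sum_i c i * B i j.
    under eq_bigr => i _ do rewrite mulrBl.
    rewrite sumrB [X in _ - X](bigD1 i0) //= eqxx [X in _ - (_ + X)]big1 => [|i /negPf ->]; last by rewrite mul0r.
    rewrite addr0 /s mulr_suml -sumrB; apply: eq_bigr => i _; rewrite /B; ring.
  rewrite e; case: (eqVneq j j0) => [->|nj]; last by apply: h3; rewrite !inE nj.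
  by rewrite big1 // => i _; rewrite /B mulrC [A i j0 * _]mulrC subrr mul0r.
Qed.

Lemma lin_dep (P : idomainType) (I J : finType) (A : I -> J -> P) : (#|J| < #|I|)%N ->
  exists c : I -> P, (exists i, c i != 0) /\ forall j, \sum_i c i * A i j = 0.
Proof.
move=> h; have [|c [h1 _ h3]] := @lin_dep_sets P I J _ [set: J] erefl [set: I] A.
  by rewrite !cardsT.
by exists c; split=> // j; apply: h3; rewrite inE.
Qed.

(** The family spans a space closed under all partial derivatives over the rational functions, with
    one common denominator [q]. In this form sums and products are handled by disjoint union and
    tensor product of families, and the degrees in iterated derivatives can be bounded. *)
Definition dsys k (I : finType) (e : I -> series k) (q : {mpoly rat[k]}) :=
  q != 0 /\ forall (i : 'I_k) (j : I), exists M : I -> {mpoly rat[k]},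
    spoly q * sderiv i (e j) = \sum_l spoly (M l) * e l.

Definition dfin k (f : series k) := exists (I : finType) (e : I -> series k) (q : {mpoly rat[k]}),
  dsys e q /\ exists c : I -> {mpoly rat[k]}, f = \sum_l spoly (c l) * e l.

Lemma dfin_poly k (p : {mpoly rat[k]}) : dfin (spoly p).
Proof.
exists unit, (fun=> 1), 1; split; last first.
  by exists (fun=> p); rewrite (big_pred1 tt) ?mulr1 // => -[].
split; first exact: oner_neq0.
move=> i j; exists (fun=> 0); rewrite sderiv1 mulr0 big1 // => l _.
by rewrite rmorph0 mul0r.
Qed.

Lemma dfin_D k (f g : series k) : dfin f -> dfin g -> dfin (f + g).
Proof.
move=> [I [e [q [[q0 he] [c ->]]]]] [J [e' [q' [[q0' he'] [c' ->]]]]].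
exists (I + J)%type, (fun x => match x with inl i => e i | inr j => e' j end), (q * q'); split; last first.
  exists (fun x => match x with inl i => c i | inr j => c' j end).
  by rewrite big_sumType.
split; first by rewrite mulf_neq0.
move=> i [j|j].
  have [M hM] := he i j; exists (fun x => match x with inl l => q' * M l | inr _ => 0 end).
  rewrite big_sumType /= [X in _ = _ + X]big1 ?addr0 => [|l _]; last by rewrite rmorph0 mul0r.
  rewrite [q * q']mulrC rmorphM -mulrA hM mulr_sumr; apply: eq_bigr => l _.
  by rewrite [in RHS]rmorphM mulrA.
have [M hM] := he' i j; exists (fun x => match x with inr l => q * M l | inl _ => 0 end).
rewrite big_sumType /= [X in _ = X + _]big1 ?add0r => [|l _]; last by rewrite rmorph0 mul0r.
rewrite rmorphM -mulrA hM mulr_sumr; apply: eq_bigr => l _.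
by rewrite [in RHS]rmorphM mulrA.
Qed.

Lemma dfin_M k (f g : series k) : dfin f -> dfin g -> dfin (f * g).
Proof.
move=> [I [e [q [[q0 he] [c ->]]]]] [J [e' [q' [[q0' he'] [c' ->]]]]].
exists (I * J)%type, (fun x => e x.1 * e' x.2), (q * q'); split; last first.
  exists (fun x => c x.1 * c' x.2).
  rewrite mulr_suml -(pair_big predT predT (fun i j => spoly (c i * c' j) * (e i * e' j))) /=.
  apply: eq_bigr => i _; rewrite mulr_sumr; apply: eq_bigr => j _.
  by rewrite rmorphM mulrACA.
split; first by rewrite mulf_neq0.
move=> i [j j'] /=.
have [M hM] := he i j; have [M' hM'] := he' i j'.
exists (fun x => q' * M x.1 *+ (x.2 == j') + q * M' x.2 *+ (x.1 == j)).
transitivity (\sum_l spoly (q' * M l) * (e l * e' j') + \sum_l spoly (q * M' l) * (e j * e' l)).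
  rewrite sderivM mulrDr; congr (_ + _).
    rewrite [q * q']mulrC rmorphM -mulrA [spoly q * _]mulrA hM mulr_suml mulr_sumr.
    by apply: eq_bigr => l _; rewrite [in RHS]rmorphM !mulrA.
  rewrite rmorphM -mulrA [e j * _]mulrC [spoly q' * _]mulrA hM' mulr_suml mulr_sumr.
  by apply: eq_bigr => l _; rewrite [in RHS]rmorphM [e j * _]mulrC !mulrA.
rewrite -(pair_big predT predT (fun l l' => spoly (q' * M l *+ (l' == j') + q * M' l' *+ (l == j)) * (e l * e' l'))) /=.
transitivity (\sum_l \sum_l' (spoly (q' * M l) * (e l * e' l') *+ (l' == j') + spoly (q * M' l') * (e l * e' l') *+ (l == j))).
  under [RHS]eq_bigr => l _ do rewrite big_split.
  rewrite big_split /=; congr (_ + _).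
    apply: eq_bigr => l _; rewrite (bigD1 j') //= eqxx mulr1n big1 ?addr0 // => l' /negPf ->.
    by rewrite mulr0n.
  rewrite [RHS](bigD1 j) //= [X in _ = _ + X]big1 ?addr0 => [|l /negPf hl].
    by apply: eq_bigr => l' _; rewrite eqxx mulr1n.
  by rewrite big1 // => l' _; rewrite hl mulr0n.
apply: eq_bigr => l _; apply: eq_bigr => l' _.
by rewrite rmorphD !rmorphMn mulrDl !mulrnAl.
Qed.

Lemma dfin_inv k (p : {mpoly rat[k]}) (f : series k) : p != 0 -> spoly p * f = 1 -> dfin f.
Proof.
move=> p0 hp; exists unit, (fun=> f), p; split; last first.
  by exists (fun=> 1); rewrite (big_pred1 tt) ?rmorph1 ?mul1r // => -[].
split=> // i j; exists (fun=> - p^`M(i)); rewrite (big_pred1 tt) => [|[]] //.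
have := congr1 (@sderiv k i) hp; rewrite sderivM sderiv1 sderiv_spoly => h.
by apply/eqP; rewrite rmorphN mulNr -addr_eq0 addrC; apply/eqP.
Qed.

Definition psub k j (a : 'I_k -> {mpoly rat[j]}) : {mpoly rat[k]} -> {mpoly rat[j]} :=
  mmap (@mpolyC j rat) a.
HB.instance Definition _ k j (a : 'I_k -> {mpoly rat[j]}) := GRing.RMorphism.on (psub a).

Lemma psubX k j (a : 'I_k -> {mpoly rat[j]}) i : psub a 'X_i = a i.
Proof. by rewrite /psub mmapX mmap1U. Qed.
Lemma psubC k j (a : 'I_k -> {mpoly rat[j]}) c : psub a c%:MP = c%:MP.
Proof. by rewrite /psub mmapC. Qed.

Lemma comp_psub k j (a : 'I_k -> {mpoly rat[j]}) p : (forall i, inF 1 (spoly (a i))) ->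
  comp (fun i => spoly (a i)) (spoly p) = spoly (psub a p).
Proof.
move=> ha; rewrite comp_spoly; elim/mpoly_ind': p => [c|i|p q hp hq|p q hp hq].
- by rewrite pcompC psubC.
- by rewrite psubX pcompX.
- by rewrite !rmorphD /= hp hq.
- by rewrite !rmorphM /= hp hq.
Qed.

(** The chain rule transports the system; injectivity on polynomials keeps its denominator
    nonzero. *)
Lemma dfin_comp k j (a : 'I_k -> {mpoly rat[j]}) f : (forall i, inF 1 (spoly (a i))) ->
  injective (psub a) -> dfin f -> dfin (comp (fun i => spoly (a i)) f).
Proof.
move=> ha inj [I [e [q [[q0 he] [c ->]]]]].
exists I, (fun l => comp (fun i => spoly (a i)) (e l)), (psub a q); split; last first.
  exists (fun l => psub a (c l)); rewrite rmorph_sum /=; apply: eq_bigr => l _.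
  by rewrite rmorphM /= comp_psub.
split; first by rewrite -(rmorph0 (psub a)) (inj_eq inj).
move=> i l; have [M hM] := choice (fun m => he m l).
exists (fun l' => \sum_m psub a (M m l') * (a m)^`M(i)).
rewrite comp_deriv // -comp_psub // mulr_sumr.
under [RHS]eq_bigr => l' _ do rewrite rmorph_sum mulr_suml.
rewrite [RHS]exchange_big /=; apply: eq_bigr => m _.
rewrite mulrA -rmorphM hM rmorph_sum mulr_suml; apply: eq_bigr => l' _.
by rewrite rmorphM /= comp_psub // rmorphM sderiv_spoly mulrAC.
Qed.

Lemma sum_option (V : nmodType) (I : finType) (F : option I -> V) :
  \sum_x F x = F None + \sum_l F (Some l).
Proof.
rewrite (bigD1 None) //=; congr (_ + _); rewrite (reindex_omap Some id) /=; last by case.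
by apply: eq_bigl => l; rewrite /= ?eqxx.
Qed.

Lemma sum_seriesE k (l : seq (series k)) : sum_series l = \sum_(f <- l) f.
Proof. by elim: l => [|f l IH]; rewrite ?big_nil // big_cons -IH. Qed.

Section Commuting.
Variables (T : Type) (n : nat) (D : 'I_n -> T -> T).
Hypothesis DC : forall i j x, D i (D j x) = D j (D i x).

Definition dmon (e : 'X_{1..n}) (x : T) : T := foldr (fun i y => iter (e i) (D i) y) x (enum 'I_n).

Lemma dmon0 x : dmon 0%MM x = x.
Proof. by rewrite /dmon; elim: (enum 'I_n) => //= i l ->; rewrite mnm0E. Qed.

Lemma iterDC i j m x : D i (iter m (D j) x) = iter m (D j) (D i x).
Proof. by elim: m => //= m <-; rewrite DC. Qed.

Lemma dmonC i e x : D i (dmon e x) = dmon e (D i x).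
Proof. by rewrite /dmon; elim: (enum 'I_n) => //= j l IH; rewrite iterDC IH. Qed.

Lemma dmonS i e x : D i (dmon e x) = dmon (e + U_(i))%MM x.
Proof.
rewrite /dmon; have : i \in enum 'I_n by rewrite mem_enum.
elim: (enum 'I_n) (enum_uniq 'I_n) => //= j l IH /andP [jl ul].
rewrite inE mnmDE mnm1E; case: (eqVneq i j) => [->|nij] /= h.
  rewrite addn1 iterS; congr (D j (iter _ _ _)).
  elim: l jl {IH ul h} => //= m l IH; rewrite inE negb_or => /andP [h1 h2].
  by rewrite -IH // mnmDE mnm1E (negPf h1) addn0.
by rewrite addn0 iterDC IH.
Qed.

Lemma dmon_iter i m e x : dmon e (iter m (D i) x) = dmon (e + U_(i) *+ m)%MM x.
Proof.
elim: m e => [|m IH] e; first by rewrite mulm0n addm0.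
by rewrite iterS -dmonC dmonS IH mulmS addmA.
Qed.

Lemma mnm_ind (P : 'X_{1..n} -> Prop) :
  P 0%MM -> (forall e i, P e -> P (e + U_(i))%MM) -> forall e, P e.
Proof.
move=> h0 hS e; move: {2}(mdeg e) (erefl (mdeg e)) => d; elim: d e => [|d IH] e he.
  by move/eqP: he; rewrite mdeg_eq0 => /eqP ->.
have [i hi] : exists i, e i != 0%N.
  apply/existsP; rewrite -negb_forall; apply/negP => /forallP h.
  have e0 : e = 0%MM by apply/mnmP => i; rewrite mnm0E; apply/eqP; exact: h.
  by rewrite e0 mdeg0 in he.
have le : (U_(i) <= e)%MM by rewrite lep1mP.
rewrite -(submK le); apply: hS; apply: IH.
by have := congr1 (@mdeg n) (submK le); rewrite mdegD mdeg1 he addn1 => -[].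
Qed.

End Commuting.

Lemma sderivm0 k (f : series k) : sderivm 0%MM f = f.
Proof. exact: dmon0. Qed.

Lemma sderivmS k (i : 'I_k) (d : 'X_{1..k}) (f : series k) :
  sderiv i (sderivm d f) = sderivm (d + U_(i))%MM f.
Proof. exact: (dmonS (@sderiv_comm k)). Qed.

(* Adjoining A to a maximal independent family of its derivatives gives a system. *)
Lemma dfin_holonomic k (A : series k) : holonomic A -> dfin A.
Proof.
move=> [N hN].
pose dep n (d : 'I_n -> 'X_{1..k}) := exists p : 'I_n -> {mpoly rat[k]},
  (exists j, p j != 0) /\ \sum_j spoly (p j) * sderivm (d j) A = 0.
have hdep (d : 'I_N.+1 -> 'X_{1..k}) : dep _ d.
  have [p [h1 h2]] := hN d; exists p; split=> //; apply: serP => m.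
  rewrite ser0E -[RHS](h2 m) sum_seriesE big_map big_enum_cond /=.
  by congr (_ m); apply: eq_bigl.
(* Take the least size at which all families are dependent. It is positive, because a relation must
   have a nonzero coefficient and the empty family has none to offer. *)
have [n [d [hnd hd]]] : exists n (d : 'I_n -> 'X_{1..k}), ~ dep n d /\ forall d0 : 'X_{1..k},
    dep n.+1 (fun j => if unlift ord0 j is Some j' then d j' else d0).
  have ex0 : exists m, `[< forall d : 'I_m -> 'X_{1..k}, dep m d >] by exists N.+1; apply/asboolP.
  case: (ex_minnP ex0) => -[|m] /asboolP hm min.
    by have [p [[[]]]] := hm (fun=> 0%MM).
  have : ~ forall d : 'I_m -> 'X_{1..k}, dep m d.
    by move=> h; have := min m (introT (asboolP _) h); rewrite ltnn.
  move=> /existsNP [d hd]; exists m, d; split=> // d0; exact: hm.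
have key d0 : exists c : {mpoly rat[k]}, c != 0 /\ exists M : 'I_n -> {mpoly rat[k]},
    spoly c * sderivm d0 A = \sum_l spoly (M l) * sderivm (d l) A.
  have [p [[j pj] h]] := hd d0; exists (p ord0); split.
    apply/eqP => p0; apply: hnd; exists (fun j => p (lift ord0 j)); split.
      by case: (unliftP ord0 j) pj => [j' ->|->]; [exists j' | rewrite p0 eqxx].
    rewrite big_ord_recl p0 rmorph0 mul0r add0r in h.
    by rewrite -[RHS]h; apply: eq_bigr => l _; rewrite liftK.
  exists (fun l => - p (lift ord0 l)).
  rewrite big_ord_recl unlift_none in h; apply/eqP; rewrite -subr_eq0 -[X in _ == X]h.
  apply/eqP; congr (_ + _); rewrite -sumrN; apply: eq_bigr => l _.
  by rewrite liftK rmorphN mulNr opprK.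
have [c hc] := choice key.
have [M0 hM0] := (proj2 (hc 0%MM)); rewrite sderivm0 in hM0.
pose e (x : option 'I_n) := if x is Some l then sderivm (d l) A else A.
pose dd (x : 'I_k * option 'I_n) : 'X_{1..k} := if x.2 is Some l then (d l + U_(x.1))%MM else U_(x.1)%MM.
exists (option 'I_n), e, (\prod_x c (dd x)); split; last first.
  exists (fun x => if x is None then 1 else 0).
  rewrite sum_option rmorph1 mul1r big1 ?addr0 // => l _.
  by rewrite rmorph0 mul0r.
split.
  by apply/prodf_neq0 => x _; apply: (proj1 (hc _)).
move=> i x; set d1 := dd (i, x).
have -> : sderiv i (e x) = sderivm d1 A.
  rewrite /d1; case: x {d1} => [l|] /=; first by rewrite sderivmS.
  by rewrite -{1}(sderivm0 A) sderivmS add0m.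
have [q' ->] : exists q', \prod_y c (dd y) = q' * c d1.
  by rewrite (bigD1 (i, x)) //=; eexists; rewrite mulrC.
have [M hM] := proj2 (hc d1).
exists (fun y => if y is Some l then q' * M l else 0).
rewrite rmorphM -mulrA hM mulr_sumr sum_option rmorph0 mul0r add0r.
by apply: eq_bigr => l _; rewrite rmorphM mulrA.
Qed.

(** Adjoin f to the system of p f: its derivatives are controlled by p f' = (p f)' - p' f. *)
Lemma dfin_div k (p : {mpoly rat[k]}) (f : series k) : p != 0 -> dfin (spoly p * f) -> dfin f.
Proof.
move=> p0 [I [e [q [[q0 he] [c hf]]]]].
pose e' (x : option I) := if x is Some l then e l else f.
exists (option I), e', (p * q); split; last first.
  exists (fun x => if x is None then 1 else 0).
  rewrite sum_option rmorph1 mul1r big1 ?addr0 // => l _.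
  by rewrite rmorph0 mul0r.
split; first by rewrite mulf_neq0.
move=> i [l|].
  have [M hM] := he i l; exists (fun y => if y is Some l' then p * M l' else 0).
  rewrite sum_option rmorph0 mul0r add0r rmorphM -mulrA hM mulr_sumr.
  by apply: eq_bigr => l' _; rewrite [in RHS]rmorphM mulrA.
have [M hM] := choice (fun l => he i l).
exists (fun y => if y is Some l' then q * (c l')^`M(i) + \sum_l c l * M l l' else - (q * p^`M(i))).
rewrite sum_option /= rmorphN mulNr.
have h1 : spoly p * sderiv i f = sderiv i (spoly p * f) - spoly p^`M(i) * f.
  by rewrite sderivM sderiv_spoly addrAC subrr add0r.
rewrite [p * q]mulrC rmorphM -mulrA h1 mulrBr [- _ + _]addrC; congr (_ - _); last by rewrite rmorphM mulrA.
rewrite hf raddf_sum mulr_sumr /=.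
transitivity (\sum_l (spoly (q * (c l)^`M(i)) * e l) + \sum_l (spoly (c l) * \sum_l' spoly (M l l') * e l')).
  rewrite -big_split; apply: eq_bigr => l _ /=; rewrite sderivM sderiv_spoly mulrDr -hM.
  by rewrite rmorphM -mulrA [in X in _ + X]mulrCA.
under [X in _ + X = _]eq_bigr => l _ do rewrite mulr_sumr.
rewrite [X in _ + X = _]exchange_big -big_split; apply: eq_bigr => l' _ /=.
rewrite rmorphD mulrDl rmorph_sum mulr_suml; congr (_ + _); apply: eq_bigr => l _.
by rewrite rmorphM mulrA.
Qed.

Lemma eulerE k (i : 'I_k) (f : series k) m : (X i * sderiv i f) m = (m i)%:R * f m.
Proof.
rewrite monoM lep1mP; case: eqP => [->|/eqP h]; first by rewrite mul0r.
have h' : (U_(i) <= m)%MM by rewrite lep1mP.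
by rewrite sderivE submK // mnmBE mnm1E eqxx subn1 prednK // lt0n.
Qed.

Lemma msizeM_le k (p q : {mpoly rat[k]}) : (msize (p * q) <= msize p + msize q)%N.
Proof.
case: (eqVneq p 0) => [->|p0]; first by rewrite mul0r msize0.
case: (eqVneq q 0) => [->|q0]; first by rewrite mulr0 msize0.
by rewrite msizeM // leq_pred.
Qed.

Lemma msize_sum_le k (I : Type) (r : seq I) (P : pred I) (F : I -> {mpoly rat[k]}) D :
  (forall i, P i -> msize (F i) <= D)%N -> (msize (\sum_(i <- r | P i) F i) <= D)%N.
Proof.
move=> h; elim/big_rec: _ => [|i p Pi hp]; first by rewrite msize0.
by apply: leq_trans (msizeD_le _ _) _; rewrite geq_max h.
Qed.

Lemma msize_deriv k (i : 'I_k) (p : {mpoly rat[k]}) : (msize p^`M(i) <= msize p)%N.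
Proof.
rewrite [X in (X <= _)%N]msizeE big_seq; apply: (big_ind (fun n => n <= msize p)%N) => //.
  by move=> a b ha hb; rewrite geq_max ha.
move=> m; rewrite mcoeff_msupp mcoeff_mderiv => h.
have : (m + U_(i))%MM \in msupp p.
  by rewrite mcoeff_msupp; apply: contra h => /eqP ->; rewrite mul0rn.
by move/msize_mdeg_lt; rewrite mdegD mdeg1 addn1; apply: ltnW.
Qed.

Lemma mderivXn_mul k (i : 'I_k) (q : {mpoly rat[k]}) n :
  q * (q ^+ n)^`M(i) = q^`M(i) * q ^+ n *+ n.
Proof.
elim: n => [|n IH]; first by rewrite expr0 -mpolyC1 mderivC mulr0 mulr0n.
rewrite exprS mderivM mulrDr [q * (q * _)]mulrCA [q * (q ^+ n)^`M(i)]IH.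
by rewrite mulrS; congr (_ + _); rewrite ?mulrnAr; [rewrite mulrCA | congr (_ *+ _); rewrite mulrCA].
Qed.

Section Growth.
Variables (k : nat) (I : finType) (e : I -> series k) (q : {mpoly rat[k]}).
Variable (M : 'I_k -> I -> I -> {mpoly rat[k]}).
Hypothesis hM : forall i j, spoly q * sderiv i (e j) = \sum_l spoly (M i j l) * e l.

(* A first-order operator raises n by 1 and the degree bound D by a constant. *)
Definition QQ n D (F : series k) := exists A : I -> {mpoly rat[k]},
  (forall l, msize (A l) <= D)%N /\ spoly (q ^+ n) * F = \sum_l spoly (A l) * e l.

Lemma QQ_le n D D' F : (D <= D')%N -> QQ n D F -> QQ n D' F.
Proof. by move=> h [A [h1 h2]]; exists A; split=> // l; apply: leq_trans (h1 l) h. Qed.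

Definition vop (v : 'I_k -> {mpoly rat[k]}) p0 (F : series k) :=
  spoly p0 * F + \sum_i spoly (v i) * sderiv i F.

Lemma QQ_vop v p0 : exists c, forall n D F, QQ n D F -> QQ n.+1 (D + c) (vop v p0 F).
Proof.
pose c := (msize p0 + \sum_i msize (v i) + 2 * msize q + \sum_i \sum_j \sum_l msize (M i j l))%N.
exists c => n D F [A [hA hF]].
pose A' l := p0 * q * A l + \sum_i v i * (q * (A l)^`M(i) - q^`M(i) * A l *+ n + \sum_j A j * M i j l).
exists A'; split=> [l|].
  have hv i : (msize (v i) <= \sum_i msize (v i))%N by rewrite (bigD1 i) //= leq_addr.
  have hMM i j l' : (msize (M i j l') <= \sum_i \sum_j \sum_l msize (M i j l))%N.
    by rewrite (bigD1 i) //= (bigD1 j) //= (bigD1 l') //= -!addnA leq_addr.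
  apply: leq_trans (msizeD_le _ _) _; rewrite geq_max; apply/andP; split.
    apply: leq_trans (msizeM_le _ _) _; have := msizeM_le p0 q; have := hA l.
    by rewrite /c; clear; lia.
  apply: msize_sum_le => i _; apply: leq_trans (msizeM_le _ _) _.
  set W := (_ + _); have : (msize W <= D + 2 * msize q + \sum_i \sum_j \sum_l msize (M i j l))%N.
    apply: leq_trans (msizeD_le _ _) _; rewrite geq_max; apply/andP; split.
      apply: leq_trans (msizeD_le _ _) _; rewrite geq_max; apply/andP; split.
        apply: leq_trans (msizeM_le _ _) _; have := msize_deriv i (A l); have := hA l; clear; lia.
      rewrite msizeN -scaler_nat; case: (n) => [|n']; first by rewrite scale0r msize0.
      rewrite msizeZ ?pnatr_eq0 //.
      apply: leq_trans (msizeM_le _ _) _; have := msize_deriv i q; have := hA l; clear; lia.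
    apply: msize_sum_le => j _; apply: leq_trans (msizeM_le _ _) _.
    by have := hA j; have := hMM i j l; clear; lia.
  by have := hv i; rewrite /c; clear; lia.
have hd i : spoly (q ^+ n.+1) * sderiv i F =
   \sum_l spoly (q * (A l)^`M(i) - q^`M(i) * A l *+ n + \sum_j A j * M i j l) * e l.
  have h1 : spoly (q ^+ n.+1) * sderiv i F =
     spoly q * sderiv i (spoly (q ^+ n) * F) - spoly q^`M(i) * (spoly (q ^+ n) * F) *+ n.
    rewrite sderivM sderiv_spoly mulrDr !mulrA -!rmorphM mderivXn_mul exprS.
    by rewrite rmorphMn mulrnAl addrAC subrr add0r.
  rewrite h1 hF raddf_sum mulr_sumr mulr_sumr -sumrMnl -sumrB.
  transitivity (\sum_l (spoly (q * (A l)^`M(i) - q^`M(i) * A l *+ n) * e l + \sum_j spoly (A l * M i l j) * e j)).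
    apply: eq_bigr => l _ /=; rewrite sderivM sderiv_spoly mulrDr [spoly q * (spoly (A l) * _)]mulrCA hM.
    rewrite rmorphB rmorphMn !rmorphM /= mulrBl mulrnAl -!mulrA addrAC; congr (_ - _ + _).
    by rewrite mulr_sumr; apply: eq_bigr => j _; rewrite [in RHS]rmorphM mulrA.
  rewrite big_split /= exchange_big -big_split; apply: eq_bigr => l _ /=.
  by rewrite [in RHS]rmorphD mulrDl; congr (_ + _); rewrite rmorph_sum mulr_suml.
rewrite /vop mulrDr mulr_sumr.
have -> : spoly (q ^+ n.+1) * (spoly p0 * F) = \sum_l spoly (p0 * q * A l) * e l.
  rewrite exprS rmorphM mulrACA hF [spoly q * _]mulrC -rmorphM.
  by rewrite mulr_sumr; apply: eq_bigr => l _; rewrite [in RHS]rmorphM mulrA.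
have -> : \sum_i spoly (q ^+ n.+1) * (spoly (v i) * sderiv i F) =
   \sum_l spoly (\sum_i v i * (q * (A l)^`M(i) - q^`M(i) * A l *+ n + \sum_j A j * M i j l)) * e l.
  under [RHS]eq_bigr => l _ do rewrite rmorph_sum mulr_suml.
  rewrite [RHS]exchange_big; apply: eq_bigr => i _ /=; rewrite mulrCA hd mulr_sumr.
  by apply: eq_bigr => l _; rewrite [in RHS]rmorphM mulrA.
by rewrite -big_split; apply: eq_bigr => l _ /=; rewrite /A' rmorphD mulrDl.
Qed.

Lemma QQ_pad n n' D F : (n <= n')%N -> QQ n D F -> QQ n' (D + (n' - n) * msize q) F.
Proof.
move=> h; rewrite -{1}(subnK h); elim: (n' - n)%N => [|m IH]; first by rewrite mul0n addn0.
move=> /IH [A [h1 h2]]; exists (fun l => q * A l); split=> [l|].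
  apply: leq_trans (msizeM_le _ _) _; have := h1 l; rewrite mulSn; clear; lia.
rewrite addSn exprS rmorphM -mulrA h2 mulr_sumr; apply: eq_bigr => l _.
by rewrite rmorphM mulrA.
Qed.

Lemma QQ_iter (O : series k -> series k) c :
  (forall n D F, QQ n D F -> QQ n.+1 (D + c) (O F)) ->
  forall a n D F, QQ n D F -> QQ (n + a) (D + a * c) (iter a O F).
Proof.
move=> h; elim=> [|a IH] n D F hF; first by rewrite mul0n !addn0.
by rewrite addnS mulSn addnA addnAC; apply: h; apply: IH.
Qed.

End Growth.

(** * Diagonals *)

(* The seven variables are z, u, t, S, alpha, p, y, the five ones z, u, t, S, R; the
   diagonal identifies R with alpha p y. *)
Definition i4 : 'I_7 := @Ordinal 7 4 isT.
Definition i5 : 'I_7 := @Ordinal 7 5 isT.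
Definition i6 : 'I_7 := @Ordinal 7 6 isT.
Definition iR : 'I_5 := @Ordinal 5 4 isT.
Definition low (i : 'I_5) : 'I_7 := widen_ord (isT : (5 <= 7)%N) i.

Definition mk7 (m : 'X_{1..5}) (a b c : nat) : 'X_{1..7} :=
  [multinom nth 0%N [:: m (inord 0); m (inord 1); m (inord 2); m (inord 3); a; b; c] i | i < 7].

(** A shifted diagonal, at distances a and b from the main one. The shifts are needed because the
    powers of [O1] and [O2] vanish on the main diagonal. *)
Definition Ext (a b : nat) (F : series 7) : series 5 :=
  fun m => F (mk7 m (m iR + a)%N (m iR + b)%N (m iR)).
Definition Diag := Ext 0 0.

Lemma Ext_is_zmod a b : zmod_morphism (Ext a b).
Proof. by move=> F G; apply: serP. Qed.
HB.instance Definition _ a b := GRing.isZmodMorphism.Build _ _ (Ext a b) (Ext_is_zmod a b).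

Lemma mk7_low m a b c (i : 'I_5) : (i < 4)%N -> mk7 m a b c (low i) = m i.
Proof.
by rewrite mnmE; case: i => -[|[|[|[|i]]]] hi //= _; congr (m _); apply: val_inj; rewrite /= inordK.
Qed.
Lemma mk7_4 m a b c : mk7 m a b c i4 = a. Proof. by rewrite mnmE. Qed.
Lemma mk7_5 m a b c : mk7 m a b c i5 = b. Proof. by rewrite mnmE. Qed.
Lemma mk7_6 m a b c : mk7 m a b c i6 = c. Proof. by rewrite mnmE. Qed.

Lemma case7 (P : 'I_7 -> Prop) : (forall i : 'I_5, (i < 4)%N -> P (low i)) ->
  P i4 -> P i5 -> P i6 -> forall i, P i.
Proof.
move=> h p4 p5 p6 [[|[|[|[|[|[|[|n]]]]]]] hi] //.
- by have := h (@Ordinal 5 0 isT) isT; rewrite (_ : low _ = Ordinal hi) //; apply: val_inj.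
- by have := h (@Ordinal 5 1 isT) isT; rewrite (_ : low _ = Ordinal hi) //; apply: val_inj.
- by have := h (@Ordinal 5 2 isT) isT; rewrite (_ : low _ = Ordinal hi) //; apply: val_inj.
- by have := h (@Ordinal 5 3 isT) isT; rewrite (_ : low _ = Ordinal hi) //; apply: val_inj.
- by rewrite (_ : Ordinal hi = i4) //; apply: val_inj.
- by rewrite (_ : Ordinal hi = i5) //; apply: val_inj.
- by rewrite (_ : Ordinal hi = i6) //; apply: val_inj.
Qed.

Lemma case5 (P : 'I_5 -> Prop) : (forall i : 'I_5, (i < 4)%N -> P i) -> P iR -> forall i, P i.
Proof.
move=> h p4 i; case: (ltnP i 4) => hi; first exact: h.
rewrite (_ : i = iR) //; apply: val_inj => /=; have := ltn_ord i; move: hi; clear; lia.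
Qed.

Lemma low_neq (i : 'I_5) : (i < 4)%N -> [/\ low i != i4, low i != i5, low i != i6 & i != iR].
Proof. by move=> h; rewrite -!val_eqE /=; split; apply/eqP => e; rewrite e in h. Qed.

Lemma mk7_low_sub m a b c (i : 'I_5) : (i < 4)%N -> (mk7 m a b c - U_(low i))%MM = mk7 (m - U_(i))%MM a b c.
Proof.
move=> hi; have [n4 n5 n6 nR] := low_neq hi.
apply/mnmP; apply: case7 => [j hj|||]; rewrite mnmBE mnm1E.
- by rewrite !mk7_low // mnmBE mnm1E.
- by rewrite !mk7_4 (negPf n4) subn0.
- by rewrite !mk7_5 (negPf n5) subn0.
- by rewrite !mk7_6 (negPf n6) subn0.
Qed.

Definition iotaX (i : 'I_5) : {mpoly rat[7]} := if (i < 4)%N then 'X_(low i) else 'X_i4 * 'X_i5 * 'X_i6.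
Definition iota := psub iotaX.
HB.instance Definition _ := GRing.RMorphism.on iota.

(** Multiplication by alpha p y moves along a shifted diagonal, so the extraction is linear over
    polynomials in z, u, t, S and R. *)
Lemma Ext_iota a b c F : Ext a b (spoly (iota c) * F) = spoly c * Ext a b F.
Proof.
rewrite /iota; elim/mpoly_ind': c F => [c|i|p q hp hq|p q hp hq] F.
- by rewrite psubC; apply: serP => m; rewrite cstM /Ext cstM.
- rewrite psubX; apply: serP => m; rewrite monoM lep1mP /iotaX.
  case: ltnP => hi.
    have [n4 n5 n6 nR] := low_neq hi.
    rewrite {1}/Ext monoM lep1mP mk7_low // mk7_low_sub // /Ext.
    by case: eqP => //= _; rewrite mnmBE mnm1E (negPf nR) subn0.
  have -> : i = iR by apply: val_inj => /=; have := ltn_ord i; move: hi; clear; lia.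
  rewrite {1}/Ext -!mpolyXD monoM.
  have -> : (U_(i4) + U_(i5) + U_(i6) <= mk7 m (m iR + a) (m iR + b) (m iR))%MM = (m iR != 0%N).
    apply/mnm_lepP/idP => [h|h].
      by have := h i6; rewrite mk7_6 !mnmDE !mnm1E /= -lt0n.
    apply: case7 => [j hj|||]; rewrite !mnmDE !mnm1E.
    - by have [n4 n5 n6 nR] := low_neq hj; rewrite ![_ == low j]eq_sym (negPf n4) (negPf n5) (negPf n6).
    - by rewrite mk7_4 /=; move: h; clear; lia.
    - by rewrite mk7_5 /=; move: h; clear; lia.
    - by rewrite mk7_6 /=; move: h; clear; lia.
  case: eqP => //= /eqP h; congr (F _); apply/mnmP; apply: case7 => [j hj|||]; rewrite mnmBE !mnmDE !mnm1E.
  - have [n4 n5 n6 nR] := low_neq hj; rewrite ![_ == low j]eq_sym (negPf n4) (negPf n5) (negPf n6).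
    by rewrite !mk7_low // mnmBE mnm1E eq_sym (negPf nR).
  - by rewrite !mk7_4 mnmBE mnm1E /=; move: h; clear; lia.
  - by rewrite !mk7_5 mnmBE mnm1E /=; move: h; clear; lia.
  - by rewrite !mk7_6 mnmBE mnm1E /=; move: h; clear; lia.
- by rewrite rmorphD rmorphD mulrDl raddfD /= hp hq rmorphD mulrDl.
- by rewrite rmorphM rmorphM -mulrA hp hq rmorphM mulrA.
Qed.

(* On the coefficient of alpha^a p^b y^c these act as multiplication by b - a, respectively
   c - b, followed by a shift, and so detect the distance to the diagonal. *)
Definition O1 (F : series 7) : series 7 := X i4 * (X i5 * sderiv i5 F - X i4 * sderiv i4 F - F).
Definition O2 (F : series 7) : series 7 := X i4 * (X i5 * (X i6 * sderiv i6 F - X i5 * sderiv i5 F - F)).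

Lemma mk7_sub4 m a b c : (mk7 m a.+1 b c - U_(i4))%MM = mk7 m a b c.
Proof.
apply/mnmP; apply: case7 => [j hj|||]; rewrite mnmBE mnm1E.
- by have [n4 _ _ _] := low_neq hj; rewrite eq_sym (negPf n4) subn0 !mk7_low.
- by rewrite !mk7_4 /= subn1.
- by rewrite !mk7_5 /= subn0.
- by rewrite !mk7_6 /= subn0.
Qed.
Lemma mk7_sub5 m a b c : (mk7 m a b.+1 c - U_(i5))%MM = mk7 m a b c.
Proof.
apply/mnmP; apply: case7 => [j hj|||]; rewrite mnmBE mnm1E.
- by have [_ n5 _ _] := low_neq hj; rewrite eq_sym (negPf n5) subn0 !mk7_low.
- by rewrite !mk7_4 /= subn0.
- by rewrite !mk7_5 /= subn1.
- by rewrite !mk7_6 /= subn0.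
Qed.

Lemma O1_coef m a b c F : O1 F (mk7 m a b c) =
  if a is a'.+1 then (b%:R - a%:R) * F (mk7 m a' b c) else 0.
Proof.
rewrite /O1 monoM lep1mP mk7_4; case: a => [|a] //=.
rewrite mk7_sub4 !serBE !eulerE mk7_5 mk7_4 -[a.+1%:R]natr1; ring.
Qed.

Lemma O2_coef m a b c F : O2 F (mk7 m a b c) =
  if a is a'.+1 then if b is b'.+1 then (c%:R - b%:R) * F (mk7 m a' b' c) else 0 else 0.
Proof.
rewrite /O2 monoM lep1mP mk7_4; case: a => [|a] //=; rewrite mk7_sub4 monoM lep1mP mk7_5.
case: b => [|b] //=; rewrite mk7_sub5 !serBE !eulerE mk7_6 mk7_5 -[b.+1%:R]natr1; ring.
Qed.

Lemma iterO1 m n a b c F : iter n O1 F (mk7 m (a + n)%N b c) =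
  (\prod_(l < n) (b%:R - (a + n)%:R + l%:R)) * F (mk7 m a b c).
Proof.
elim: n a => [|n IH] a; first by rewrite big_ord0 mul1r addn0.
rewrite iterS addnS O1_coef IH big_ord_recl /= addr0 mulrA; congr (_ * _ * _).
by apply: eq_bigr => i _; rewrite /bump /= -natr1 natrD; ring.
Qed.

Lemma iterO1_0 m n l a b c F : (l < n)%N -> (b + l)%N = a -> iter n O1 F (mk7 m a b c) = 0.
Proof.
elim: n l a => // n IH l a hl ha; rewrite iterS O1_coef; case: a ha => // a ha.
case: l hl ha => [|l] hl ha; first by rewrite -ha addn0 subrr mul0r.
by rewrite (IH l) ?mulr0 //; move: ha; clear; lia.
Qed.

Lemma iterO2 m n a b c F : iter n O2 F (mk7 m (a + n)%N (b + n)%N c) =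
  (\prod_(l < n) (c%:R - (b + n)%:R + l%:R)) * F (mk7 m a b c).
Proof.
elim: n a b => [|n IH] a b; first by rewrite big_ord0 mul1r !addn0.
rewrite iterS !addnS O2_coef IH big_ord_recl /= addr0 mulrA; congr (_ * _ * _).
by apply: eq_bigr => i _; rewrite /bump /= -natr1 natrD; ring.
Qed.

Lemma iterO2_0 m n l a b c F : (l < n)%N -> (c + l)%N = b -> iter n O2 F (mk7 m a b c) = 0.
Proof.
elim: n l a b => // n IH l a b hl hb; rewrite iterS O2_coef; case: a => // a; case: b hb => // b hb.
case: l hl hb => [|l] hl hb; first by rewrite -hb addn0 subrr mul0r.
by rewrite (IH l) ?mulr0 //; move: hb; clear; lia.
Qed.

Lemma prod_sub_neq0 n : \prod_(l < n) (- n%:R + l%:R) != 0 :> rat.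
Proof.
apply/prodf_neq0 => l _; rewrite addrC subr_eq0 eqr_nat.
by have := ltn_ord l; clear; lia.
Qed.

(** On the diagonal shifted by (a0 + b0, b0) the factors of [O1] to the power a contain a zero as
    soon as a > a0. For a = a0 what remains is [O2] on the diagonal shifted by b0, where b > b0
    gives a zero in the same way. The lexicographically least pair thus isolates its own term. *)
Lemma Ext_O a0 b0 a b F : (a0 < a)%N || (a0 == a) && (b0 <= b)%N ->
  Ext (a0 + b0) b0 (iter a O1 (iter b O2 F)) =
  if (a == a0) && (b == b0) then
    cst 5 ((\prod_(l < a0) (- a0%:R + l%:R)) * \prod_(l < b0) (- b0%:R + l%:R)) * Diag F
  else 0.
Proof.
move=> h; apply: serP => m; rewrite {1}/Ext.
case: (ltngtP a0 a) h => [h1|//|<-] /= h.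
  by rewrite (@iterO1_0 _ _ a0) // -addnA [(a0 + _)%N]addnC.
rewrite addnA addnAC iterO1.
case: (ltngtP b0 b) h => [h2|//|<-] _ /=.
  by rewrite (@iterO2_0 _ _ b0) // mulr0.
rewrite iterO2 cstM mulrA /Diag /Ext !addn0; congr (_ * _ * _).
- by apply: eq_bigr => l _; rewrite natrD; ring.
- by apply: eq_bigr => l _; rewrite natrD; ring.
Qed.

(** After multiplication by (p y)^D each power of alpha can be completed to a power of alpha p y,
    which counts as a scalar. Only exponents of p and y up to 2 D remain, so the space has dimension
    quadratic in D. *)
Lemma shift_poly (A : {mpoly rat[7]}) D : (msize A <= D)%N ->
  exists C : 'I_(D + D).+1 -> 'I_(D + D).+1 -> {mpoly rat[5]},
    A * ('X_i5 * 'X_i6) ^+ D = \sum_j \sum_l iota (C j l) * ('X_i5 ^+ j * 'X_i6 ^+ l).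
Proof.
move=> hA.
pose r5 (m : 'X_{1..7}) : 'X_{1..5} := [multinom m (low i) | i < 5].
pose ej (m : 'X_{1..7}) := (D + m i5 - m i4)%N.
pose el (m : 'X_{1..7}) := (D + m i6 - m i4)%N.
have mono m : (mdeg m < D)%N ->
  'X_[m] * ('X_i5 * 'X_i6) ^+ D = iota 'X_[r5 m] * ('X_i5 ^+ ej m * 'X_i6 ^+ el m) :> {mpoly rat[7]}.
  move=> hm; have h4 : (m i4 <= D)%N.
    by apply: leq_trans (ltnW hm); rewrite mdegE (bigD1 i4) //= leq_addr.
  have -> : iota 'X_[r5 m] = (\prod_(i < 5 | (i < 4)%N) 'X_(low i) ^+ m (low i)) * ('X_i4 * 'X_i5 * 'X_i6) ^+ m i4.
    rewrite mpolyXE_id rmorph_prod /= (bigID (fun i : 'I_5 => (i < 4)%N)) /=; congr (_ * _).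
      by apply: eq_bigr => i hi; rewrite rmorphXn /= /iota psubX /iotaX hi mnmE.
    rewrite (big_pred1 iR) => [|i].
      by rewrite rmorphXn /= /iota psubX /iotaX /= mnmE; congr (_ ^+ m _); apply: val_inj.
    by rewrite /= -val_eqE /=; have := ltn_ord i; clear; lia.
  rewrite mpolyXE_id.
  have -> : \prod_(i < 7) 'X_i ^+ m i = (\prod_(i < 5 | (i < 4)%N) 'X_(low i) ^+ m (low i)) * ('X_i4 ^+ m i4 * 'X_i5 ^+ m i5 * 'X_i6 ^+ m i6) :> {mpoly rat[7]}.
    rewrite (bigD1 i4) //= (bigD1 i5) //= (bigD1 i6) //= (reindex_onto low (fun i => inord i)) /=; last first.
      move=> i hi; apply: val_inj; rewrite /= inordK //.
      by move: hi; rewrite -!val_eqE /=; have := ltn_ord i; clear; lia.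
    rewrite (eq_bigl (fun i : 'I_5 => (i < 4)%N)) => [|i]; last first.
      rewrite -!val_eqE /=; have -> : inord i = i by apply: val_inj; rewrite /= inordK.
      by rewrite eqxx andbT; have := ltn_ord i; clear; lia.
    move: (\prod_(i < 5 | _) _) ('X_i4 ^+ _) ('X_i5 ^+ _) ('X_i6 ^+ _) => w a b c.
    by ring.
  rewrite -!mulrA; congr (_ * _).
  have e5 : (D + m i5 = ej m + m i4)%N by rewrite /ej; move: h4; clear; lia.
  have e6 : (D + m i6 = el m + m i4)%N by rewrite /el; move: h4; clear; lia.
  rewrite !exprMn_comm; try exact: mulrC.
  move: (ej m) (el m) e5 e6 => x y e5 e6.
  move: ('X_i4) ('X_i5) ('X_i6) => a b c.
  transitivity (a ^+ m i4 * (b ^+ (D + m i5) * c ^+ (D + m i6))); first by rewrite !exprD; ring.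
  by rewrite e5 e6 !exprD; ring.
exists (fun j l : 'I_(D + D).+1 => \sum_(m <- msupp A | (ej m == j) && (el m == l)) A@_m *: 'X_[r5 m]).
rewrite {1}[A]mpolyE mulr_suml.
under [RHS]eq_bigr => j _ do under eq_bigr => l _ do rewrite rmorph_sum mulr_suml.
under [RHS]eq_bigr => j _ do rewrite (exchange_big_dep predT) //=.
rewrite (exchange_big_dep predT) //=.
rewrite big_seq [RHS]big_seq; apply: eq_bigr => m hm.
have dm : (mdeg m < D)%N by apply: leq_trans hA; apply: msize_mdeg_lt.
have h5 : (ej m < (D + D).+1)%N.
  have : (m i5 <= mdeg m)%N by rewrite mdegE (bigD1 i5) //= leq_addr.
  by rewrite /ej; move: dm; clear; lia.
have h6 : (el m < (D + D).+1)%N.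
  have : (m i6 <= mdeg m)%N by rewrite mdegE (bigD1 i6) //= leq_addr.
  by rewrite /el; move: dm; clear; lia.
rewrite (bigD1 (Ordinal h5)) //= (big_pred1 (Ordinal h6)) => [|l]; last first.
  by rewrite /= eqxx -val_eqE /= eq_sym.
rewrite big1 ?addr0 => [|j hj]; last first.
  rewrite big1 // => l /andP [/eqP e _]; case/eqP: hj; apply: val_inj; by rewrite /= -e.
have iZ (a : rat) p : iota (a *: p) = a%:MP * iota p.
  by rewrite -mul_mpolyC rmorphM /= [iota _%:MP]psubC.
by rewrite iZ -mul_mpolyC -!mulrA mono.
Qed.

Lemma mX_neq0 k (m : 'X_{1..k}) : 'X_[m] != 0 :> {mpoly rat[k]}.
Proof.
apply/eqP => /(congr1 (mcoeff m)); rewrite mcoeffX eqxx mcoeff0.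
by move/eqP; rewrite oner_eq0.
Qed.

Lemma choice_ex (T U : Type) (P : T -> U -> Prop) :
  (forall x, exists y, P x y) -> exists f, forall x, P x (f x).
Proof. by move=> /choice [f hf]; exists f. Qed.

(* Lipshitz: the (N+1)^3 series O1^a O2^b d^i F have O(N^2) coordinates over the polynomials
   in z, u, t, S, R; in a relation among them, the terms with (a, b) minimal survive on a
   shifted diagonal. *)
Theorem diag_ode (F : series 7) (v : 'I_7 -> {mpoly rat[7]}) (d5 : series 5 -> series 5) :
  (forall G, Diag (\sum_i spoly (v i) * sderiv i G) = d5 (Diag G)) -> dfin F ->
  exists n (c : 'I_n -> {mpoly rat[5]}), (exists i, c i != 0) /\
    \sum_i spoly (c i) * iter i d5 (Diag F) = 0.
Proof.
move=> hv [I [e [q [[q0 he] [c0 hF]]]]].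
have [M0 hM0] := choice_ex (fun i => choice_ex (he i)).
pose d7 G := \sum_i spoly (v i) * sderiv i G.
have [cd hd] := QQ_vop hM0 v 0.
have [c1 h1] := QQ_vop hM0 (fun i => if i == i5 then 'X_i4 * 'X_i5 else if i == i4 then - ('X_i4 * 'X_i4) else 0) (- 'X_i4).
have [c2 h2] := QQ_vop hM0 (fun i => if i == i6 then 'X_i4 * 'X_i5 * 'X_i6 else if i == i5 then - ('X_i4 * 'X_i5 * 'X_i5) else 0) (- ('X_i4 * 'X_i5)).
have vd G : vop v 0 G = d7 G by rewrite /vop rmorph0 mul0r add0r.
have v1 G : vop (fun i => if i == i5 then 'X_i4 * 'X_i5 else if i == i4 then - ('X_i4 * 'X_i4) else 0) (- 'X_i4) G = O1 G.
  rewrite /vop (bigD1 i5) //= (bigD1 i4) //= big1 => [|i /andP [/negPf n1 /negPf n2]]; last first.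
    by rewrite n1 n2 rmorph0 mul0r.
  rewrite !rmorphN !rmorphM /= -/(X i4) -/(X i5) /O1.
  have E (R : comNzRingType) (a b x y z : R) : - a * z + (a * b * x + (- (a * a) * y + 0)) = a * (b * x - a * y - z) by ring.
  exact: (E (series 7 : comNzRingType)).
have v2 G : vop (fun i => if i == i6 then 'X_i4 * 'X_i5 * 'X_i6 else if i == i5 then - ('X_i4 * 'X_i5 * 'X_i5) else 0) (- ('X_i4 * 'X_i5)) G = O2 G.
  rewrite /vop (bigD1 i6) //= (bigD1 i5) //= big1 => [|i /andP [/negPf n1 /negPf n2]]; last first.
    by rewrite n1 n2 rmorph0 mul0r.
  rewrite !rmorphN !rmorphM /= -/(X i4) -/(X i5) -/(X i6) /O2.
  have E (R : comNzRingType) (a b c x y z : R) : - (a * b) * z + (a * b * c * x + (- (a * b * b) * y + 0)) = a * (b * (c * x - b * y - z)) by ring.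
  exact: (E (series 7 : comNzRingType)).
have {}hd n D G : QQ e q n D G -> QQ e q n.+1 (D + cd) (d7 G) by rewrite -vd; apply: hd.
have {}h1 n D G : QQ e q n D G -> QQ e q n.+1 (D + c1) (O1 G) by rewrite -v1; apply: h1.
have {}h2 n D G : QQ e q n D G -> QQ e q n.+1 (D + c2) (O2 G) by rewrite -v2; apply: h2.
pose D0 := (\sum_l msize (c0 l))%N.
have Q0 : QQ e q 0 D0 F.
  exists c0; split=> [l|]; last by rewrite expr0 rmorph1 mul1r.
  by rewrite /D0 (bigD1 l) //= leq_addr.
pose C := (cd + c1 + c2 + msize q)%N.
(* Each of at most 3 N operators raises the degree by at most C, and C also covers padding to a
   common power of q. Hence 2 D + 1 is at most K (N + 1), and N is chosen so that [#|I|] times the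
   square of K (N + 1) equals N (N + 1)^2, which is less than (N + 1)^3. *)
pose K := (2 * D0 + 6 * C + 1)%N.
pose N := (#|I| * K * K)%N.
pose G (x : 'I_N.+1 * 'I_N.+1 * 'I_N.+1) := iter x.1.1 O1 (iter x.1.2 O2 (iter x.2 d7 F)).
pose D := (D0 + 3 * N * C)%N.
have QG x : QQ e q (3 * N) D (G x).
  have := QQ_iter h1 x.1.1 (QQ_iter h2 x.1.2 (QQ_iter hd x.2 Q0)); rewrite -/(G x) add0n => h.
  have := ltn_ord x.1.1; have := ltn_ord x.1.2; have := ltn_ord x.2; rewrite !ltnS => l3 l2 l1.
  have hN : (x.2 + x.1.2 + x.1.1 <= 3 * N)%N by move: l1 l2 l3; clear; lia.
  apply: QQ_le (QQ_pad hN h).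
  have a1 : (x.2 * cd <= N * cd)%N by rewrite leq_mul2r l3 orbT.
  have a2 : (x.1.2 * c2 <= N * c2)%N by rewrite leq_mul2r l2 orbT.
  have a3 : (x.1.1 * c1 <= N * c1)%N by rewrite leq_mul2r l1 orbT.
  have a4 : ((3 * N - (x.2 + x.1.2 + x.1.1)) * msize q <= 3 * N * msize q)%N by rewrite leq_mul2r leq_subr orbT.
  move: a1 a2 a3 a4; rewrite /D /C; move: (_ * cd)%N (_ * c2)%N (_ * c1)%N ((3 * N - _) * _)%N => u1 u2 u3 u4.
  clear; nia.
have [A hA] := choice_ex QG.
have hS x l := shift_poly (proj1 (hA x) l).
have [B hB] := choice_ex (fun x => choice_ex (hS x)).
have cardlt : (#|{: I * ('I_(D + D).+1 * 'I_(D + D).+1)}| < #|{: 'I_N.+1 * 'I_N.+1 * 'I_N.+1}|)%N.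
  rewrite !card_prod !card_ord.
  have b1 : ((D + D).+1 <= K * N.+1)%N by rewrite /D /K; clear; nia.
  have b2 : ((D + D).+1 * (D + D).+1 <= (K * N.+1) * (K * N.+1))%N by apply: leq_mul.
  have b3 : (#|I| * ((D + D).+1 * (D + D).+1) <= #|I| * ((K * N.+1) * (K * N.+1)))%N by apply: leq_mul.
  apply: leq_ltn_trans b3 _.
  rewrite (_ : #|I| * _ = N * (N.+1 * N.+1))%N; last by rewrite {1}mulnACA /N !mulnA.
  have f n : (n * (n.+1 * n.+1) < n.+1 * n.+1 * n.+1)%N by clear; nia.
  exact: f.
have [c [[x0 cx0] hc]] := lin_dep (fun x (y : I * ('I_(D + D).+1 * 'I_(D + D).+1)) => B x y.1 y.2.1 y.2.2) cardlt.
(* The relation holds among the coordinates, that is, after multiplication by a nonzero polynomial,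
   which can be cancelled. *)
have rel : \sum_x spoly (iota (c x)) * G x = 0.
  have nz : spoly (q ^+ (3 * N) * ('X_i5 * 'X_i6) ^+ D) != 0.
    by rewrite spoly_eq0 mulf_neq0 ?expf_neq0 // mulf_neq0 // mX_neq0.
  apply: (ser_mulI nz); rewrite mulr_sumr.
  have -> : \sum_x spoly (q ^+ (3 * N) * ('X_i5 * 'X_i6) ^+ D) * (spoly (iota (c x)) * G x) =
    \sum_x \sum_l \sum_j \sum_k spoly (iota (c x * B x l j k)) * (spoly ('X_i5 ^+ j * 'X_i6 ^+ k) * e l).
    apply: eq_bigr => x _; rewrite mulrCA rmorphM [spoly (q ^+ _) * _]mulrC -mulrA (proj2 (hA x)).
    rewrite mulr_sumr mulr_sumr; apply: eq_bigr => l _.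
    have -> : spoly (('X_i5 * 'X_i6) ^+ D) * (spoly (A x l) * e l) =
      \sum_j \sum_k spoly (iota (B x l j k)) * (spoly ('X_i5 ^+ j * 'X_i6 ^+ k) * e l).
      rewrite mulrA -rmorphM [_ ^+ D * _]mulrC hB rmorph_sum mulr_suml; apply: eq_bigr => j _.
      rewrite rmorph_sum mulr_suml; apply: eq_bigr => k _.
      by rewrite [in LHS]rmorphM mulrA.
    rewrite mulr_sumr; apply: eq_bigr => j _; rewrite mulr_sumr; apply: eq_bigr => k _.
    by rewrite [iota (_ * _)]rmorphM [in RHS]rmorphM -mulrA.
  rewrite exchange_big big1 // => l _; rewrite exchange_big big1 // => j _.
  rewrite exchange_big big1 // => k _; rewrite -mulr_suml -!rmorph_sum.
  by have := hc (l, (j, k)); rewrite /= => ->; rewrite !rmorph0 mul0r.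
(* Since the second exponent is at most N, this number orders the pairs (a, b) lexicographically. *)
pose key (x : 'I_N.+1 * 'I_N.+1 * 'I_N.+1) := (x.1.1 * N.+1 + x.1.2)%N.
case: (arg_minnP (P := fun x => c x != 0) key cx0) => -[[a b] i] /= ci hmin.
pose kap : rat := (\prod_(l < a) (- a%:R + l%:R)) * \prod_(l < b) (- b%:R + l%:R).
have kap0 : kap != 0 by rewrite mulf_neq0 ?prod_sub_neq0.
exists N.+1, (fun i => c (a, b, i)); split; first by exists i.
have := congr1 (Ext (a + b) b) rel; rewrite raddf_sum raddf0 /=.
have -> : \sum_x Ext (a + b) b (spoly (iota (c x)) * G x) =
   \sum_(i < N.+1) spoly (c (a, b, i)) * (cst 5 kap * iter i d5 (Diag F)).
  rewrite (eq_bigr (fun x => if x.1 == (a, b) then spoly (c (x.1, x.2)) * (cst 5 kap * iter x.2 d5 (Diag F)) else 0)).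
    rewrite -(pair_big predT predT (fun y j => if y == (a, b) then spoly (c (y, j)) * (cst 5 kap * iter j d5 (Diag F)) else 0)) /=.
    rewrite (bigD1 (a, b)) //= [X in _ + X]big1 ?addr0 => [|y /negPf hy].
      by apply: eq_bigr => j _; rewrite eqxx.
    by rewrite big1 // => j _; rewrite hy.
  move=> [[a' b'] j] _ /=; rewrite Ext_iota /G /=.
  case: (eqVneq (c (a', b', j)) 0) => [->|cn].
    by rewrite rmorph0 mul0r mul0r; case: ifP.
  have := hmin _ cn; rewrite /key /= => hk.
  have la : ((a < a') || (a == a' :> nat) && (b <= b'))%N.
    have lb := ltn_ord b'; case: (ltngtP a a') => //= h; last by move: hk; rewrite h leq_add2l.
    exfalso; move: hk lb h (ltn_ord b); move: (nat_of_ord a) (nat_of_ord a') (nat_of_ord b) (nat_of_ord b') => u u' w w'.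
    by clear; nia.
  rewrite Ext_O // xpair_eqE -!val_eqE /=; case: ifP => _; last by rewrite mulr0.
  rewrite -/kap; congr (_ * (_ * _)).
  by elim: (nat_of_ord j) => //= n <-; rewrite -hv.
move=> h; apply: (@ser_mulI _ (cst 5 kap)).
  by rewrite /cst spoly_eq0 mpolyC_eq0.
rewrite mulr_sumr -[RHS]h; apply: eq_bigr => j _; exact: mulrCA.
Qed.

(** * Fields of rational functions and algebraic dependence *)

Definition ev k m (b : 'I_m -> series k) : {mpoly rat[m]} -> series k := mmap (cst k) b.
HB.instance Definition _ k m (b : 'I_m -> series k) := GRing.RMorphism.on (ev b).

Lemma evX k m (b : 'I_m -> series k) i : ev b 'X_i = b i.
Proof. by rewrite /ev mmapX mmap1U. Qed.
Lemma evC k m (b : 'I_m -> series k) c : ev b c%:MP = cst k c.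
Proof. by rewrite /ev mmapC. Qed.
Lemma evXm k m (b : 'I_m -> series k) (e : 'X_{1..m}) : ev b 'X_[e] = \prod_i b i ^+ e i.
Proof. by rewrite /ev mmapX. Qed.
Lemma evE k m (b : 'I_m -> series k) (P : {mpoly rat[m]}) :
  ev b P = \sum_(e <- msupp P) cst k P@_e * \prod_i b i ^+ e i.
Proof. by []. Qed.

Definition deriv k (D : series k -> series k) :=
  [/\ forall x y, D (x + y) = D x + D y, forall x y, D (x * y) = D x * y + x * D y
    & forall c, D (cst k c) = 0].

Section Rat.
Variables (k m : nat) (b : 'I_m -> series k).

(** Membership in the field Q(b_1, ..., b_m), expressed by a cross-multiplied equation inside the
    domain of power series. *)
Definition ratp (x : series k) := exists P Q : {mpoly rat[m]}, ev b Q != 0 /\ ev b Q * x = ev b P.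

Lemma ratp_ev P : ratp (ev b P).
Proof. by exists P, 1; rewrite rmorph1 oner_neq0 mul1r. Qed.
Lemma ratp_gen i : ratp (b i).
Proof. by rewrite -evX; apply: ratp_ev. Qed.
Lemma ratp_cst c : ratp (cst k c).
Proof. by rewrite -(evC b); apply: ratp_ev. Qed.
Lemma ratp0 : ratp 0. Proof. by rewrite -(rmorph0 (ev b)); apply: ratp_ev. Qed.
Lemma ratpD x y : ratp x -> ratp y -> ratp (x + y).
Proof.
move=> [P [Q [h1 h2]]] [P' [Q' [h1' h2']]]; exists (P * Q' + P' * Q), (Q * Q').
rewrite !rmorphD !rmorphM /= ser_mul_neq0 //; split=> //.
rewrite mulrDr -!h2 -h2'.
have E (R : comNzRingType) (a1 a2 a3 a4 : R) : a1 * a2 * a3 + a1 * a2 * a4 = a1 * a3 * a2 + a2 * a4 * a1 by ring.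
exact: (E (series k : comNzRingType)).
Qed.
Lemma ratpM x y : ratp x -> ratp y -> ratp (x * y).
Proof.
move=> [P [Q [h1 h2]]] [P' [Q' [h1' h2']]]; exists (P * P'), (Q * Q').
by rewrite !rmorphM /= ser_mul_neq0 //; split=> //; rewrite mulrACA h2 h2'.
Qed.
Lemma ratpN x : ratp x -> ratp (- x).
Proof.
by move=> h; rewrite -mulN1r; apply: ratpM => //; rewrite -(rmorph1 (cst k)) -rmorphN; apply: ratp_cst.
Qed.
Lemma ratpB x y : ratp x -> ratp y -> ratp (x - y).
Proof. by move=> h1 h2; apply: ratpD => //; apply: ratpN. Qed.
Lemma ratp_div c x : c != 0 -> ratp c -> ratp (c * x) -> ratp x.
Proof.
move=> c0 [P [Q [h1 h2]]] [P' [Q' [h1' h2']]]; exists (P' * Q), (Q' * P).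
have P0 : ev b P != 0 by rewrite -h2; apply: ser_mul_neq0.
rewrite !rmorphM /= ser_mul_neq0 //; split=> //.
rewrite -h2 -h2'.
have E (R : comNzRingType) (a1 a2 a3 a4 : R) : a1 * (a2 * a3) * a4 = a1 * (a3 * a4) * a2 by ring.
exact: (E (series k : comNzRingType)).
Qed.
Lemma ratp_sum I (r : seq I) (P : pred I) (F : I -> series k) :
  (forall i, P i -> ratp (F i)) -> ratp (\sum_(i <- r | P i) F i).
Proof. by move=> h; elim/big_rec: _ => [|i x Pi hx]; [exact: ratp0 | apply: ratpD => //; apply: h]. Qed.

Lemma ratp_deriv D : deriv D -> (forall i, ratp (D (b i))) -> forall x, ratp x -> ratp (D x).
Proof.
move=> [hD hM hC] hb.
have hev P : ratp (D (ev b P)).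
  elim/mpoly_ind': P => [c|i|P Q hP hQ|P Q hP hQ].
  - by rewrite evC hC; apply: ratp0.
  - by rewrite evX.
  - by rewrite (rmorphD (ev b)) hD; exact: (ratpD hP hQ).
  - by rewrite rmorphM /= hM; apply: ratpD; apply: ratpM => //; apply: ratp_ev.
move=> x hx; have [P [Q [h1 h2]]] := hx; apply: (ratp_div h1 (ratp_ev Q)).
have -> : ev b Q * D x = D (ev b P) - D (ev b Q) * x by rewrite -h2 hM addrAC subrr add0r.
by apply: ratpB => //; apply: ratpM.
Qed.

End Rat.

Lemma msize_exp k (p : {mpoly rat[k]}) n : (msize (p ^+ n) <= n * msize p + 1)%N.
Proof.
elim: n => [|n IH]; first by rewrite expr0 msize1.
by rewrite exprS; apply: leq_trans (msizeM_le _ _) _; rewrite mulSn -addnA leq_add2l.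
Qed.

Lemma msize_prod k n (F : 'I_n -> {mpoly rat[k]}) (D : 'I_n -> nat) :
  (forall i, msize (F i) <= D i)%N -> (msize (\prod_i F i) <= \sum_i D i + 1)%N.
Proof.
move=> h; elim/big_rec2: _ => [|i y p _ IH]; first by rewrite msize1.
by apply: leq_trans (msizeM_le _ _) _; rewrite -addnA leq_add.
Qed.

Lemma card_bmnm m B : (#|{: 'X_{1..m < B}}| <= B ^ m)%N.
Proof.
have <- : #|{ffun 'I_m -> 'I_B}| = (B ^ m)%N by rewrite card_ffun !card_ord.
have hb (x : 'X_{1..m < B}) i : (x i < B)%N.
  by apply: leq_ltn_trans (bmdeg x); rewrite mdegE (bigD1 i) //= leq_addr.
apply: (@leq_card _ _ (fun x : 'X_{1..m < B} => [ffun i => Ordinal (hb x i)])) => x y /ffunP e.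
by apply: val_inj; apply/mnmP => i; have := e i; rewrite !ffunE => /(congr1 val).
Qed.

(* There are more monomials of bounded degree in the f_i than polynomials of the corresponding
   degree in the m generators have coefficients. *)
Theorem alg_dep k m n (b : 'I_m -> series k) (f : 'I_n -> series k) : (m < n)%N ->
  (forall i, ratp b (f i)) -> exists P : {mpoly rat[n]}, P != 0 /\ ev f P = 0.
Proof.
move=> mn hf.
have [P0 hP0] := choice_ex hf; have [Q0 hQ0] := choice_ex hP0.
pose Q := \prod_i Q0 i; pose P i := P0 i * \prod_(j | j != i) Q0 j.
have QE i : Q = Q0 i * \prod_(j | j != i) Q0 j by rewrite /Q (bigD1 i).
have evQ : ev b Q != 0.
  rewrite /Q rmorph_prod /=; elim/big_rec: _ => [|i x _ hx]; first exact: oner_neq0.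
  by apply: ser_mul_neq0 => //; case: (hQ0 i).
have hPf i : ev b Q * f i = ev b (P i).
  by rewrite (QE i) /P !rmorphM /= mulrAC (proj2 (hQ0 i)).
pose c := (msize Q + \sum_i msize (P i) + 2)%N.
have hc i : (msize (P i) <= c)%N by rewrite /c (bigD1 i) //=; clear; lia.
have hcQ : (msize Q <= c)%N by rewrite /c; clear; lia.
(* The size B of the polynomials is at most K (D + 1), so they have at most K^m (D + 1)^m
   coefficients. As D = K^m, this is D (D + 1)^m, less than the number (D + 1)^n of exponent
   vectors. *)
pose K := (n * c.+1 + n * c.+1 + 5)%N; pose D := (K ^ m)%N.
pose wgt (e : {ffun 'I_n -> 'I_D.+1}) := (\sum_i e i)%N.
have hw e : (wgt e <= n * D)%N.
  by rewrite /wgt -[n in (n * _)%N]card_ord -sum_nat_const; apply: leq_sum => i _; rewrite -ltnS.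
(* The monomial of exponent e in the f_i, multiplied by the power n D of their common denominator,
   which is the same for all e. *)
pose T (e : {ffun 'I_n -> 'I_D.+1}) := Q ^+ (n * D - wgt e) * \prod_i P i ^+ e i.
pose B := (n * D * c + 1 + (n * (D * c + 1) + 1)).+1.
have hT e : (msize (T e) < B)%N.
  rewrite /B ltnS; apply: leq_trans (msizeM_le _ _) _; apply: leq_add.
    apply: leq_trans (msize_exp _ _) _; rewrite leq_add2r; apply: leq_mul => //; exact: leq_subr.
  apply: leq_trans (@msize_prod _ _ _ (fun _ => (D * c + 1)%N) _) _ => [i|].
    apply: leq_trans (msize_exp _ _) _; rewrite leq_add2r; apply: leq_mul => //.
    by rewrite -ltnS.
  by rewrite sum_nat_const card_ord.
have cardlt : (#|{: 'X_{1..m < B}}| < #|{ffun 'I_n -> 'I_D.+1}|)%N.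
  rewrite card_ffun !card_ord; apply: leq_ltn_trans (card_bmnm _ _) _.
  have hB : (B <= K * D.+1)%N by rewrite /B /K; clear; nia.
  have h1 : (B ^ m <= (K * D.+1) ^ m)%N by case: (m) => // m'; rewrite leq_exp2r.
  apply: leq_ltn_trans h1 _; rewrite expnMn -/D.
  apply: (@leq_trans (D.+1 ^ m.+1)%N); last by apply: leq_pexp2l.
  by rewrite expnS ltn_pmul2r ?expn_gt0.
have [a [[e0 ae0] ha]] := lin_dep (fun e (mu : 'X_{1..m < B}) => (T e)@_mu) cardlt.
have relT : \sum_e a e *: T e = 0.
  apply/mpolyP => mu; rewrite raddf_sum mcoeff0 /=.
  case: (ltnP (mdeg mu) B) => hmu.
    by rewrite -[RHS](ha (BMultinom hmu)); apply: eq_bigr => e _; rewrite mcoeffZ.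
  rewrite big1 // => e _; rewrite mcoeffZ memN_msupp_eq0 ?mulr0 //.
  by apply: msize_mdeg_ge; apply: leq_trans (ltnW (hT e)) hmu.
pose mon (e : {ffun 'I_n -> 'I_D.+1}) : 'X_{1..n} := [multinom (e i : nat) | i < n].
exists (\sum_e a e *: 'X_[mon e]); split.
  apply/eqP => /mpolyP /(_ (mon e0)); rewrite raddf_sum mcoeff0 /= (bigD1 e0) //= big1 => [|e ne].
    by rewrite mcoeffZ mcoeffX eqxx mulr1 addr0; apply/eqP.
  rewrite mcoeffZ mcoeffX; case: eqP => [ee|_]; last by rewrite mulr0.
  case/eqP: ne; apply/ffunP => i; apply: val_inj.
  by have := congr1 (fun mm : 'X_{1..n} => mm i) ee; rewrite !mnmE.
have nz : ev b Q ^+ (n * D) != 0.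
  by elim: (n * D)%N => [|j IH]; rewrite ?expr0 ?oner_neq0 // exprS ser_mul_neq0.
apply: (ser_mulI nz); rewrite rmorph_sum mulr_sumr /=.
have := congr1 (ev b) relT; rewrite rmorph_sum rmorph0 /= => h0; rewrite -[RHS]h0.
apply: eq_bigr => e _; rewrite -!mul_mpolyC !rmorphM /= !evC mulrCA; congr (_ * _).
have -> : ev b (\prod_i P i ^+ e i) = \prod_i (ev b Q ^+ e i * f i ^+ e i).
  rewrite (rmorph_prod (ev b)); apply: eq_bigr => i _; by rewrite rmorphXn /= -hPf exprMn.
rewrite big_split /= evXm prodrXr rmorphXn /= mulrA -exprD subnK //; congr (_ * _).
by apply: eq_bigr => i _; rewrite mnmE.
Qed.

(** * A finitely generated field closed under commuting derivations *)

Section Closure.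
Variables (k n : nat) (D : 'I_n -> series k -> series k).
Hypothesis DC : forall i j x, D i (D j x) = D j (D i x).
Hypothesis Dd : forall i, deriv (D i).
Hypothesis DX : forall i l, exists p, D i (X l) = spoly p.

Lemma deriv0 i : D i 0 = 0.
Proof. by have [_ _ /(_ 0)] := Dd i; rewrite rmorph0. Qed.
Lemma iterD_add i m x y : iter m (D i) (x + y) = iter m (D i) x + iter m (D i) y.
Proof. by have [h _ _] := Dd i; elim: m => //= m ->; rewrite h. Qed.
Lemma iterD0 i m : iter m (D i) 0 = 0.
Proof. by elim: m => //= m ->; rewrite deriv0. Qed.
Lemma dmonD e x y : dmon D e (x + y) = dmon D e x + dmon D e y.
Proof. by rewrite /dmon; elim: (enum 'I_n) => //= i l ->; rewrite iterD_add. Qed.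
Lemma dmon_0 e : dmon D e 0 = 0.
Proof. by rewrite /dmon; elim: (enum 'I_n) => //= i l ->; rewrite iterD0. Qed.
Lemma dmon_sum e (I : Type) (r : seq I) (P : pred I) F :
  dmon D e (\sum_(i <- r | P i) F i) = \sum_(i <- r | P i) dmon D e (F i).
Proof. by elim/big_rec2: _ => [|i y x _ <-]; rewrite ?dmon_0 // dmonD. Qed.

Lemma D_spoly i p : exists q, D i (spoly p) = spoly q.
Proof.
have [hD hM hC] := Dd i; elim/mpoly_ind': p => [c|l|p q [p' hp] [q' hq]|p q [p' hp] [q' hq]].
- by exists 0; rewrite [D _ _]hC rmorph0.
- exact: DX.
- by exists (p' + q'); rewrite !rmorphD hD hp hq.
- by exists (p' * q + p * q'); rewrite rmorphM hM hp hq [in RHS]rmorphD !rmorphM.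
Qed.

Section Leibniz.
Variables (m : nat) (b : 'I_m -> series k).
Hypothesis ratX : forall p, ratp b (spoly p).

(** By Leibniz' rule the difference involves only derivatives of [y] of order below that of [e],
    with polynomial coefficients. *)
Lemma dmon_leibniz e c y : (forall e', (mdeg e' < mdeg e)%N -> ratp b (dmon D e' y)) ->
  ratp b (dmon D e (spoly c * y) - spoly c * dmon D e y).
Proof.
elim/mnm_ind: e c y => [|e i IH] c y h; first by rewrite !dmon0 subrr; exact: ratp0.
have [_ hM _] := Dd i; have [c' hc'] := D_spoly i c.
have lt e' : (mdeg e' < mdeg e)%N -> ratp b (dmon D e' y).
  by move=> he; apply: h; rewrite mdegD; apply: leq_trans he (leq_addr _ _).
rewrite -!dmonS // !dmonC // hM dmonD hc'.
have -> : dmon D e (spoly c' * y) + dmon D e (spoly c * D i y) - spoly c * dmon D e (D i y) =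
  (dmon D e (spoly c' * y) - spoly c' * dmon D e y) + spoly c' * dmon D e y +
  (dmon D e (spoly c * D i y) - spoly c * dmon D e (D i y)) by rewrite subrK addrA.
apply: ratpD; first apply: ratpD.
- exact: IH.
- by apply: ratpM => //; apply: h; rewrite mdegD mdeg1 addn1.
apply: IH => e' he'; rewrite -dmonC // dmonS //; apply: h.
by rewrite !mdegD !mdeg1 !addn1 ltnS.
Qed.
End Leibniz.

(* A mixed derivative of high order in direction j is, by the equation in that direction, a
   rational combination of derivatives of smaller total order. *)
Theorem closure (I : finType) (Phi : I -> series k) :
  (forall s j, exists N (c : 'I_N -> {mpoly rat[k]}), (exists i, c i != 0) /\
     \sum_i spoly (c i) * iter i (D j) (Phi s) = 0) ->
  exists m (b : 'I_m -> series k),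
    [/\ forall p, ratp b (spoly p), forall s, ratp b (Phi s)
      & forall j x, ratp b x -> ratp b (D j x)].
Proof.
move=> hPhi.
have h1 s j : exists (x : nat * (nat -> {mpoly rat[k]})), x.2 x.1 != 0 /\
    \sum_(i < x.1.+1) spoly (x.2 i) * iter i (D j) (Phi s) = 0.
  have [N [c [[i ci] hc]]] := hPhi s j.
  (* With coefficients extended by zero, the largest index carrying a nonzero one can be chosen; the
     equation is then cut off after its leading term. *)
  pose c' (l : nat) : {mpoly rat[k]} := if insub l is Some l' then c l' else 0.
  have c'E (l : 'I_N) : c' l = c l by rewrite /c' valK.
  have ex : exists l, c' l != 0 by exists i; rewrite c'E.
  have ub l : c' l != 0 -> (l <= N)%N.
    by rewrite /c'; case: insubP => [u hu _ _|_]; [exact: ltnW | rewrite eqxx].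
  case: (ex_maxnP ex ub) => L hL max; exists (L, c'); split=> //=; rewrite -[RHS]hc.
  have LN : (L < N)%N by move: hL; rewrite /c'; case: insubP => // _ /eqP.
  rewrite (big_ord_widen N (fun l => spoly (c' l) * iter l (D j) (Phi s)) LN) big_mkcond /=.
  apply: eq_bigr => l _; rewrite c'E; case: ltnP => // hl.
  have [->|cl] := eqVneq (c l) 0; first by rewrite rmorph0 mul0r.
  by have := max l; rewrite c'E cl leqNgt hl => /(_ isT).
have [x0 hx0] := choice_ex (fun s => choice_ex (h1 s)).
pose L s j := (x0 s j).1; pose c s j := (x0 s j).2.
(* One bound above the orders of all the equations: a derivative outside the box of exponents below
   B can be reduced in some direction. *)
pose B := (\sum_s \sum_j L s j).+1.
have LB s j : (L s j < B)%N by rewrite /B ltnS (bigD1 s) //= (bigD1 j) //= -addnA leq_addr.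
pose J : finType := ('I_k + I * {ffun 'I_n -> 'I_B})%type.
pose tom (e : {ffun 'I_n -> 'I_B}) : 'X_{1..n} := [multinom (e i : nat) | i < n].
pose b0 (x : J) := match x with inl i => X i | inr y => dmon D (tom y.2) (Phi y.1) end.
pose b (i : 'I_#|J|) := b0 (enum_val i).
have gen x : ratp b (b0 x) by rewrite -[x]enum_rankK; apply: ratp_gen.
have ratX p : ratp b (spoly p).
  elim/mpoly_ind': p => [a|i|p q hp hq|p q hp hq].
  - exact: ratp_cst.
  - exact: (gen (inl i)).
  - by rewrite rmorphD; exact: (ratpD hp hq).
  - by rewrite rmorphM; exact: (ratpM hp hq).
have rat_dm s e : ratp b (dmon D e (Phi s)).
  move: {2}(mdeg e).+1 (ltnSn (mdeg e)) => d; elim: d e => // d IH e; rewrite ltnS => he.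
  case: (boolP [forall j, (e j < B)%N]) => [/forallP h|].
    have := gen (inr (s, [ffun j => Ordinal (h j)])); rewrite /b0 /=.
    by rewrite (_ : tom _ = e) //; apply/mnmP => j; rewrite mnmE ffunE.
  rewrite negb_forall => /existsP [j]; rewrite -leqNgt => hj.
  have [cL rel] := hx0 s j; rewrite -/(L s j) -/(c s j) in cL rel.
  have le : (U_(j) *+ L s j <= e)%MM.
    apply/mnm_lepP => i; rewrite mulmnE mnm1E; case: eqP => [<-|_]; last by rewrite mul0n.
    by rewrite mul1n; apply: leq_trans (ltnW (LB s j)) hj.
  move: (submK le); set e' := (e - _)%MM => ee.
  have de : (mdeg e' + L s j = mdeg e)%N by rewrite -ee mdegD mdegMn mdeg1 mul1n.
  have dm_i i e1 : dmon D e1 (iter i (D j) (Phi s)) = dmon D (e1 + U_(j) *+ i)%MM (Phi s) by apply: dmon_iter.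
  have deg_i i e1 : mdeg (e1 + U_(j) *+ i)%MM = (mdeg e1 + i)%N by rewrite mdegD mdegMn mdeg1 mul1n.
  have dif (i : 'I_(L s j).+1) : ratp b (dmon D e' (spoly (c s j i) * iter i (D j) (Phi s))
        - spoly (c s j i) * dmon D e' (iter i (D j) (Phi s))).
    apply: dmon_leibniz => // e1 he1; rewrite dm_i; apply: IH; rewrite deg_i.
    apply: leq_trans he; rewrite -de -addnS; have := ltn_ord i; move: he1; clear; lia.
  (* The derivative e' of the equation in direction j: modulo rational terms, only the leading
     coefficient times the wanted derivative survives. *)
  have := @ratp_sum _ _ b _ (index_enum 'I_(L s j).+1) predT _ (fun i _ => dif i).
  rewrite sumrB -dmon_sum rel dmon_0 sub0r => /ratpN; rewrite opprK big_ord_recr /= => hr.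
  apply: (@ratp_div _ _ b (spoly (c s j (L s j)))) => //; first by rewrite spoly_eq0.
  rewrite -ee -dm_i; set t := _ * _ in hr *; set S := \sum_(i < _) _ in hr *.
  rewrite -[t](addKr S) addrC; apply: ratpB => //.
  apply: ratp_sum => i _; apply: ratpM => //=; rewrite dm_i; apply: IH; rewrite deg_i.
  by apply: leq_trans he; rewrite -de; have := ltn_ord i; clear; lia.
exists #|J|, b; split=> // [s|j x hx]; first by rewrite -(dmon0 D (Phi s)).
apply: ratp_deriv hx => // i; rewrite /b; case: (enum_val i) => [l|[s e]] /=.
  by have [p ->] := DX j l.
by rewrite dmonS.
Qed.

End Closure.

(** * The generating function as a specialized diagonal *)

Lemma ee_rmorph (A B : comNzRingType) (f : {rmorphism A -> B}) R S m k :
  f (ee R S m k) = ee (f R) (f S) m k.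
Proof.
elim: m k => [|m IH] [|k] /=; rewrite ?rmorph_nat //.
  by rewrite rmorphD !rmorphM /= !IH rmorph_nat.
by rewrite !(rmorphD, rmorphM) /= !IH.
Qed.

Lemma trinomial_exp (A : comNzRingType) (a b S : A) m K : (m <= K)%N ->
  (a + S + b) ^+ m = \sum_(k < K.+1) ee (a * b) S m k * (if k == 0%N :> nat then 1 else a ^+ k + b ^+ k).
Proof.
set R := a * b => hK.
pose T c m := \sum_(k < K) ee R S m k.+1 * c ^+ k.+1.
have -> : \sum_(k < K.+1) ee R S m k * (if k == 0%N :> nat then 1 else a ^+ k + b ^+ k) =
    ee R S m 0 + T a m + T b m.
  rewrite big_ord_recl mulr1 -addrA -big_split; congr (_ + _); apply: eq_bigr => k _.
  by rewrite /= -mulrDr.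
(* Used for (a, b) and for (b, a): multiplication by [c] raises the exponent, multiplication by [d]
   lowers it at the price of a factor R. *)
have step c d n : (n < K)%N -> c * d = R ->
    T c n * (c + S + d) = T c n.+1 - ee R S n 0 * c + R * ee R S n 1.
  move=> hn cd.
  have sh (F : nat -> A) : \sum_(k < K) F k.+1 = \sum_(k < K) F k + F K - F 0%N.
    have <- : \sum_(k < K.+1) F k = \sum_(k < K) F k + F K by rewrite big_ord_recr.
    by rewrite big_ord_recl [RHS]addrC addKr; apply: eq_bigr.
  have h1 : T c n * c = \sum_(k < K) ee R S n k * c ^+ k.+1 - ee R S n 0 * c.
    rewrite /T mulr_suml.
    under eq_bigr => k _ do rewrite -mulrA -exprSr.
    by rewrite (sh (fun k => ee R S n k * c ^+ k.+1)) expr1 (ee_gt _ _ hn) mul0r addr0.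
  have h2 : T c n * d = R * ee R S n 1 + \sum_(k < K) R * ee R S n k.+2 * c ^+ k.+1.
    rewrite (sh (fun k => R * ee R S n k.+1 * c ^+ k)) (ee_gt _ _ (leqW hn)) mulr0 mul0r.
    rewrite addr0 expr0 mulr1 addrC subrK /T mulr_suml; apply: eq_bigr => k _.
    by rewrite exprS -cd; ring.
  have -> : T c n.+1 = \sum_(k < K) ee R S n k * c ^+ k.+1 + S * T c n + \sum_(k < K) R * ee R S n k.+2 * c ^+ k.+1.
    rewrite /T mulr_sumr -!big_split; apply: eq_bigr => k _ /=; ring.
  rewrite !mulrDr h1 h2; ring.
elim: m hK => [|m IH] hK.
  by rewrite /T !big1 ?addr0 // => k _; rewrite /= mul0r.
rewrite exprSr IH ?(ltnW hK) // !mulrDl step //.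
have -> : a + S + b = b + S + a by ring.
rewrite step //; last by rewrite mulrC.
by rewrite /=; ring.
Qed.

Lemma comp_id k (f : series k) : comp (@X k) f = f.
Proof.
have h p : comp (@X k) (spoly p) = spoly p.
  elim/mpoly_ind': p => [c|i|p q hp hq|p q hp hq].
  - exact: comp_cst.
  - by rewrite comp_X //; apply: inF_X.
  - by rewrite !rmorphD /= hp hq.
  - by rewrite !rmorphM /= hp hq.
apply: inF_eq => N; rewrite -(subrKA (spoly (trunc N f))); apply: inFD.
  rewrite -h -rmorphB; apply: comp_inF => m hm.
  by rewrite serBE /spoly mcoeff_trunc hm subrr.
by move=> m hm; rewrite serBE /spoly mcoeff_trunc hm subrr.
Qed.

Lemma comp_eqF k j (a b : 'I_k -> series j) N f :
  (forall i, inF 1 (a i)) -> (forall i, inF 1 (b i)) -> (forall i, eqF N (a i) (b i)) ->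
  eqF N (comp a f) (comp b f).
Proof.
move=> a1 b1 hab.
have h p : eqF N (comp a (spoly p)) (comp b (spoly p)).
  elim/mpoly_ind': p => [c|i|p q hp hq|p q hp hq].
  - by rewrite !comp_cst; apply: eqF_refl.
  - by rewrite !comp_X.
  - by rewrite !rmorphD /=; apply: eqFD.
  - by rewrite !rmorphM /=; apply: eqFM.
have d (c : 'I_k -> series j) : eqF N (comp c f) (comp c (spoly (trunc N f))).
  rewrite /eqF -rmorphB; apply: comp_inF => m hm.
  by rewrite serBE /spoly mcoeff_trunc hm subrr.
exact: eqF_trans (d a) (eqF_trans (h _) (eqF_sym (d b))).
Qed.

(** The geometric series in one variable, composed with f. *)
Lemma ser_inv k (f : series k) : inF 1 f -> exists g, (1 - f) * g = 1.
Proof.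
move=> hf; pose g : series 1 := fun=> 1.
have hg : (1 - X ord0) * g = 1.
  apply: serP => m; rewrite mulrBl mul1r serBE monoM ser1E /g lep1mP -mdeg_eq0 mdegE big_ord1.
  by case: (m ord0); rewrite ?subr0 ?subrr.
exists (comp (fun=> f) g).
have -> : 1 - f = comp (fun=> f) (1 - X (ord0 : 'I_1)) by rewrite rmorphB rmorph1 /= comp_X.
by rewrite -rmorphM hg rmorph1.
Qed.

Definition iS : 'I_5 := @Ordinal 5 3 isT.

Lemma mdeg_mk7 m a b c : (mdeg (mk7 m a b c) + m iR = mdeg m + a + b + c)%N.
Proof.
have E5 (F : 'I_5 -> nat) : (\sum_i F i = F (inord 0) + F (inord 1) + F (inord 2) + F (inord 3) + F iR)%N.
  rewrite !big_ord_recl big_ord0 addn0 !addnA.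
  by congr (F _ + F _ + F _ + F _ + F _)%N; apply: val_inj; rewrite /= ?inordK.
have E7 (F : 'I_7 -> nat) : (\sum_i F i = F (low (inord 0)) + F (low (inord 1)) + F (low (inord 2)) + F (low (inord 3)) + F i4 + F i5 + F i6)%N.
  rewrite !big_ord_recl big_ord0 addn0 !addnA.
  by congr (F _ + F _ + F _ + F _ + F _ + F _ + F _)%N; apply: val_inj; rewrite /= ?inordK.
rewrite !mdegE E5 E7 !mk7_low ?inordK // mk7_4 mk7_5 mk7_6; clear; lia.
Qed.

(** The diagonal turns alpha p y, of degree 3, into R, of degree 1, so an order shrinks at most by
    the factor 3. *)
Lemma Diag_inF N F : inF (3 * N) F -> inF N (Diag F).
Proof.
move=> h m hm; rewrite /Diag /Ext !addn0; apply: h.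
have le : (m iR <= mdeg m)%N by rewrite mdegE (bigD1 iR) //= leq_addr.
by have := mdeg_mk7 m (m iR) (m iR) (m iR); move: hm le; clear; lia.
Qed.

(* 1 / (1 - p) *)
Definition kap : series 7 := fun m => (m == U_(i5) *+ m i5)%MM%:R.

Lemma kapE : spoly (1 - 'X_i5) * kap = 1.
Proof.
apply: serP => m; rewrite rmorphB rmorph1 mulrBl mul1r serBE monoM lep1mP ser1E /kap.
have E (x y : 'X_{1..7}) : (x == y) = [forall i, x i == y i].
  by apply/eqP/forallP => [-> //|h]; apply/mnmP => i; apply/eqP.
have [h|h] := eqVneq (m i5) 0%N; first by rewrite /= h mulm0n subr0.
suff -> : ((m - U_(i5))%MM == U_(i5) *+ (m - U_(i5))%MM i5)%MM = (m == U_(i5) *+ m i5)%MM.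
  rewrite /= subrr; case: eqP => // e; by rewrite e mnm0E in h.
rewrite !E; apply: eq_forallb => i; rewrite !mulmnE !mnmBE !mnm1E eqxx.
by case: (eqVneq i5 i) => [<-|_]; rewrite ?mul0n ?subn0 // !mul1n !eqxx.
Qed.

(** The factor 1 / (1 - p) supplies any missing power of p. The condition b = a of the plain
    diagonal is thereby relaxed to b <= a. *)
Lemma Diag_kap a b c :
  Diag (kap * spoly ('X_i4 ^+ a * 'X_i5 ^+ b * 'X_i6 ^+ c)) =
  ((a == c) && (b <= a)%N)%:R * X iR ^+ a.
Proof.
have -> : 'X_i4 ^+ a * 'X_i5 ^+ b * 'X_i6 ^+ c = 'X_[U_(i4) *+ a + U_(i5) *+ b + U_(i6) *+ c] :> {mpoly rat[7]}.
  by rewrite !mpolyXD !mpolyXn.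
rewrite /X -rmorphXn mpolyXn -(rmorph_nat (cst 5)); apply: serP => m.
rewrite cstM /= spolyX [RHS]mulrC [kap * _]mulrC {1}/Diag {1}/Ext !addn0 monoM /kap.
set e := (U_(i4) *+ a + _ + _)%MM; set M := mk7 _ _ _ _.
have e4 : e i4 = a by rewrite !mnmDE !mulmnE !mnm1E /= !mul1n !mul0n !addn0.
have e5 : e i5 = b by rewrite !mnmDE !mulmnE !mnm1E /= !mul1n !mul0n !addn0.
have e6 : e i6 = c by rewrite !mnmDE !mulmnE !mnm1E /= !mul1n !mul0n.
have eL (i : 'I_5) : (i < 4)%N -> e (low i) = 0%N.
  move=> hi; have [n4 n5 n6 _] := low_neq hi.
  by rewrite !mnmDE !mulmnE !mnm1E ![_ == low i]eq_sym (negPf n4) (negPf n5) (negPf n6).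
have key : ((e <= M)%MM && (M - e == U_(i5) *+ (M - e)%MM i5)%MM) =
    (m == U_(iR) *+ a)%MM && ((a == c) && (b <= a)%N).
  apply/andP/andP => [[/mnm_lepP le /eqP/mnmP he]|[/eqP/mnmP hm /andP [/eqP ac ba]]].
    have := le i4; have := le i5; have := le i6; rewrite e4 e5 e6 mk7_4 mk7_5 mk7_6 => l6 l5 l4.
    have := he i4; have := he i6; rewrite !mnmBE !mulmnE !mnm1E mk7_4 mk7_6 e4 e6 /= mul0n => h6 h4.
    have ra : m iR = a by move: l4 h4; clear; lia.
    split; last by move: l6 l5 h6 ra; clear; move=> l6 l5 h6 ra; apply/andP; split; lia.
    apply/eqP/mnmP; apply: case5 => [i hi|]; last by rewrite mulmnE mnm1E eqxx mul1n.
    have [_ n5 _ nR] := low_neq hi; have := he (low i).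
    rewrite mulmnE !mnmBE mnm1E eq_sym (negPf n5) mul0n mk7_low // eL // subn0 => ->.
    by rewrite mulmnE mnm1E eq_sym (negPf nR) mul0n.
  have ra : m iR = a by rewrite hm mulmnE mnm1E eqxx mul1n.
  split.
    apply/mnm_lepP; apply: case7 => [i hi|||]; rewrite ?eL ?e4 ?e5 ?e6 ?mk7_4 ?mk7_5 ?mk7_6 ?ra ?ac //.
    by rewrite -ac.
  apply/eqP/mnmP; apply: case7 => [i hi|||]; rewrite mnmBE mulmnE mnm1E.
  - have [_ n5 _ nR] := low_neq hi; rewrite eq_sym (negPf n5) mul0n mk7_low // hm mulmnE mnm1E.
    by rewrite eq_sym (negPf nR) mul0n.
  - by rewrite mk7_4 e4 ra subnn.
  - by rewrite mul1n.
  - by rewrite mk7_6 e6 ra ac subnn.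
by rewrite -natrM mulnb -key; case: ifP.
Qed.

Lemma DiagB F G : Diag (F - G) = Diag F - Diag G. Proof. by []. Qed.
Lemma DiagD F G : Diag (F + G) = Diag F + Diag G. Proof. by []. Qed.
Lemma Diag_sum I (r : seq I) (P : pred I) F :
  Diag (\sum_(i <- r | P i) F i) = \sum_(i <- r | P i) Diag (F i).
Proof. by elim/big_rec2: _ => [//|i y x _ <-]; rewrite DiagD. Qed.
Lemma Diag_iota c F : Diag (spoly (iota c) * F) = spoly c * Diag F.
Proof. exact: Ext_iota. Qed.

Definition Dk (P : {mpoly rat[7]}) := Diag (kap * spoly P).
Lemma DkD P Q : Dk (P + Q) = Dk P + Dk Q. Proof. by rewrite /Dk rmorphD mulrDr. Qed.
Lemma DkB P Q : Dk (P - Q) = Dk P - Dk Q. Proof. by rewrite /Dk rmorphB mulrBr. Qed.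
Lemma Dk_sum I (r : seq I) (P : pred I) F :
  Dk (\sum_(i <- r | P i) F i) = \sum_(i <- r | P i) Dk (F i).
Proof. by rewrite /Dk rmorph_sum mulr_sumr Diag_sum. Qed.
Lemma Dk_iota c P : Dk (iota c * P) = spoly c * Dk P.
Proof. by rewrite /Dk rmorphM mulrCA Diag_iota. Qed.
Lemma Dk_mono a b c : Dk ('X_i4 ^+ a * 'X_i5 ^+ b * 'X_i6 ^+ c) = ((a == c) && (b <= a)%N)%:R * X iR ^+ a.
Proof. exact: Diag_kap. Qed.

Lemma Diag_Dk P : Diag (spoly P) = Dk P - Dk ('X_i5 * P).
Proof.
rewrite -DkB /Dk -{2}[P]mul1r -mulrBl rmorphM mulrCA mulrA kapE mul1r //.
Qed.
Lemma Diag_mono a b c :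
  Diag (spoly ('X_i4 ^+ a * 'X_i5 ^+ b * 'X_i6 ^+ c)) = ((a == b) && (a == c))%:R * X iR ^+ a.
Proof.
rewrite Diag_Dk.
have -> : 'X_i5 * ('X_i4 ^+ a * 'X_i5 ^+ b * 'X_i6 ^+ c) = 'X_i4 ^+ a * 'X_i5 ^+ b.+1 * 'X_i6 ^+ c :> {mpoly rat[7]}.
  by rewrite exprS; ring.
rewrite !Dk_mono -mulrBl; congr (_ * _).
case: (a == c); rewrite ?andbF ?subrr // andbT eqn_leq /=.
by case: (ltngtP a b); rewrite ?subrr ?subr0.
Qed.

Definition v1 : {mpoly rat[7]} := 'X_i4 + 'X_(low iS) + 'X_i5 * 'X_i6.
Definition v2 : {mpoly rat[7]} := 'X_i4 * 'X_i5 + 'X_(low iS) + 'X_i6.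
Definition Ee m k : {mpoly rat[5]} := ee 'X_iR 'X_iS m k.

Lemma iota_Ee m k : iota (Ee m k) = ee ('X_i4 * 'X_i5 * 'X_i6) 'X_(low iS) m k.
Proof. by rewrite /Ee ee_rmorph /= /iota !psubX. Qed.

Lemma v1_exp m K : (m <= K)%N -> v1 ^+ m = \sum_(k < K.+1) iota (Ee m k) *
  (if k == 0%N :> nat then 1 else 'X_i4 ^+ k + ('X_i5 * 'X_i6) ^+ k).
Proof.
by move=> h; rewrite /v1 (trinomial_exp _ _ _ h) mulrA; apply: eq_bigr => k _; rewrite iota_Ee.
Qed.
Lemma v2_exp m K : (m <= K)%N -> v2 ^+ m = \sum_(k < K.+1) iota (Ee m k) *
  (if k == 0%N :> nat then 1 else ('X_i4 * 'X_i5) ^+ k + 'X_i6 ^+ k).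
Proof.
by move=> h; rewrite /v2 (trinomial_exp _ _ _ h); apply: eq_bigr => k _; rewrite iota_Ee.
Qed.

Lemma Diag_v1 m : Diag (spoly (v1 ^+ m)) = spoly (Ee m 0).
Proof.
rewrite (v1_exp (leqnn m)) rmorph_sum Diag_sum big_ord_recl big1 ?addr0 => [|k _].
  rewrite mulr1 -[iota _]mulr1 rmorphM Diag_iota -[RHS]mulr1; congr (_ * _).
  by have := Diag_mono 0 0 0; rewrite !expr0 !mulr1 => ->.
rewrite rmorphM Diag_iota /= exprMn rmorphD DiagD.
have := Diag_mono k.+1 0 0; rewrite !expr0 !mulr1 => ->.
have := Diag_mono 0 k.+1 k.+1; rewrite !expr0 mul1r => ->.
by rewrite !mul0r addr0 mulr0.
Qed.

Lemma Diag_v1' m : Diag (spoly ('X_i5 * 'X_i6 * v1 ^+ m)) = X iR * spoly (Ee m 1).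
Proof.
rewrite (v1_exp (leqnSn m)) mulr_sumr rmorph_sum Diag_sum /= big_ord_recl big_ord_recl big1 ?addr0 => [|k _].
  rewrite ![_ * (iota _ * _)]mulrCA ![spoly (iota _ * _)]rmorphM !Diag_iota /=.
  rewrite mulr1 !expr1 mulrDr rmorphD DiagD.
  have -> : 'X_i5 * 'X_i6 = 'X_i4 ^+ 0 * 'X_i5 ^+ 1 * 'X_i6 ^+ 1 :> {mpoly rat[7]} by rewrite mul1r.
  have -> : 'X_i4 ^+ 0 * 'X_i5 ^+ 1 * 'X_i6 ^+ 1 * 'X_i4 = 'X_i4 ^+ 1 * 'X_i5 ^+ 1 * 'X_i6 ^+ 1 :> {mpoly rat[7]} by rewrite mul1r !expr1; ring.
  have -> : 'X_i4 ^+ 0 * 'X_i5 ^+ 1 * 'X_i6 ^+ 1 * ('X_i4 ^+ 0 * 'X_i5 ^+ 1 * 'X_i6 ^+ 1) = 'X_i4 ^+ 0 * 'X_i5 ^+ 2 * 'X_i6 ^+ 2 :> {mpoly rat[7]} by rewrite !mul1r !expr1; ring.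
  by rewrite !Diag_mono /= !mul0r mulr0 add0r addr0 mul1r expr1 mulrC.
rewrite [_ * (iota _ * _)]mulrCA rmorphM Diag_iota /= /bump /= !add1n mulrDr rmorphD DiagD.
have -> : 'X_i5 * 'X_i6 * 'X_i4 ^+ k.+2 = 'X_i4 ^+ k.+2 * 'X_i5 ^+ 1 * 'X_i6 ^+ 1 :> {mpoly rat[7]} by rewrite !expr1; ring.
have -> : 'X_i5 * 'X_i6 * ('X_i5 * 'X_i6) ^+ k.+2 = 'X_i4 ^+ 0 * 'X_i5 ^+ k.+3 * 'X_i6 ^+ k.+3 :> {mpoly rat[7]}.
  by rewrite -exprS exprMn mul1r.
by rewrite !Diag_mono /= !mul0r addr0 mulr0.
Qed.

(** * The kernel [bt] as a diagonal *)

Section Pairing.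
Variables (A : comNzRingType) (R S : A).
(** The coefficient of [ee R S m k * ee R S n l] in the kernel [bt R S m n]. *)
Definition Gk (k l : nat) : A :=
  if k is k'.+1 then R ^+ k * ((l == k')%:R - R * (l == k'.+2)%:R) else 0.

Lemma bt_Gk m n K : (m <= K.+1)%N -> (n < K.+2)%N ->
  \sum_(k < K.+2) \sum_(l < K.+2) ee R S m k * ee R S n l * Gk k l = bt R S m n.
Proof.
move=> hm hn; rewrite big_ord_recl big1 ?add0r => [|l _]; last by rewrite mulr0.
rewrite (btE _ _ _ hm); apply: eq_bigr => k _ /=.
have sel j : \sum_(l < K.+2) ee R S n l * (l == j :> nat)%:R = ee R S n j.
  case: (ltnP j K.+2) => hj.
    rewrite (bigD1 (Ordinal hj)) //= eqxx mulr1 big1 ?addr0 // => i.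
    by rewrite -val_eqE /= => /negPf ->; rewrite mulr0.
  rewrite ee_gt ?big1 // => [i _|]; last exact: leq_trans hn hj.
  by case: eqP => [e|_]; [rewrite -e leqNgt ltn_ord in hj | rewrite mulr0].
rewrite /MM -(sel k) -(sel k.+2) mulr_sumr -sumrB mulr_sumr; apply: eq_bigr => l _.
by ring.
Qed.
End Pairing.

Section Expand.
Variables (A : comNzRingType) (a p y : A).
Let m i j l := a ^+ i * p ^+ j * y ^+ l.
Lemma kernel00 : p * (y - a * p) * 1 * 1 = m 0 1 1 - m 1 2 0.
Proof. by rewrite /m; ring. Qed.
Lemma kernel0 L : p * (y - a * p) * 1 * ((a * p) ^+ L + y ^+ L) =
  (m L L.+1 1 + m 0 1 L.+1) - (m L.+1 L.+2 0 + m 1 2 L).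
Proof. by rewrite /m !exprMn !exprS; ring. Qed.
Lemma kernel1 K : p * (y - a * p) * (a ^+ K + (p * y) ^+ K) * 1 =
  (m K 1 1 + m 0 K.+1 K.+1) - (m K.+1 2 0 + m 1 K.+2 K).
Proof. by rewrite /m !exprMn !exprS; ring. Qed.
Lemma kernel2 K L : p * (y - a * p) * (a ^+ K + (p * y) ^+ K) * ((a * p) ^+ L + y ^+ L) =
  (m (K + L) L.+1 1 + m K 1 L.+1 + m L (K + L).+1 K.+1 + m 0 K.+1 (K + L).+1) -
  (m (K + L).+1 L.+2 0 + m K.+1 2 L + m L.+1 (K + L).+2 K + m 1 K.+2 (K + L)).
Proof. by rewrite /m !exprMn !exprS !exprD; ring. Qed.
End Expand.

Lemma Dk_eq0 a b c : ~~ ((a == c) && (b <= a)%N) -> Dk ('X_i4 ^+ a * 'X_i5 ^+ b * 'X_i6 ^+ c) = 0.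
Proof. by rewrite Dk_mono => /negPf ->; rewrite mul0r. Qed.

(** For k > 0 only the products of alpha^k and y^l survive: the factor p y pairs k with l + 1, and -
    alpha p^2 pairs k with l - 1. Every other term has unequal exponents of alpha and y, or more
    factors p than alpha. *)
Lemma Dk_kl (k l : nat) :
  Dk ('X_i5 * ('X_i6 - 'X_i4 * 'X_i5) *
      (if k == 0%N then 1 else 'X_i4 ^+ k + ('X_i5 * 'X_i6) ^+ k) *
      (if l == 0%N then 1 else ('X_i4 * 'X_i5) ^+ l + 'X_i6 ^+ l)) = spoly (Gk 'X_iR k l).
Proof.
have spG k' l' : spoly (Gk 'X_iR k'.+1 l') = X iR ^+ k'.+1 * ((l' == k')%:R - X iR * (l' == k'.+2)%:R).
  by rewrite rmorphM rmorphXn rmorphB rmorphM /= !rmorph_nat.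
case: k l => [|k] [|l]; rewrite ?spG ?rmorph0 /=.
- by rewrite kernel00 DkB !Dk_eq0 ?subrr.
- rewrite kernel0 DkB !DkD !Dk_eq0 ?addr0 ?subrr //; clear; lia.
- rewrite kernel1 DkB !DkD [Dk (_ ^+ k.+1 * _ * _)]Dk_mono !Dk_eq0 /= ?andbF //; try by clear; lia.
  by rewrite mulr0 ?addr0 ?subr0 ?addr0 ?subr0 andbT eqSS eq_sym mulrC.
rewrite kernel2 DkB !DkD [Dk ('X_i4 ^+ k.+1 * 'X_i5 ^+ 1 * _)]Dk_mono.
rewrite [Dk ('X_i4 ^+ k.+2 * 'X_i5 ^+ 2 * _)]Dk_mono !Dk_eq0; try by clear; lia.
rewrite !add0r !addr0 /= !andbT !eqSS mulrBr [k.+1 == l]eq_sym [k == _]eq_sym.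
by rewrite mulrC [X in _ - X]mulrC mulrA -exprSr.
Qed.

Lemma Dk_bt m n : Dk ('X_i5 * ('X_i6 - 'X_i4 * 'X_i5) * v1 ^+ m * v2 ^+ n) = spoly (bt 'X_iR 'X_iS m n).
Proof.
pose K := (m + n).+2.
rewrite (@v1_exp m K.+1) ?(@v2_exp n K.+1); try by rewrite /K; clear; lia.
rewrite [X in Dk (X * _)]mulr_sumr mulr_suml Dk_sum.
rewrite -(@bt_Gk _ 'X_iR 'X_iS m n K); try by rewrite /K; clear; lia.
rewrite rmorph_sum; apply: eq_bigr => k _; rewrite mulr_sumr Dk_sum rmorph_sum; apply: eq_bigr => l _ /=.
rewrite [in RHS]rmorphM /= -Dk_kl -[X in spoly X * _]/(Ee m k * Ee n l) -Dk_iota [iota (_ * _)]rmorphM /=; congr Dk.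
move: (iota (Ee m k)) (iota (Ee n l)) (_ - _) (if _ then _ else _) (if _ then _ else _) => x1 x2 x3 x4 x5.
move: ('X_i5) => x6.
have E (A : comNzRingType) (a b c d e f : A) :
  f * c * (a * d) * (b * e) = a * b * (f * c * d * e) by ring.
exact: (E ({mpoly rat[7]} : comNzRingType)).
Qed.

Lemma trunc_eqF k N (f : series k) : eqF N f (spoly (trunc N f)).
Proof. by move=> m hm; rewrite serBE /spoly mcoeff_trunc hm subrr. Qed.

Lemma comp_cong k j (a : 'I_k -> series j) N f g : eqF N f g -> eqF N (comp a f) (comp a g).
Proof. by move=> h; rewrite /eqF -rmorphB; apply: comp_inF. Qed.

Lemma Diag_cong N F G : eqF (3 * N) F G -> eqF N (Diag F) (Diag G).
Proof. by move=> h; rewrite /eqF -DiagB; apply: Diag_inF. Qed.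

Lemma eqF_eq k (f g : series k) : (forall N, eqF N f g) -> f = g.
Proof. exact: inF_eq. Qed.

(** * Embeddings, substitution for v, and expansions in v *)

Definition emb k (h : (3 <= k)%N) : series 3 -> series k := comp (fun i => X (widen_ord h i)).
HB.instance Definition _ k h := GRing.RMorphism.on (@emb k h).
Notation to4 := (@emb 4 isT).
Notation to5 := (@emb 5 isT).
Notation to7 := (@emb 7 isT).

Lemma emb_X k (h : (3 <= k)%N) i : emb h (X i) = X (widen_ord h i).
Proof. by rewrite /emb comp_X //; apply: inF_X. Qed.


Lemma Diag_emb f F : Diag (to7 f * F) = to5 f * Diag F.
Proof.
have hp p : Diag (to7 (spoly p) * F) = to5 (spoly p) * Diag F.
  rewrite /emb !(@comp_psub _ _ (fun i => 'X_(widen_ord _ i))) ; try by move=> i; apply: inF_X.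
  rewrite -Diag_iota; congr (Diag (spoly _ * _)); rewrite /iota.
  elim/mpoly_ind': p => [c|i|p q hp hq|p q hp hq].
  - by rewrite !psubC.
  - rewrite !psubX /iotaX /= (leq_trans (ltn_ord i)) //; congr 'X_ _; exact: val_inj.
  - by rewrite !rmorphD /= hp hq.
  - by rewrite !rmorphM /= hp hq.
apply: eqF_eq => N; set N3 := (3 * N)%N.
apply: (@eqF_trans _ _ (Diag (to7 (spoly (trunc N3 f)) * F))).
  by apply: Diag_cong; apply: eqFMl; apply: comp_cong; apply: trunc_eqF.
rewrite hp; apply: eqFMl; apply: (@eqF_le _ N3); first by rewrite /N3; clear; lia.
by apply: eqF_sym; apply: comp_cong; apply: trunc_eqF.
Qed.

Definition ax (v : {mpoly rat[7]}) (i : 'I_4) : {mpoly rat[7]} :=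
  if (i < 3)%N then 'X_(widen_ord (isT : (4 <= 7)%N) i) else v.
Definition sub v : series 4 -> series 7 := comp (fun i => spoly (ax v i)).
HB.instance Definition _ v := GRing.RMorphism.on (sub v).

Lemma inF_ax v : inF 1 (spoly v) -> forall i, inF 1 (spoly (ax v i)).
Proof. by move=> hv i; rewrite /ax; case: ifP => _ //; apply: inF_X. Qed.

Lemma sub_to4 v f : inF 1 (spoly v) -> sub v (to4 f) = to7 f.
Proof.
move=> hv; rewrite /sub /emb comp_comp => [|i]; last exact: inF_X.
apply: eq_comp => i; rewrite comp_X; last exact: inF_ax.
by rewrite /ax /= ltn_ord; congr (spoly 'X_ _); exact: val_inj.
Qed.

Lemma sub_v v : inF 1 (spoly v) -> sub v (X var_v) = spoly v.
Proof. by move=> hv; rewrite /sub comp_X; [|exact: inF_ax]. Qed.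

Lemma sub_dfin v (c : 'I_7 -> {mpoly rat[4]}) f : inF 1 (spoly v) ->
  (forall i : 'I_4, (i < 3)%N -> c (widen_ord (isT : (4 <= 7)%N) i) = 'X_i) -> psub c v = 'X_var_v ->
  dfin f -> dfin (sub v f).
Proof.
move=> hv hc hcv; apply: dfin_comp; first exact: inF_ax.
apply: (can_inj (g := psub c)) => p; elim/mpoly_ind': p => [a|i|p q hp hq|p q hp hq].
- by rewrite !psubC.
- rewrite psubX /ax; case: ifP => hi; first by rewrite psubX hc.
  rewrite hcv; congr 'X_ _; apply: val_inj => /=; have := ltn_ord i; move: hi; clear; lia.
- by rewrite !rmorphD /= hp hq.
- by rewrite !rmorphM /= hp hq.
Qed.

(** A common left inverse of both substitutions: with alpha, p, y set to 0 and S to v, each of [v1]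
    and [v2] becomes v. *)
Definition cx (i : 'I_7) : {mpoly rat[4]} :=
  if (i < 4)%N then 'X_(inord i) else 0.

Lemma cx_low (i : 'I_4) : cx (widen_ord (isT : (4 <= 7)%N) i) = 'X_i.
Proof. by rewrite /cx /= ltn_ord; congr 'X_ _; apply: val_inj; rewrite /= inordK. Qed.
Lemma cx_S : cx (low iS) = 'X_var_v.
Proof. by rewrite /cx /=; congr 'X_ _; apply: val_inj; rewrite /= inordK. Qed.

Lemma inF_v1 : inF 1 (spoly v1).
Proof. by rewrite /v1 !rmorphD rmorphM; do 2?apply: inFD; [exact: inF_X..|apply: inFMl; exact: inF_X]. Qed.
Lemma inF_v2 : inF 1 (spoly v2).
Proof. by rewrite /v2 !rmorphD rmorphM; do 2?apply: inFD; [apply: inFMl|..]; exact: inF_X. Qed.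

Lemma dfin_v1 f : dfin f -> dfin (sub v1 f).
Proof.
apply: (@sub_dfin _ cx) => [|i _|]; [exact: inF_v1 | exact: cx_low |].
by rewrite /v1 !rmorphD rmorphM /= !psubX cx_S /cx /= add0r mul0r addr0.
Qed.
Lemma dfin_v2 f : dfin f -> dfin (sub v2 f).
Proof.
apply: (@sub_dfin _ cx) => [|i _|]; [exact: inF_v2 | exact: cx_low |].
by rewrite /v2 !rmorphD rmorphM /= !psubX cx_S /cx /= mul0r add0r addr0.
Qed.

(* The expansion f = sum_n c_n v^n with c_n in Q[[z, u, t]]. *)
Definition vexp (f : series 4) (c : nat -> series 3) :=
  forall K, eqF K f (\sum_(n < K) to4 (c n) * X var_v ^+ n).

Lemma sub_vexp v f c K : inF 1 (spoly v) -> vexp f c ->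
  eqF K (sub v f) (\sum_(n < K) to7 (c n) * spoly (v ^+ n)).
Proof.
move=> hv h; apply: eqF_trans (comp_cong _ (h K)) _.
rewrite -/(sub v _) rmorph_sum /= (eq_bigr (fun n : 'I_K => to7 (c n) * spoly (v ^+ n))) => [|n _]; first exact: eqF_refl.
by rewrite rmorphM rmorphXn /= sub_to4 // sub_v // rmorphXn.
Qed.

Lemma Diag_vexp v f c P N K : inF 1 (spoly v) -> vexp f c -> (3 * N <= K)%N ->
  eqF N (Diag (P * sub v f)) (\sum_(n < K) to5 (c n) * Diag (P * spoly (v ^+ n))).
Proof.
move=> hv h hK; rewrite (_ : \sum_(n < K) _ = Diag (P * \sum_(n < K) to7 (c n) * spoly (v ^+ n))).
  by apply: Diag_cong; apply: eqFMr; apply: eqF_le hK _; apply: sub_vexp.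
by rewrite mulr_sumr Diag_sum; apply: eq_bigr => n _; rewrite mulrCA Diag_emb.
Qed.

Lemma Diag_vexp2 v w f g c d (P : series 7) N K : inF 1 (spoly v) -> inF 1 (spoly w) -> vexp f c -> vexp g d -> (3 * N <= K)%N ->
  eqF N (Diag (P * sub v f * sub w g))
    (\sum_(m < K) \sum_(n < K) to5 (c m) * to5 (d n) * Diag (P * spoly (v ^+ m) * spoly (w ^+ n))).
Proof.
move=> hv hw hf hg hK; have E (p x y z : series 7) : p * (x * y) * z = x * (p * z * y).
  have E0 (A : comNzRingType) (p' x' y' z' : A) : p' * (x' * y') * z' = x' * (p' * z' * y') by ring.
  exact: (E0 (series 7 : comNzRingType)).
apply: (eqF_trans (Diag_vexp _ hw hg hK)).
rewrite (_ : \sum_(n < K) _ = Diag (P * (\sum_(n < K) to7 (d n) * spoly (w ^+ n)) * sub v f)).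
  apply: (eqF_trans (Diag_vexp _ hv hf hK)).
  rewrite (_ : \sum_(n < K) _ = \sum_(m < K) \sum_(n < K) to5 (c m) * to5 (d n) * Diag (P * spoly (v ^+ m) * spoly (w ^+ n))).
    exact: eqF_refl.
  apply: eq_bigr => m _; rewrite mulr_sumr mulr_suml Diag_sum mulr_sumr; apply: eq_bigr => n _.
  by rewrite E Diag_emb mulrA.
rewrite mulr_sumr mulr_suml Diag_sum; apply: eq_bigr => n _.
by rewrite E Diag_emb.
Qed.

Lemma restr3E m i : restr3 m i = m (widen_ord (leqnSn 3) i).
Proof. by rewrite mnmE. Qed.

Lemma case4 (P : 'I_4 -> Prop) : (forall i : 'I_3, P (widen_ord (leqnSn 3) i)) -> P var_v -> forall i, P i.
Proof.
move=> h hv i; case: (ltnP i 3) => hi.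
  by have := h (Ordinal hi); rewrite (_ : widen_ord _ _ = i) //; apply: val_inj.
rewrite (_ : i = var_v) //; apply: val_inj => /=; have := ltn_ord i; move: hi; clear; lia.
Qed.

Lemma widen_var_v i : widen_ord (leqnSn 3) i == var_v = false.
Proof. by rewrite -val_eqE /=; have := ltn_ord i; case: eqP => // ->. Qed.

Lemma emb_cst k (h : (3 <= k)%N) c : emb h (cst 3 c) = cst k c.
Proof. exact: comp_cst. Qed.

Lemma to4_coef f m : to4 f m = if m var_v == 0%N then f (restr3 m) else 0.
Proof.
have [N hN] : exists N, (mdeg m < N)%N by exists (mdeg m).+1.
have := comp_cong (fun i => X (widen_ord (isT : (3 <= 4)%N) i)) (@trunc_eqF _ N f) hN.
rewrite serBE => /eqP; rewrite subr_eq0 => /eqP; rewrite -!/(to4 _) => ->.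
pose ex (e : 'X_{1..3}) : 'X_{1..4} := [multinom if (i < 3)%N then e (inord i) else 0%N | i < 4].
have to4m e : to4 (spoly 'X_[e]) = spoly 'X_[ex e].
  rewrite /emb (@comp_psub _ _ (fun i => 'X_(widen_ord _ i))); last by move=> i; apply: inF_X.
  congr spoly; rewrite (mpolyXE_id _ e) rmorph_prod mpolyXE_id [RHS]big_ord_recr /= [ex e _]mnmE /= expr0 mulr1.
  apply: eq_bigr => i _; rewrite rmorphXn /= psubX mnmE /= ltn_ord; congr (_ ^+ e _).
  by apply: val_inj; rewrite /= inordK.
have exE e : (m == ex e) = (m var_v == 0%N) && (restr3 m == e).
  apply/eqP/andP => [->|[/eqP mv /eqP <-]].
    rewrite mnmE /=; split=> //; apply/eqP/mnmP => i; rewrite !mnmE /= ltn_ord; congr (e _).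
    by apply: val_inj; rewrite /= inordK.
  apply/mnmP; apply: case4 => [i|]; rewrite mnmE ?mv //= ltn_ord mnmE; congr (m _).
  by apply: val_inj; rewrite /= inordK.
have -> p : to4 (spoly p) m = if m var_v == 0%N then p@_(restr3 m) else 0.
  rewrite {1}[p]mpolyE !rmorph_sum ser_sumE.
  transitivity (\sum_(e <- msupp p) p@_e * (m == ex e)%:R).
    by apply: eq_bigr => e _; rewrite -mul_mpolyC !rmorphM /= -/(cst 3 _) emb_cst cstM to4m spolyX.
  case: eqP => mv; last by rewrite big1 // => e _; rewrite exE (introF eqP mv) mulr0.
  rewrite [in RHS](mpolyE p) raddf_sum /=; apply: eq_bigr => e _.
  by rewrite mcoeffZ mcoeffX exE mv /= eq_sym.
case: ifP => // _; rewrite mcoeff_trunc (leq_ltn_trans _ hN) //.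
by rewrite !mdegE [leqRHS]big_ord_recr /=; under eq_bigr => i _ do rewrite mnmE; apply: leq_addr.
Qed.

Lemma to4_mono f n m : (to4 f * X var_v ^+ n) m = if m var_v == n then f (restr3 m) else 0.
Proof.
rewrite /X -rmorphXn mpolyXn mulrC monoM.
have -> : (U_(var_v) *+ n <= m)%MM = (n <= m var_v)%N.
  apply/mnm_lepP/idP => [/(_ var_v)|h]; first by rewrite mulmnE mnm1E eqxx mul1n.
  by apply: case4 => [i|]; rewrite mulmnE mnm1E ?eqxx ?mul1n // eq_sym widen_var_v.
case: ltngtP => h //; rewrite to4_coef mnmBE mulmnE mnm1E eqxx mul1n.
  by rewrite subn_eq0 leqNgt h.
rewrite h subnn /=; congr f; apply/mnmP => i.
by rewrite !restr3E mnmBE mulmnE mnm1E eq_sym widen_var_v subn0.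
Qed.

Lemma vexp_coef (f : series 4) (c : nat -> series 3) : (forall m, f m = c (m var_v) (restr3 m)) -> vexp f c.
Proof.
move=> h K m hm; apply/eqP; rewrite serBE subr_eq0 h ser_sumE.
have hK : (m var_v < K)%N by apply: leq_ltn_trans hm; rewrite mdegE (bigD1 var_v) //= leq_addr.
under eq_bigr => n _ do rewrite to4_mono.
rewrite (bigD1 (Ordinal hK)) //= eqxx big1 ?addr0 // => i.
by rewrite -val_eqE /= eq_sym => /negPf ->.
Qed.

Lemma vexpB f c g d : vexp f c -> vexp g d -> vexp (f - g) (fun n => c n - d n).
Proof.
move=> hf hg K; under eq_bigr => n _ do rewrite rmorphB mulrBl.
by rewrite sumrB; apply: eqFB.
Qed.

Lemma vexp_scale a f c : vexp f c -> vexp (to4 a * f) (fun n => a * c n).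
Proof.
move=> hf K; under eq_bigr => n _ do rewrite rmorphM -mulrA.
by rewrite -mulr_sumr; apply: eqFMr.
Qed.

Lemma vexp_X : vexp (X var_v) (fun n => (n == 1%N)%:R).
Proof.
move=> K; case: K => [|[|K]]; first exact: inF00.
  by rewrite big_ord1 rmorph0 mul0r; apply: eqF0; apply: inF_X.
rewrite 2!big_ord_recl big1 => [|i _]; last by rewrite rmorph0 mul0r.
by rewrite rmorph0 rmorph1 mul0r mul1r add0r addr0; apply: eqF_refl.
Qed.

Definition gv (g : nat -> series 3) : series 4 := fun m => g (m var_v).+1 (restr3 m).
Lemma vexp_gv g : vexp (gv g) (fun n => g n.+1).
Proof. exact: vexp_coef. Qed.

Lemma gen_vE g : gen_v g = X var_v * gv g.
Proof.
apply: serP => m; rewrite monoM lep1mP /gen_v lt0n; case: eqP => //= h.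
rewrite /gv mnmBE mnm1E eqxx subn1 prednK ?lt0n; last exact/eqP.
by congr (g _ _); apply/mnmP => i; rewrite !restr3E mnmBE mnm1E eq_sym widen_var_v subn0.
Qed.

Lemma dfin_gv g : holonomic (gen_v g) -> dfin (gv g).
Proof. by move/dfin_holonomic; rewrite gen_vE; apply: dfin_div; apply: mX_neq0. Qed.

Definition psi4 g : series 4 := X var_v - to4 (X var_t * X var_u) * gv g.
Lemma vexp_psi4 g : vexp (psi4 g) (psi g).
Proof. exact: vexpB vexp_X (vexp_scale _ (vexp_gv g)). Qed.
Lemma dfin_psi4 g : dfin (gv g) -> dfin (psi4 g).
Proof.
move=> h; rewrite /psi4 -mulNr -rmorphN; apply: dfin_D; first exact: dfin_poly.
apply: dfin_M => //; rewrite rmorphN rmorphM /= !emb_X -rmorphM -rmorphN; exact: dfin_poly.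
Qed.

Definition E0 g := Diag (sub v1 (gv g)).
Definition Em g := Diag (spoly ('X_i5 * 'X_i6) * sub v1 (gv g)).
(** The additional factor [v2] corrects an index: [gv h] attaches h_(l+1) to v^l, whereas the kernel
    is wanted at l + 1. *)
Definition BB g h := Diag (kap * spoly ('X_i5 * ('X_i6 - 'X_i4 * 'X_i5) * v2) * sub v1 (psi4 g) * sub v2 (gv h)).

(** * Specialization of S and R *)

Section Sigma.
Variables (R S : series 3).
Hypotheses (R1 : inF 1 R) (S1 : inF 1 S).
Definition sg (i : 'I_5) : series 3 := if (i < 3)%N then X (inord i) else if i == iS then S else R.
Definition sigma := comp sg.
HB.instance Definition _ := GRing.RMorphism.on sigma.

Lemma inF_sg i : inF 1 (sg i).
Proof. by rewrite /sg; do 2?case: ifP => // _; apply: inF_X. Qed.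
Lemma sigma_to5 f : sigma (to5 f) = f.
Proof.
rewrite /sigma /emb comp_comp => [|i]; last exact: inF_X.
rewrite -[RHS]comp_id; apply: eq_comp => i; rewrite comp_X; last exact: inF_sg.
by rewrite /sg /= ltn_ord; congr X; apply: val_inj; rewrite /= inordK.
Qed.
Lemma sigma_S : sigma (X iS) = S. Proof. by rewrite /sigma comp_X //; exact: inF_sg. Qed.
Lemma sigma_R : sigma (X iR) = R. Proof. by rewrite /sigma comp_X //; exact: inF_sg. Qed.
Lemma sigma_Ee m k : sigma (spoly (Ee m k)) = ee R S m k.
Proof.
rewrite /Ee ee_rmorph /= -!/(X _) ee_rmorph /=.
by rewrite sigma_S sigma_R.
Qed.
Lemma sigma_bt m n : sigma (spoly (bt 'X_iR 'X_iS m n)) = bt R S m n.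
Proof.
rewrite /bt !rmorph_sum; apply: eq_bigr => k _ /=; rewrite /MM.
rewrite !(rmorphM, rmorphB, rmorphXn) /= -!/(Ee _ _).
by rewrite -!/(X _) sigma_R !sigma_Ee.
Qed.

Variables (g h : nat -> series 3) (N K : nat).
Hypothesis hK : (3 * N <= K)%N.

Lemma sigma_E0 : eqF N (sigma (E0 g)) (\sum_(n < K) g n.+1 * ee R S n 0).
Proof.
have := Diag_vexp 1 inF_v1 (vexp_gv g) hK; rewrite mul1r => /(comp_cong sg).
rewrite -!/(sigma _) rmorph_sum /=; congr eqF; apply: eq_bigr => n _.
by rewrite mul1r Diag_v1 rmorphM /= sigma_to5 sigma_Ee.
Qed.

Lemma sigma_Em : eqF N (sigma (Em g)) (\sum_(n < K) g n.+1 * (R * ee R S n 1)).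
Proof.
have := Diag_vexp (spoly ('X_i5 * 'X_i6)) inF_v1 (vexp_gv g) hK => /(comp_cong sg).
rewrite -!/(sigma _) rmorph_sum /=; congr eqF; apply: eq_bigr => n _.
by rewrite -rmorphM Diag_v1' !rmorphM /= sigma_to5 sigma_R sigma_Ee.
Qed.

Lemma sigma_BB : eqF N (sigma (BB g h)) (\sum_(l < K) h l.+1 * ws R S K (psi g) l.+1).
Proof.
have := Diag_vexp2 (kap * spoly ('X_i5 * ('X_i6 - 'X_i4 * 'X_i5) * v2)) inF_v1 inF_v2 (vexp_psi4 g) (vexp_gv h) hK.
move=> /(comp_cong sg); rewrite -!/(sigma _) rmorph_sum /=; congr eqF.
rewrite /ws; under [RHS]eq_bigr => l _ do rewrite mulr_sumr.
rewrite [RHS]exchange_big; apply: eq_bigr => m _; rewrite rmorph_sum; apply: eq_bigr => n _ /=.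
have assoc (a b c : {mpoly rat[7]}) : kap * spoly a * spoly b * spoly c = kap * spoly (a * b * c).
  by rewrite !(rmorphM (@spoly 7)) /= !mulrA.
rewrite assoc.
have -> : 'X_i5 * ('X_i6 - 'X_i4 * 'X_i5) * v2 * v1 ^+ m * v2 ^+ n =
  'X_i5 * ('X_i6 - 'X_i4 * 'X_i5) * v1 ^+ m * v2 ^+ n.+1.
  by rewrite exprS !mulrA [_ * v2 * v1 ^+ m]mulrAC.
by rewrite [Diag _]Dk_bt !rmorphM /= !sigma_to5 sigma_bt -mulrA mulrCA.
Qed.
End Sigma.

(** The coefficient at m is constant from stage [(mdeg m).+1] on. *)
Lemma lim_exists k (a : nat -> series k) : (forall n i, eqF n (a n) (a (n + i)%N)) ->
  exists L, forall N, eqF N L (a N).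
Proof.
move=> h; exists (fun m => a (mdeg m).+1 m) => N m hm.
by have := h (mdeg m).+1 (N - (mdeg m).+1)%N m (ltnSn _); rewrite !serBE subnKC.
Qed.

(** * The series R and S as a fixed point *)

Section FixedPoint.
Variables (g : nat -> series 3).

Let step (x : series 3 * series 3) : series 3 * series 3 :=
  (X var_z * X var_t + X var_t * X var_u * sigma x.1 x.2 (Em g), X var_t * X var_u * sigma x.1 x.2 (E0 g)).
Let it n := iter n step (0, 0).

Let eqF2 N (x y : series 3 * series 3) := eqF N x.1 y.1 /\ eqF N x.2 y.2.
Let in1 (x : series 3 * series 3) := inF 1 x.1 /\ inF 1 x.2.

Lemma step_in1 x : in1 (step x).
Proof.
split; last by rewrite /= -mulrA; apply: inFMl; apply: inF_X.
by apply: inFD; [|rewrite -mulrA]; apply: inFMl; apply: inF_X.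
Qed.

Lemma sigma_eqP N x y F : in1 x -> in1 y -> eqF2 N x y -> eqF N (sigma x.1 x.2 F) (sigma y.1 y.2 F).
Proof.
move=> [x1 x2] [y1 y2] [e1 e2]; apply: comp_eqF => i; [exact: inF_sg..|].
by rewrite /sg; do 2?case: ifP => // _; apply: eqF_refl.
Qed.

Lemma step_eqP N x y : in1 x -> in1 y -> eqF2 N x y -> eqF2 N.+1 (step x) (step y).
Proof.
move=> hx hy h.
have gain F G : eqF N F G -> eqF N.+1 (X var_t * X var_u * F) (X var_t * X var_u * G).
  move=> e; rewrite /eqF -mulrBr -mulrA -[N.+1]add1n; apply: inFM; first exact: inF_X.
  exact: inFMr.
split=> /=; last by apply: gain; apply: sigma_eqP.
by apply: eqFD; [exact: eqF_refl | apply: gain; apply: sigma_eqP].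
Qed.

Lemma it_in1 n : in1 (it n).
Proof. by case: n => [|n]; [split | exact: step_in1]. Qed.

Lemma it_stable n k : eqF2 n (it n) (it (n + k)).
Proof.
elim: n k => [|n IH] k; first by split; apply: inF00.
by apply: step_eqP (IH k); apply: it_in1.
Qed.

(** The factor t u makes [step] a contraction for the order, so its iterates from (0, 0) converge
    and the limit is fixed. *)
Theorem RS_exist : exists R S : series 3, [/\ inF 1 R, inF 1 S,
  S = X var_t * X var_u * sigma R S (E0 g)
  & R = X var_z * X var_t + X var_t * X var_u * sigma R S (Em g)].
Proof.
have [R hR] := lim_exists (fun n k => proj1 (it_stable n k)).
have [S hS] := lim_exists (fun n k => proj2 (it_stable n k)).
pose lim := (R, S); have hlim N : eqF2 N lim (it N) by split.
have in1lim : in1 lim.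
  have [h1 h2] := hlim 1%N; have [k1 k2] := it_in1 1.
  by split; [rewrite -(subrK (it 1).1 lim.1) | rewrite -(subrK (it 1).2 lim.2)]; apply: inFD.
have fix_ : step lim = lim.
  have h N : eqF2 N (step lim) lim.
    have [e1 e2] := step_eqP in1lim (it_in1 N) (hlim N).
    have [k1 k2] := hlim N.+1.
    by split; apply: (@eqF_le _ N.+1) => //; [apply: eqF_trans e1 (eqF_sym k1) | apply: eqF_trans e2 (eqF_sym k2)].
  rewrite [step lim]surjective_pairing [RHS]surjective_pairing.
  by congr pair; apply: eqF_eq => N; have [] := h N.
exists R, S; have [? ?] := in1lim.
by have [eR eS] := fix_; split.
Qed.

Lemma sigma_C R S h : inF 1 R -> inF 1 S ->
  S = X var_t * X var_u * sigma R S (E0 g) ->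
  R = X var_z * X var_t + X var_t * X var_u * sigma R S (Em g) ->
  sigma R S (BB g h) = X var_t * C_maps g h.
Proof.
move=> R1 S1 eS eR; apply: eqF_eq => N; apply: (@eqF_le _ N.+2); first by rewrite !leqW.
(* The length 3 (N + 2) serves both sides: it allows for the factor 3 lost by the diagonal and
   exceeds the degree bound 2 (N + 1). *)
have hK : (3 * N.+2 <= 3 * N.+2)%N by [].
apply: (eqF_trans (sigma_BB R1 S1 g h hK)); apply: eqF_sym; apply: tC_formula => //.
- by clear; lia.
- by rewrite {1}eS; apply: eqFMr; apply: sigma_E0.
by rewrite {1}eR; apply: eqFD; [exact: eqF_refl | apply: eqFMr; apply: sigma_Em].
Qed.
End FixedPoint.

(** * Differential algebraicity *)

(* The diagonal intertwines alpha d/dalpha with R d/dR, but d/dR with no derivation. *)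
Definition eul (i : 'I_5) (f : series 5) : series 5 := if i == iR then X i * sderiv i f else sderiv i f.

Lemma eul_deriv i : deriv (eul i).
Proof.
split=> [x y|x y|c]; rewrite /eul; case: ifP => _.
- by rewrite raddfD mulrDr.
- by rewrite raddfD.
- by rewrite sderivM mulrDr mulrA [X in _ + X]mulrCA.
- exact: sderivM.
- by rewrite sderiv_cst mulr0.
- exact: sderiv_cst.
Qed.

Lemma eulC i j f : eul i (eul j f) = eul j (eul i f).
Proof.
rewrite /eul; case: (eqVneq i iR) (eqVneq j iR) => [->|ni] [->|nj] //.
- by rewrite sderivM sderiv_X (negPf nj) mul0r add0r sderiv_comm.
- by rewrite sderivM sderiv_X (negPf ni) mul0r add0r sderiv_comm.
- exact: sderiv_comm.
Qed.

Lemma eul_X i l : exists p, eul i (X l) = spoly p.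
Proof.
rewrite /eul sderiv_X; case: ifP => _; last by exists (i == l)%:R; rewrite rmorph_nat.
by exists ('X_i * (i == l)%:R); rewrite rmorphM rmorph_nat.
Qed.

Lemma Diag_eul i : exists v : 'I_7 -> {mpoly rat[7]},
  forall G, Diag (\sum_l spoly (v l) * sderiv l G) = eul i (Diag G).
Proof.
elim/case5: i => [i hi|].
  have [n4 n5 n6 nR] := low_neq hi.
  exists (fun l => (l == low i)%:R) => G; rewrite (bigD1 (low i)) //= eqxx rmorph1 mul1r.
  rewrite big1 ?addr0 => [|l /negPf ->]; last by rewrite rmorph0 mul0r.
  apply: serP => m; rewrite /eul (negPf nR) /Diag /Ext !sderivE !addn0 mk7_low //; congr (_ * G _).
  have mR : (m + U_(i))%MM iR = m iR by rewrite mnmDE mnm1E (negPf nR) addn0.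
  apply/mnmP; apply: case7 => [j hj|||]; rewrite mnmDE mnm1E mR.
  - by rewrite !mk7_low // mnmDE mnm1E.
  - by rewrite !mk7_4 (negPf n4) addn0.
  - by rewrite !mk7_5 (negPf n5) addn0.
  - by rewrite !mk7_6 (negPf n6) addn0.
exists (fun l => if l == i4 then 'X_i4 else 0) => G; rewrite (bigD1 i4) //=.
rewrite big1 ?addr0 => [|l /negPf ->]; last by rewrite rmorph0 mul0r.
by apply: serP => m; rewrite /eul eqxx /Diag /Ext -/(X i4) !eulerE !addn0 mk7_4.
Qed.

Lemma comp_ev k m j (a : 'I_k -> series j) (f : 'I_m -> series k) P :
  comp a (ev f P) = ev (fun i => comp a (f i)) P.
Proof.
elim/mpoly_ind': P => [c|i|p q hp hq|p q hp hq].
- by rewrite !evC comp_cst.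
- by rewrite !evX.
- by rewrite !rmorphD /= hp hq.
- by rewrite !rmorphM /= hp hq.
Qed.

Lemma ev_psub k m j (a : 'I_m -> series k) (c : 'I_j -> {mpoly rat[m]}) P :
  ev a (psub c P) = ev (fun i => ev a (c i)) P.
Proof.
elim/mpoly_ind': P => [b|i|p q hp hq|p q hp hq].
- by rewrite psubC !evC.
- by rewrite psubX evX.
- by rewrite !rmorphD /= hp hq.
- by rewrite !rmorphM /= hp hq.
Qed.

Lemma spowE k (f : series k) n : spow f n = f ^+ n.
Proof. by elim: n => // n IH; rewrite exprS -IH. Qed.

Lemma sevalE k j (P : {mpoly rat[k]}) (a : 'I_k -> series j) : seval P a = ev a P.
Proof.
rewrite /seval sum_seriesE big_map evE; apply: eq_bigr => e _.
apply: serP => m; rewrite cstM /sscale; congr (_ * _ m).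
rewrite sfoldE big_map big_enum_cond /=; apply: eq_big => // i _; exact: spowE.
Qed.

Lemma sderiv_exp k i (f : series k) n : f * sderiv i (f ^+ n) = n%:R * sderiv i f * f ^+ n.
Proof.
elim: n => [|n IH]; first by rewrite expr0 sderiv1 mulr0 !mul0r.
rewrite exprS sderivM mulrDr IH -natr1.
have E (A : comNzRingType) (x y z t : A) : x * (y * z) + x * (t * y * z) = (t + 1) * y * (x * z) by ring.
exact: (E (series k : comNzRingType)).
Qed.

Lemma cramer2 (A : comNzRingType) (a b c d i u v : A) :
  a * u + b * v = 0 -> c * u + d * v = 0 -> (a * d - b * c) * i = 1 -> u = 0 /\ v = 0.
Proof.
move=> h1 h2 h; rewrite -[u]mul1r -[v]mul1r -h; split.
  have -> : (a * d - b * c) * i * u = i * (d * (a * u + b * v) - b * (c * u + d * v)) by ring.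
  by rewrite h1 h2 !mulr0 subr0 mulr0.
have -> : (a * d - b * c) * i * v = i * (a * (c * u + d * v) - c * (a * u + b * v)) by ring.
by rewrite h1 h2 !mulr0 subr0 mulr0.
Qed.

(** * Lifting a derivation through the specialization *)

Section Lift.
Variables (g : nat -> series 3) (R S : series 3) (tau : 'I_3).
Hypotheses (R1 : inF 1 R) (S1 : inF 1 S).
Hypothesis eS : S = X var_t * X var_u * sigma R S (E0 g).
Hypothesis eR : R = X var_z * X var_t + X var_t * X var_u * sigma R S (Em g).

Let sig := sigma R S.
Let tau5 : 'I_5 := widen_ord (isT : (3 <= 5)%N) tau.

Lemma sigma_deriv F : sderiv tau (sig F) =
  sig (sderiv tau5 F) + sig (sderiv iS F) * sderiv tau S + sig (sderiv iR F) * sderiv tau R.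
Proof.
rewrite /sig /sigma comp_deriv => [|l]; last exact: inF_sg.
have n1 : iR != iS by [].
have n2 : tau5 != iS by rewrite -val_eqE /=; have := ltn_ord tau; case: eqP => // ->.
have n3 : tau5 != iR by rewrite -val_eqE /=; have := ltn_ord tau; case: eqP => // ->.
rewrite (bigD1 iS) //= (bigD1 iR) //= (bigD1 tau5) /=; last by rewrite n2 n3.
rewrite big1 ?addr0 => [|l /andP [/andP [lS lR] lt]].
  have -> : sg R S tau5 = X tau.
    by rewrite /sg /= ltn_ord; congr X; apply: val_inj; rewrite /= inordK.
  by rewrite sderiv_X eqxx mulr1 [LHS]addrA [LHS]addrC [LHS]addrA.
have l3 : (l < 3)%N.
  by move: lS lR; rewrite -!val_eqE /=; have := ltn_ord l; clear; lia.
rewrite /sg l3 sderiv_X (_ : _ == _ = false) ?mulr0 //.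
apply/eqP => e; move/eqP: lt; apply; apply: val_inj; by rewrite /= e inordK.
Qed.

Let e1 : series 5 := to5 (X var_t * X var_u) * E0 g.
Let e2 : series 5 := to5 (X var_z * X var_t) + to5 (X var_t * X var_u) * Em g.
Let epsS := X iS - e1.
Let epsR := X iR - e2.

Lemma sig_epsS : sig epsS = 0.
Proof. by rewrite /sig /epsS /e1 rmorphB (rmorphM (sigma R S)) /= sigma_S // sigma_to5 // {1}eS subrr. Qed.
Lemma sig_epsR : sig epsR = 0.
Proof. by rewrite /sig /epsR /e2 rmorphB rmorphD (rmorphM (sigma R S)) /= sigma_R // !sigma_to5 // {1}eR subrr. Qed.

(* The derivation d/dtau + x d/dS + y d/dR, with x and y given by Cramer's rule so that it kills
   [epsS] and [epsR], corresponds to d/dtau under the specialization. *)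
Lemma lift_deriv m (b : 'I_m -> series 5) : (forall p, ratp b (spoly p)) ->
  (forall i x, ratp b x -> ratp b (sderiv i x)) -> ratp b (E0 g) -> ratp b (Em g) ->
  exists dd : series 5 -> series 5, (forall x, ratp b x -> ratp b (dd x)) /\
    forall x, sig (dd x) = sderiv tau (sig x).
Proof.
move=> ratX ratD rE0 rEm.
have rX i : ratp b (to5 (X i)) by rewrite emb_X; apply: ratX.
(* Order 2 is what is needed here: the first derivatives of [e1] and [e2] then still have no
   constant term, and the Jacobian determinant is invertible. *)
have tu2 : inF 2 (to5 (X var_t * X var_u)).
  by rewrite rmorphM /= !emb_X; apply: (@inFM _ 1 1); apply: inF_X.
have zt2 : inF 2 (to5 (X var_z * X var_t)).
  by rewrite rmorphM /= !emb_X; apply: (@inFM _ 1 1); apply: inF_X.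
have re1 : ratp b e1 by apply: ratpM => //; rewrite rmorphM; apply: ratpM; apply: rX.
have re2 : ratp b e2.
  by apply: ratpD; [|apply: ratpM => //]; rewrite rmorphM; apply: ratpM; apply: rX.
have f1 i : inF 1 (sderiv i e1) by apply: inF_sderiv; apply: inFMl.
have f2 i : inF 1 (sderiv i e2) by apply: inF_sderiv; apply: inFD => //; apply: inFMl.
have rS : ratp b epsS by apply: ratpB => //; apply: ratX.
have rR : ratp b epsR by apply: ratpB => //; apply: ratX.
set p := sderiv iS e1 in f1; set q := sderiv iR e2.
have dSS : sderiv iS epsS = 1 - p by rewrite (raddfB (@sderiv 5 _)) /= sderiv_X eqxx.
have dRR : sderiv iR epsR = 1 - q by rewrite (raddfB (@sderiv 5 _)) /= sderiv_X eqxx.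
have dRS : sderiv iR epsS = - sderiv iR e1 by rewrite (raddfB (@sderiv 5 _)) /= sderiv_X sub0r.
have dSR : sderiv iS epsR = - sderiv iS e2 by rewrite (raddfB (@sderiv 5 _)) /= sderiv_X sub0r.
pose det := (1 - p) * (1 - q) - sderiv iR e1 * sderiv iS e2.
have [inv hinv] : exists inv, det * inv = 1.
  have -> : det = 1 - (p + q - p * q + sderiv iR e1 * sderiv iS e2).
      have E (A : comNzRingType) (x y z w : A) : (1 - x) * (1 - y) - z * w = 1 - (x + y - x * y + z * w) by ring.
    exact: (E (series 5 : comNzRingType) p q (sderiv iR e1) (sderiv iS e2)).
  by apply: ser_inv; apply: inFD; [apply: inFB; [apply: inFD|]|]; [exact: f1|exact: f2|apply: inFMl; exact: f1..].
have det0 : det != 0.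
  by apply/eqP => d0; move/eqP: hinv; rewrite d0 mul0r eq_sym oner_eq0.
have rdet : ratp b det.
  by apply: ratpB; apply: ratpM; rewrite -?dSS -?dRR; apply: ratD.
have rinv : ratp b inv by apply: (ratp_div det0) => //; rewrite hinv -(rmorph1 (@spoly 5)); apply: ratX.
pose uS := sderiv tau5 epsS; pose uR := sderiv tau5 epsR.
pose x := - inv * ((1 - q) * uS + sderiv iR e1 * uR).
pose y := - inv * ((1 - p) * uR + sderiv iS e2 * uS).
have rx : ratp b x.
  by apply: ratpM; [exact: ratpN | apply: ratpD; apply: ratpM; rewrite -?dRR; do ?apply: ratD].
have ry : ratp b y.
  by apply: ratpM; [exact: ratpN | apply: ratpD; apply: ratpM; rewrite -?dSS; do ?apply: ratD].
pose dd f := sderiv tau5 f + x * sderiv iS f + y * sderiv iR f.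
exists dd; split=> [f hf|].
  by apply: ratpD; [apply: ratpD|]; try apply: ratpM => //; apply: ratD.
have ddS : dd epsS = 0.
  rewrite /dd dSS dRS -/uS -[RHS](subrr (uS * 1)) -{3}hinv /x /y /det.
  have E (A : comNzRingType) (a1 a2 a3 a4 a5 a6 a7 : A) :
    a1 + - a7 * ((1 - a4) * a1 + a5 * a2) * (1 - a3) + - a7 * ((1 - a3) * a2 + a6 * a1) * - a5 =
    a1 * 1 - a1 * (((1 - a3) * (1 - a4) - a5 * a6) * a7) by ring.
  exact: (E (series 5 : comNzRingType) uS uR p q (sderiv iR e1) (sderiv iS e2) inv).
have ddR : dd epsR = 0.
  rewrite /dd dSR dRR -/uR -[RHS](subrr (uR * 1)) -{3}hinv /x /y /det.
  have E (A : comNzRingType) (a1 a2 a3 a4 a5 a6 a7 : A) :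
    a2 + - a7 * ((1 - a4) * a1 + a5 * a2) * - a6 + - a7 * ((1 - a3) * a2 + a6 * a1) * (1 - a4) =
    a2 * 1 - a2 * (((1 - a3) * (1 - a4) - a5 * a6) * a7) by ring.
  exact: (E (series 5 : comNzRingType) uS uR p q (sderiv iR e1) (sderiv iS e2) inv).
(* The defect of [dd] is linear in the errors of the specialized x and y as candidates for the
   derivatives of S and R. It vanishes on [epsS] and [epsR], which gives a homogeneous 2 by 2 system
   with invertible determinant, so both errors are 0. *)
have key F : sig (dd F) - sderiv tau (sig F) =
    sig (sderiv iS F) * (sig x - sderiv tau S) + sig (sderiv iR F) * (sig y - sderiv tau R).
  have sD x' y' f1' f2' f3' : sig (f1' + x' * f2' + y' * f3') = sig f1' + sig x' * sig f2' + sig y' * sig f3'.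
    by rewrite /sig 2!(rmorphD (sigma R S)) 2!(rmorphM (sigma R S)) /=.
  rewrite sigma_deriv /dd sD.
  have E (A : comNzRingType) (b1 b2 b3 b4 b5 b6 b7 : A) :
    b1 + b2 * b3 + b4 * b5 - (b1 + b3 * b6 + b5 * b7) = b3 * (b2 - b6) + b5 * (b4 - b7) by ring.
  exact: (E (series 3 : comNzRingType) (sig (sderiv tau5 F)) (sig x) (sig (sderiv iS F)) (sig y) (sig (sderiv iR F))).
have s0 : sig 0 = 0 by rewrite /sig rmorph0.
have kS := key epsS; have kR := key epsR.
rewrite ddS sig_epsS dSS dRS s0 raddf0 subr0 in kS.
rewrite ddR sig_epsR dSR dRR s0 raddf0 subr0 in kR.
have kdet : (sig (1 - p) * sig (1 - q) - sig (- sderiv iR e1) * sig (- sderiv iS e2)) * sig inv = 1.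
  by rewrite /sig -!rmorphM -rmorphB -rmorphM mulrNN hinv rmorph1.
have [zx zy] := cramer2 (esym kS) (esym kR) kdet.
by move=> F; apply/eqP; rewrite -subr_eq0 key zx zy !mulr0 addr0.
Qed.
End Lift.

Lemma ratp_nat k m (b : 'I_m -> series k) n : ratp b n%:R.
Proof. by rewrite -(rmorph_nat (cst k)); apply: ratp_cst. Qed.

Theorem diff_alg_C (g h : nat -> series 3) (tau : 'I_3) :
  holonomic (gen_v g) -> holonomic (gen_v h) -> diff_alg_wrt tau (C_maps g h).
Proof.
move=> hg hh; have dg := dfin_gv hg; have dh := dfin_gv hh.
have [R [S [R1 S1 eS eR]]] := RS_exist g.
pose Phi (s : 'I_3) := nth 0 [:: E0 g; Em g; BB g h] s.
have ode s j : exists N (c : 'I_N -> {mpoly rat[5]}), (exists i, c i != 0) /\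
     \sum_i spoly (c i) * iter i (eul j) (Phi s) = 0.
  have [v hv] := Diag_eul j.
  have dk : dfin kap.
    apply: (dfin_inv (p := 1 - 'X_i5)); last exact: kapE.
    rewrite -spoly_eq0; apply/eqP => h0; have := kapE; rewrite h0 mul0r => /eqP.
    by rewrite eq_sym oner_eq0.
  case: s => -[|[|[|s]]] hs //; rewrite /Phi /=; apply: (diag_ode hv).
  - exact: dfin_v1.
  - by apply: dfin_M; [exact: dfin_poly | exact: dfin_v1].
  apply: dfin_M; last exact: dfin_v2.
  by apply: dfin_M; [apply: dfin_M => //; exact: dfin_poly | apply: dfin_v1; apply: dfin_psi4].
have [m [b [ratX ratPhi ratE]]] := closure eulC eul_deriv eul_X ode.
(* The closure is under R d/dR; dividing by the nonzero element R of the field gives d/dR itself. *)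
have ratD i x : ratp b x -> ratp b (sderiv i x).
  move=> hx; have := ratE i x hx; rewrite /eul; case: ifP => // /eqP -> hX.
  apply: (ratp_div _ _ hX); last exact: ratX.
  by rewrite spoly_eq0; apply: mX_neq0.
have [dd [ratdd hdd]] := lift_deriv tau R1 S1 eS eR ratX ratD (ratPhi ord0) (ratPhi (lift ord0 ord0)).
pose t' : series 3 := sderiv tau (X var_t).
(* Since t d(t^(i+1) f) - (i + 1) (dt) t^(i+1) f = t^(i+2) df, this recursion specializes to t^(i+1)
   d^i C and never divides by t. *)
pose B := fix B i := if i is j.+1 then to5 (X var_t) * dd (B j) - j.+1%:R * to5 t' * B j else BB g h.
have ratB i : ratp b (B i).
  elim: i => [|i IH]; first exact: (ratPhi (Ordinal (isT : (2 < 3)%N))).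
  apply: ratpB; first by apply: ratpM; [rewrite emb_X; apply: ratX | apply: ratdd].
  apply: ratpM => //; apply: ratpM; first exact: ratp_nat.
  by rewrite /t' sderiv_X rmorph_nat; apply: ratp_nat.
have sigB i : sigma R S (B i) = X var_t ^+ i.+1 * iter i (sderiv tau) (C_maps g h).
  elim: i => [|i IH]; first exact: sigma_C.
  rewrite /= rmorphB !rmorphM /= !sigma_to5 // hdd IH rmorph_nat sderivM.
  have E (A : comNzRingType) (x y z w d n s : A) : x * d = n * s * y ->
      x * (d * z + y * w) - n * s * (y * z) = x * y * w.
    by move=> e; rewrite mulrDr mulrA e; ring.
  rewrite (E (series 3 : comNzRingType)) -?exprS //; exact: sderiv_exp.
have [P [P0 hP]] := @alg_dep _ _ m.+1 b (fun i => B i) (ltnSn m) (fun i => ratB i).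
pose c (i : 'I_m.+1) : {mpoly rat[m.+1 + 3]} := 'X_(rshift m.+1 var_t) ^+ i.+1 * 'X_(lshift 3 i).
exists m, (psub c P); split.
  (* Setting t to 1 inverts the substitution [c], so the polynomial relation remains nonzero after
     the powers of t are inserted. *)
  pose d (i : 'I_(m.+1 + 3)) : {mpoly rat[m.+1]} := if split i is inl l then 'X_l else 1.
  have dc Q : psub d (psub c Q) = Q.
    elim/mpoly_ind': Q => [a|i|p q hp hq|p q hp hq].
    - by rewrite !psubC.
    - rewrite psubX rmorphM rmorphXn /= !psubX /d.
      by rewrite -[lshift 3 i]/(unsplit (inl i)) -[rshift _ _]/(unsplit (inr var_t)) !unsplitK expr1n mul1r.
    - by rewrite !rmorphD /= hp hq.
    - by rewrite !rmorphM /= hp hq.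
  by apply/eqP => h0; move/eqP: P0; rewrite -(dc P) h0 rmorph0.
move=> mm; rewrite sevalE ev_psub.
have := congr1 (sigma R S) hP; rewrite rmorph0 [sigma _ _ _]comp_ev => h0.
rewrite -[RHS]/((0 : series 3) mm) -h0; congr (ev _ P mm); apply: funext => i.
rewrite -[comp _ _]/(sigma R S (B i)) sigB rmorphM rmorphXn /= !evX.
by rewrite -[lshift 3 i]/(unsplit (inl i)) -[rshift _ _]/(unsplit (inr var_t)) !unsplitK svarE.
Qed.

Theorem theorem4p1p1 (g h : nat -> series 3) :
  holonomic (gen_v g) -> holonomic (gen_v h) ->
  diff_alg_wrt var_t (C_maps g h) /\
  diff_alg_wrt var_u (C_maps g h) /\
  diff_alg_wrt var_z (C_maps g h).
Proof. by move=> hg hh; split; [|split]; apply: diff_alg_C. Qed.
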